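(* Let $\mathbb K$ be an algebraically closed field, $n\ge2$, $r,s\in\mathbb K$ nonzero, $r\ne s$, and $\widetilde U=U_{r,s}(\mathfrak{gl}_n)$. For modules $N,N'$ in the category $\mathcal O$ let $R_{N,N'}=\Theta\circ\widetilde f\circ P:N\otimes N'\to N'\otimes N$, and let $R_{12},R_{23}$ denote $R$ applied to the first two, respectively last two, of three tensor factors. Let $M,M',M''$ be in $\mathcal O$. Then the hexagon identities hold, that is, (i) $R_{12}\circ R_{23}=(1\otimes\Delta)(\Theta)\circ\widetilde f'\circ P_{12}\circ P_{23}$ as maps $M\otimes(M'\otimes M'')\to(M''\otimes M)\otimes M'$, and (ii) $R_{23}\circ R_{12}=(\Delta\otimes1)(\Theta)\circ\widetilde f''\circ P_{23}\circ P_{12}$ as maps $(M\otimes M')\otimes M''\to M'\otimes(M''\otimes M)$, where $\widetilde f'$ is the linear operator on $M''\otimes M\otimes M'$ with $\widetilde f'(m''\otimes m\otimes m')=f(\nu,\lambda+\mu)\,m''\otimes m\otimes m'$, and $\widetilde f''$ is the linear operator on $M'\otimes M''\otimes M$ with $\widetilde f''(m'\otimes m''\otimes m)=f(\mu+\nu,\lambda)\,m'\otimes m''\otimes m$, for $m\in M_\lambda$, $m'\in M'_\mu$, $m''\in M''_\nu$; here $P_{12}$, $P_{23}$ are the flips of the indicated adjacent tensor factors.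
   Context: Let $\epsilon_1,\dots,\epsilon_n$ be an orthonormal basis of $\mathbb R^n$ with inner product $\langle\,,\rangle$, $\alpha_j=\epsilon_j-\epsilon_{j+1}$ for $1\le j<n$, $\alpha_n=\epsilon_n$, $\Lambda=\bigoplus_{i=1}^n\mathbb Z\epsilon_i=\bigoplus_{i=1}^n\mathbb Z\alpha_i$, $Q^+=\sum_{i=1}^{n-1}\mathbb Z_{\ge0}\alpha_i$. $\widetilde U=U_{r,s}(\mathfrak{gl}_n)$ is the unital associative $\mathbb K$-algebra generated by $e_j,f_j$ ($1\le j<n$), $a_i^{\pm1},b_i^{\pm1}$ ($1\le i\le n$) with relations: (R1) the $a_i^{\pm1},b_j^{\pm1}$ all commute and $a_ia_i^{-1}=b_jb_j^{-1}=1$; (R2) $a_ie_j=r^{\langle\epsilon_i,\alpha_j\rangle}e_ja_i$, $a_if_j=r^{-\langle\epsilon_i,\alpha_j\rangle}f_ja_i$; (R3) $b_ie_j=s^{\langle\epsilon_i,\alpha_j\rangle}e_jb_i$, $b_if_j=s^{-\langle\epsilon_i,\alpha_j\rangle}f_jb_i$; (R4) $[e_i,f_j]=\frac{\delta_{i,j}}{r-s}(a_ib_{i+1}-a_{i+1}b_i)$; (R5) $[e_i,e_j]=[f_i,f_j]=0$ if $|i-j|>1$; (R6) $e_i^2e_{i+1}-(r+s)e_ie_{i+1}e_i+rs\,e_{i+1}e_i^2=0$, $e_ie_{i+1}^2-(r+s)e_{i+1}e_ie_{i+1}+rs\,e_{i+1}^2e_i=0$; (R7) $f_i^2f_{i+1}-(r^{-1}+s^{-1})f_if_{i+1}f_i+r^{-1}s^{-1}f_{i+1}f_i^2=0$,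 $f_if_{i+1}^2-(r^{-1}+s^{-1})f_{i+1}f_if_{i+1}+r^{-1}s^{-1}f_{i+1}^2f_i=0$. With $\omega_j=a_jb_{j+1}$, $\omega_j'=a_{j+1}b_j$, it is a Hopf algebra with $a_i^{\pm1},b_i^{\pm1}$ group-like, $\Delta(e_i)=e_i\otimes1+\omega_i\otimes e_i$, $\Delta(f_i)=1\otimes f_i+f_i\otimes\omega_i'$, $\varepsilon(e_i)=\varepsilon(f_i)=0$. Pairing: $\widetilde B$ is the Hopf subalgebra generated by all $e_j,\omega_j^{\pm1}$ and $a_n^{\pm1}$; $\widetilde B'$ is the subalgebra generated by all $f_j,(\omega_j')^{\pm1}$ and $b_n^{\pm1}$, with the coproduct opposite to that of $\widetilde U$. The bilinear form $(\,,)$ on $\widetilde B'\times\widetilde B$ is the Hopf pairing (i.e. $(1,h)=\varepsilon(h)$, $(h',1)=\varepsilon(h')$, $(h',hk)=\sum(h'_{(1)},h)(h'_{(2)},k)$, $(h'k',h)=\sum(h',h_{(1)})(k',h_{(2)})$, using these coproducts) determined by $(f_i,e_j)=\frac{\delta_{i,j}}{s-r}$, $(\omega_i',\omega_j)=r^{\langle\epsilon_j,\alpha_i\rangle}s^{\langle\epsilon_{j+1},\alpha_i\rangle}$, $(b_n,a_n)=1$, $(b_n,\omega_j)=s^{-\langle\epsilon_n,\alpha_j\rangle}$, $(\omega_i',a_n)=r^{\langle\epsilon_n,\alpha_i\rangle}$, inverses of group-like generators giving inverse values, and $0$ on all other pairs of generators. $U^+$ (resp. $U^-$) is the subalgebra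 generated by $1$ and the $e_i$ (resp. $f_i$), $1\le i<n$; for $\zeta\in Q^+$, $U^+_\zeta$ (resp. $U^-_{-\zeta}$) is the span of monomials $e_{i_1}\cdots e_{i_\ell}$ (resp. $f_{i_1}\cdots f_{i_\ell}$) with $\alpha_{i_1}+\cdots+\alpha_{i_\ell}=\zeta$. The spaces $U^+_\zeta$ and $U^-_{-\zeta}$ are nondegenerately paired by $(\,,)$. Let $\{u_k^\zeta\}$ be a basis of $U^+_\zeta$ and $\{v_k^\zeta\}$ the dual basis of $U^-_{-\zeta}$, $(v_k^\zeta,u_l^\zeta)=\delta_{k,l}$. Put $\Theta_\zeta=\sum_kv_k^\zeta\otimes u_k^\zeta$ and $\Theta=\sum_{\zeta\in Q^+}\Theta_\zeta$; $(\Delta\otimes1)(\Theta)=\sum_\zeta(\Delta\otimes1)(\Theta_\zeta)$ and $(1\otimes\Delta)(\Theta)=\sum_\zeta(1\otimes\Delta)(\Theta_\zeta)$. All these sums are finite on each vector of the tensor products of modules in $\mathcal O$ on which they act. Category $\mathcal O$: $\widetilde U$-modules $M$ such that $M=\bigoplus_{\lambda\in\mathrm{wt}(M)}M_\lambda$ with the set of weights $\mathrm{wt}(M)\subseteq\Lambda$, where $M_\lambda=\{m: a_i m=r^{\langle\epsilon_i,\lambda\rangle}m,\ b_i m=s^{\langle\epsilon_i,\lambda\rangle}m\ \forall i\}$; $\dim M_\lambda<\infty$ for all $\lambda\in\mathrm{wt}(M)$; and $\mathrm{wt}(M)\subseteq\bigcup_{\mu\in F}(\mu-Q^+)$ for some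 finite $F\subset\Lambda$. For $\lambda=\sum_{i=1}^n\lambda_i\alpha_i\in\Lambda$ put $\omega_\lambda=\omega_1^{\lambda_1}\cdots\omega_{n-1}^{\lambda_{n-1}}a_n^{\lambda_n}$, $\omega'_\lambda=(\omega_1')^{\lambda_1}\cdots(\omega_{n-1}')^{\lambda_{n-1}}b_n^{\lambda_n}$, and $f(\lambda,\mu)=(\omega'_\mu,\omega_\lambda)^{-1}$ for $\lambda,\mu\in\Lambda$. On a tensor product $N'\otimes N$ of modules in $\mathcal O$, $\widetilde f(m'\otimes m)=f(\lambda,\mu)\,m'\otimes m$ for $m'\in N'_\lambda$, $m\in N_\mu$. $P:N\otimes N'\to N'\otimes N$ is the flip. *)

(* Defs.v *)
From HB Require Import structures.
From mathcomp Require Import all_boot all_order all_algebra.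
From mathcomp Require Import boolp classical_sets fsbigop.
From mathcomp Require Import zify ring.

Set Implicit Arguments.
Unset Strict Implicit.
Unset Printing Implicit Defensive.

Import GRing.Theory.
Local Open Scope ring_scope.
Local Open Scope quotient_scope.

Reserved Notation "x \ox y" (at level 39, left associativity).

Definition bilin (K : fieldType) (M N V : lmodType K) (b : M -> N -> V) : Prop :=
  (forall m, linear (b m)) /\ (forall n, linear (b^~ n)).

Section TensorDef.
Variables (K : fieldType) (M N : lmodType K).

(* A formal sum [:: (m_1, n_1); ...; (m_k, n_k)] stands for the sum of the
   m_i \ox n_i. *)
Definition fsum : Type := seq (M * N).

Inductive tcong : fsum -> fsum -> Prop :=
| tc_refl x : tcong x x
| tc_sym x y : tcong x y -> tcong y x
| tc_trans x y z : tcong x y -> tcong y z -> tcong x z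
| tc_cat x x' y y' : tcong x x' -> tcong y y' -> tcong (x ++ y) (x' ++ y')
| tc_comm x y : tcong (x ++ y) (y ++ x)
| tc_zero n : tcong [:: (0, n)] [::]
| tc_addl m m' n : tcong [:: (m + m', n)] [:: (m, n); (m', n)]
| tc_addr m n n' : tcong [:: (m, n + n')] [:: (m, n); (m, n')]
| tc_scale k m n : tcong [:: (k *: m, n)] [:: (m, k *: n)].

HB.instance Definition _ := Choice.on fsum.

Definition tcongb (x y : fsum) : bool := `[< tcong x y >].

Lemma tcongb_refl : reflexive tcongb.
Proof. by move=> x; apply/asboolP; exact: tc_refl. Qed.
Lemma tcongb_sym : symmetric tcongb.
Proof. by move=> x y; apply/asboolP/asboolP; exact: tc_sym. Qed.
Lemma tcongb_trans : transitive tcongb.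
Proof. by move=> y x z /asboolP h /asboolP h'; apply/asboolP/(tc_trans h). Qed.

Canonical tcong_equiv := EquivRel tcongb tcongb_refl tcongb_sym tcongb_trans.

Definition tens : Type := {eq_quot tcong_equiv}.
HB.instance Definition _ := Choice.on tens.

Definition tclass (x : fsum) : tens := \pi_({eq_quot tcong_equiv}) x.
Definition trepr (x : tens) : fsum := repr (x : {eq_quot tcong_equiv}).

Lemma treprK x : tclass (trepr x) = x. Proof. exact: reprK. Qed.

Lemma tclassP x y : tclass x = tclass y <-> tcong x y.
Proof.
split=> [/eqquotP /asboolP //|h]; by apply/eqquotP/asboolP.
Qed.

Lemma trepr_class x : tcong (trepr (tclass x)) x.
Proof. by apply/tclassP; rewrite treprK. Qed.

Definition pure (m : M) (n : N) : tens := tclass [:: (m, n)].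

Let fopp (x : fsum) : fsum := [seq (- p.1, p.2) | p <- x].
Let fscale k (x : fsum) : fsum := [seq (k *: p.1, p.2) | p <- x].

Let fscale_cong k x y : tcong x y -> tcong (fscale k x) (fscale k y).
Proof.
elim=> {x y}.
- by move=> x; exact: tc_refl.
- by move=> x y _; exact: tc_sym.
- by move=> x y z _ h _; exact: tc_trans.
- by move=> x x' y y' _ h _ h'; rewrite /fscale !map_cat; exact: tc_cat.
- by move=> x y; rewrite /fscale !map_cat; exact: tc_comm.
- by move=> n; rewrite /= scaler0; exact: tc_zero.
- by move=> m m' n; rewrite /= scalerDr; exact: tc_addl.
- by move=> m n n'; exact: tc_addr.
- by move=> l m n; rewrite /= scalerA mulrC -scalerA; exact: tc_scale.
Qed.

Let foppE x : fopp x = fscale (-1) x.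
Proof. by apply: eq_map => p; rewrite scaleN1r. Qed.

Let tzero := tclass [::].
Let tadd x y := tclass (trepr x ++ trepr y).
Let topp x := tclass (fopp (trepr x)).
Let tscale k x := tclass (fscale k (trepr x)).

Let taddE x y : tadd (tclass x) (tclass y) = tclass (x ++ y).
Proof. by apply/tclassP/tc_cat; exact: trepr_class. Qed.
Let tscaleE k x : tscale k (tclass x) = tclass (fscale k x).
Proof. by apply/tclassP/fscale_cong; exact: trepr_class. Qed.
Let toppE x : topp (tclass x) = tclass (fopp x).
Proof. by rewrite /topp !foppE; exact: tscaleE. Qed.

Let taddA : associative tadd.
Proof.
move=> x y z; rewrite -[x]treprK -[y]treprK -[z]treprK.
by rewrite !taddE catA.
Qed.
Let taddC : commutative tadd.
Proof. by move=> x y; apply/tclassP; exact: tc_comm. Qed.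
Let tadd0 : left_id tzero tadd.
Proof. by move=> x; rewrite -[x]treprK taddE. Qed.
Let taddN : left_inverse tzero topp tadd.
Proof.
move=> x; rewrite -[x]treprK toppE taddE; apply/tclassP.
elim: (trepr x) => [|[m n] s IH]; first exact: tc_refl.
have h0 : tcong ([:: (- m, n)] ++ [:: (m, n)]) [::].
  apply: tc_trans (tc_zero n); rewrite -(addNr m); exact/tc_sym/tc_addl.
have -> : fopp ((m, n) :: s) ++ (m, n) :: s
        = [:: (- m, n)] ++ (fopp s ++ [:: (m, n)]) ++ s by rewrite -catA.
apply: tc_trans (tc_cat (tc_refl _) (tc_cat (tc_comm _ _) (tc_refl _))) _.
rewrite -catA catA; exact: tc_cat h0 IH.
Qed.

HB.instance Definition _ :=
  GRing.isZmodule.Build tens taddA taddC tadd0 taddN.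

Let tscaleA k l x : tscale k (tscale l x) = tscale (k * l) x.
Proof.
rewrite -[x]treprK !tscaleE; congr tclass; rewrite /fscale -map_comp.
by apply: eq_map => p /=; rewrite scalerA.
Qed.
Let tscale1 : left_id 1 tscale.
Proof.
move=> x; rewrite -[x]treprK tscaleE; congr tclass.
by rewrite -[RHS]map_id; apply: eq_map => -[m n] /=; rewrite scale1r.
Qed.
Let tscaleDr : right_distributive tscale +%R.
Proof.
move=> k x y; rewrite -[x]treprK -[y]treprK [_ + _]taddE !tscaleE [RHS]taddE.
by congr tclass; rewrite /fscale map_cat.
Qed.
Let tscaleDl x : {morph tscale^~ x : k l / k + l}.
Proof.
move=> k l; rewrite -[x]treprK !tscaleE [RHS]taddE; apply/tclassP.
elim: (trepr x) => [|[m n] s IH]; first exact: tc_refl.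
have -> : fscale (k + l) ((m, n) :: s)
   = [:: (k *: m + l *: m, n)] ++ fscale (k + l) s by rewrite /= scalerDl.
apply: tc_trans (tc_cat (tc_addl _ _ _) IH) _.
have -> : fscale k ((m, n) :: s) ++ fscale l ((m, n) :: s)
   = [:: (k *: m, n)] ++ (fscale k s ++ [:: (l *: m, n)]) ++ fscale l s.
  by rewrite -catA.
apply: (tc_cat (x := [:: _]) (tc_refl _)); rewrite -cat1s catA.
exact: tc_cat (tc_comm _ _) (tc_refl _).
Qed.

HB.instance Definition _ := GRing.Zmodule_isLmodule.Build K tens
  tscaleA tscale1 tscaleDr tscaleDl.

Lemma tclassD x y : tclass (x ++ y) = tclass x + tclass y.
Proof. by rewrite [RHS]taddE. Qed.
Lemma tclass0 : tclass [::] = 0. Proof. by []. Qed.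
Lemma tclassE x : tclass x = \sum_(p <- x) pure p.1 p.2.
Proof.
elim: x => [|[m n] s IH]; first by rewrite big_nil.
by rewrite -cat1s tclassD IH big_cons.
Qed.
Lemma tclassZ k x :
  k *: tclass x = tclass [seq (k *: p.1, p.2) | p <- x].
Proof. by rewrite [LHS]tscaleE. Qed.

Lemma pure_bilin : bilin (pure : M -> N -> tens).
Proof.
have hs k m n : k *: pure m n = pure (k *: m) n by rewrite tclassZ.
split=> [m k n n'|n k m m'] /=.
  have -> : pure m (k *: n + n') = pure m (k *: n) + pure m n'.
    by rewrite -tclassD; apply/tclassP; exact: tc_addr.
  congr (_ + _); rewrite hs; apply/tclassP; exact: tc_sym (tc_scale _ _ _).
rewrite hs -tclassD; apply/tclassP; exact: tc_addl.
Qed.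

Lemma tens_sumE x : x = \sum_(p <- trepr x) pure p.1 p.2.
Proof. by rewrite -tclassE treprK. Qed.

Lemma tens_ind_pure (P : tens -> Prop) :
  (forall m n, P (pure m n)) -> (forall x y, P x -> P y -> P (x + y)) ->
  P 0 -> forall x, P x.
Proof.
move=> h1 hD h0 x; rewrite [x]tens_sumE.
by elim: (trepr x) => [|p s IH]; rewrite ?big_nil // big_cons; exact: hD.
Qed.

(* The map m \ox n |-> b m n.  It is defined for every b; it is independent of
   the choice of the representative, and linear, when b is bilinear. *)
Definition tlift (V : zmodType) (b : M -> N -> V) (x : tens) : V :=
  \sum_(p <- trepr x) b p.1 p.2.

Section Lift.
Variables (V : lmodType K) (b : M -> N -> V).
Hypothesis b_bilin : bilin b.

Let bDl m m' n : b (m + m') n = b m n + b m' n.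
Proof. by have := b_bilin.2 n 1 m m'; rewrite /= !scale1r. Qed.
Let bDr m n n' : b m (n + n') = b m n + b m n'.
Proof. by have := b_bilin.1 m 1 n n'; rewrite /= !scale1r. Qed.
Let b0l n : b 0 n = 0.
Proof. by apply: (addrI (b 0 n)); rewrite -bDl !addr0. Qed.
Let b0r m : b m 0 = 0.
Proof. by apply: (addrI (b m 0)); rewrite -bDr !addr0. Qed.
Let bZl k m n : b (k *: m) n = k *: b m n.
Proof. by have := b_bilin.2 n k m 0; rewrite /= b0l !addr0. Qed.
Let bZr k m n : b m (k *: n) = k *: b m n.
Proof. by have := b_bilin.1 m k n 0; rewrite /= b0r !addr0. Qed.

Lemma tlift_class x : tlift b (tclass x) = \sum_(p <- x) b p.1 p.2.
Proof.
rewrite /tlift; have := trepr_class x; move: (trepr _) => y.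
elim=> {x y} //.
- by move=> x y z _ -> _ ->.
- by move=> x x' y y' _ h _ h'; rewrite !big_cat /= h h'.
- by move=> x y; rewrite !big_cat /= addrC.
- by move=> n; rewrite big_seq1 big_nil.
- by move=> m m' n; rewrite !big_cons !big_nil !addr0 /= bDl.
- by move=> m n n'; rewrite !big_cons !big_nil !addr0 /= bDr.
- by move=> k m n; rewrite !big_seq1 /= bZl bZr.
Qed.

Lemma tlift_pure m n : tlift b (pure m n) = b m n.
Proof. by rewrite tlift_class big_seq1. Qed.

Lemma tlift_linear : linear (tlift b).
Proof.
move=> k x y; rewrite -[x]treprK -[y]treprK tclassZ -tclassD !tlift_class.
rewrite big_cat big_map /= scaler_sumr; congr (_ + _).
by apply: eq_bigr => p _; rewrite bZl.
Qed.

End Lift.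

Lemma tens_linear_ext (V : lmodType K) (f g : tens -> V) :
  linear f -> linear g -> (forall m n, f (pure m n) = g (pure m n)) -> f =1 g.
Proof.
move=> lf lg h x.
have D (u : tens -> V) : linear u -> forall x y, u (x + y) = u x + u y.
  by move=> lu y z; have := lu 1 y z; rewrite !scale1r.
have Z0 (u : tens -> V) : linear u -> u 0 = 0.
  by move=> /D hu; apply: (addrI (u 0)); rewrite -hu !addr0.
elim/tens_ind_pure: x => [//|x y hx hy|]; first by rewrite !D // hx hy.
by rewrite !Z0.
Qed.

End TensorDef.

Arguments pure {K M N} m n.
Notation "x \ox y" := (pure x y) : ring_scope.

Section LinearHelpers.
Variables (K : fieldType) (V W : lmodType K) (f : V -> W).
Hypothesis f_lin : linear f.
Lemma linD x y : f (x + y) = f x + f y.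
Proof. by have := f_lin 1 x y; rewrite !scale1r. Qed.
Lemma lin0 : f 0 = 0.
Proof. by apply: (addrI (f 0)); rewrite -linD !addr0. Qed.
Lemma linZ k x : f (k *: x) = k *: f x.
Proof. by have := f_lin k x 0; rewrite lin0 !addr0. Qed.
Lemma lin_sum (I : Type) (s : seq I) (g : I -> V) :
  f (\sum_(i <- s) g i) = \sum_(i <- s) f (g i).
Proof.
by elim: s => [|i s IH]; rewrite ?big_nil ?lin0 // !big_cons linD IH.
Qed.
End LinearHelpers.

Section TensorMaps.
Variable K : fieldType.

Definition tmap (M N M' N' : lmodType K) (f : M -> M') (g : N -> N') :
    tens M N -> tens M' N' :=
  tlift (fun m n => f m \ox g n).

Definition tflip (M N : lmodType K) : tens M N -> tens N M :=
  tlift (fun m n => n \ox m).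

Definition tassoc (L M N : lmodType K) :
    tens L (tens M N) -> tens (tens L M) N :=
  tlift (fun l x => tlift (fun m n => (l \ox m) \ox n) x).

Definition tassocV (L M N : lmodType K) :
    tens (tens L M) N -> tens L (tens M N) :=
  tlift (fun x n => tlift (fun l m => l \ox (m \ox n)) x).

Lemma pureDl (M N : lmodType K) (m m' : M) (n : N) :
  (m + m') \ox n = m \ox n + m' \ox n.
Proof. exact: (linD ((pure_bilin M N).2 n)). Qed.
Lemma pureDr (M N : lmodType K) (m : M) (n n' : N) :
  m \ox (n + n') = m \ox n + m \ox n'.
Proof. exact: (linD ((pure_bilin M N).1 m)). Qed.
Lemma pureZl (M N : lmodType K) k (m : M) (n : N) :
  (k *: m) \ox n = k *: (m \ox n).
Proof. exact: (linZ ((pure_bilin M N).2 n)). Qed.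
Lemma pureZr (M N : lmodType K) k (m : M) (n : N) :
  m \ox (k *: n) = k *: (m \ox n).
Proof. exact: (linZ ((pure_bilin M N).1 m)). Qed.

Lemma pureBl (M N : lmodType K) (m m' : M) (n : N) :
  (m - m') \ox n = m \ox n - m' \ox n.
Proof. by rewrite -scaleN1r pureDl pureZl scaleN1r. Qed.
Lemma pureBr (M N : lmodType K) (m : M) (n n' : N) :
  m \ox (n - n') = m \ox n - m \ox n'.
Proof. by rewrite -scaleN1r pureDr pureZr scaleN1r. Qed.
Lemma pure0l (M N : lmodType K) (n : N) : (0 : M) \ox n = 0.
Proof. exact: (lin0 ((pure_bilin M N).2 n)). Qed.
Lemma pure0r (M N : lmodType K) (m : M) : m \ox (0 : N) = 0.
Proof. exact: (lin0 ((pure_bilin M N).1 m)). Qed.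

Lemma tmap_bilin (M N M' N' : lmodType K) (f : M -> M') (g : N -> N') :
  linear f -> linear g -> bilin (fun m n => f m \ox g n).
Proof.
move=> lf lg; split=> [m k n n'|n k m m'] /=.
  by rewrite lg pureDr pureZr.
by rewrite lf pureDl pureZl.
Qed.

Lemma tmap_linear (M N M' N' : lmodType K) (f : M -> M') (g : N -> N') :
  linear f -> linear g -> linear (tmap f g).
Proof. by move=> lf lg; exact: tlift_linear (tmap_bilin lf lg). Qed.

Lemma tmap_pure (M N M' N' : lmodType K) (f : M -> M') (g : N -> N') m n :
  linear f -> linear g -> tmap f g (m \ox n) = f m \ox g n.
Proof. by move=> lf lg; rewrite /tmap tlift_pure //; exact: tmap_bilin. Qed.

Lemma tlift_paramlin (L M N V : lmodType K) (b : L -> M -> N -> V) :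
  (forall m n, linear (fun l => b l m n)) -> (forall l, bilin (b l)) ->
  bilin (fun l (x : tens M N) => tlift (b l) x).
Proof.
move=> h h'; split=> [l|x k l l'] /=; first exact: tlift_linear.
rewrite /tlift scaler_sumr -big_split /=.
by apply: eq_bigr => p _; rewrite h.
Qed.

Lemma tflip_bilin (M N : lmodType K) : bilin (fun (m : M) (n : N) => n \ox m).
Proof.
by split=> [m k n n'|n k m m'] /=; rewrite ?pureDl ?pureDr ?pureZl ?pureZr.
Qed.
Lemma tflip_linear (M N : lmodType K) : linear (@tflip M N).
Proof. exact: tlift_linear (tflip_bilin M N). Qed.
Lemma tflip_pure (M N : lmodType K) (m : M) (n : N) : tflip (m \ox n) = n \ox m.
Proof. by rewrite /tflip tlift_pure //; exact: tflip_bilin. Qed.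

Lemma tassoc_bilin (L M N : lmodType K) (l : L) :
  bilin (fun (m : M) (n : N) => (l \ox m) \ox n).
Proof.
split=> [m k n n'|n k m m'] /=; first by rewrite pureDr pureZr.
by rewrite pureDr pureZr pureDl pureZl.
Qed.
Lemma tassoc_bilin2 (L M N : lmodType K) :
  bilin (fun (l : L) (x : tens M N) => tlift (fun m n => (l \ox m) \ox n) x).
Proof.
apply: tlift_paramlin => [m n k l l'|l]; last exact: tassoc_bilin.
by rewrite pureDl pureZl pureDl pureZl.
Qed.
Lemma tassoc_linear (L M N : lmodType K) : linear (@tassoc L M N).
Proof. exact: tlift_linear (tassoc_bilin2 L M N). Qed.
Lemma tassoc_pure (L M N : lmodType K) (l : L) (m : M) (n : N) :
  tassoc (l \ox (m \ox n)) = (l \ox m) \ox n.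
Proof.
rewrite /tassoc tlift_pure; last exact: tassoc_bilin2.
by rewrite tlift_pure //; exact: tassoc_bilin.
Qed.

Lemma tassocV_bilin (L M N : lmodType K) (n : N) :
  bilin (fun (l : L) (m : M) => l \ox (m \ox n)).
Proof.
split=> [m k l l'|l k m m'] /=; last by rewrite pureDl pureZl.
by rewrite pureDl pureZl pureDr pureZr.
Qed.
Lemma tassocV_bilin2 (L M N : lmodType K) :
  bilin (fun (x : tens L M) (n : N) => tlift (fun l m => l \ox (m \ox n)) x).
Proof.
have [] := @tlift_paramlin N L M _ (fun n (l : L) (m : M) => l \ox (m \ox n)).
- by move=> l m k n n' /=; rewrite !pureDr !pureZr.
- exact: tassocV_bilin.
- by split.
Qed.
Lemma tassocV_linear (L M N : lmodType K) : linear (@tassocV L M N).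
Proof. exact: tlift_linear (tassocV_bilin2 L M N). Qed.
Lemma tassocV_pure (L M N : lmodType K) (l : L) (m : M) (n : N) :
  tassocV ((l \ox m) \ox n) = l \ox (m \ox n).
Proof.
rewrite /tassocV tlift_pure; last exact: tassocV_bilin2.
by rewrite tlift_pure //; exact: tassocV_bilin.
Qed.

Lemma id_linear (M : lmodType K) : linear (@id M).
Proof. by []. Qed.

End TensorMaps.

Local Open Scope classical_set_scope.

(* A nonzero vector is separated from 0 by a linear form, whence
   1 \ox 1 != 0 in a tensor product of nonzero algebras. *)
Lemma exists_form (K : fieldType) (V : lmodType K) (v : V) :
  v != 0 -> exists2 f : V -> K^o, linear f & f v = 1.
Proof.
move=> v0.
pose sub (W : set V) := W 0 /\ forall k x y, W x -> W y -> W (k *: x + y).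
pose P (W : set V) := (sub W /\ ~ W v) \/ W = set0.
have [F FP Ftot|W [[[[W0 WD] Wv]|W0] Wmax]] := @Zorn_bigcup V P.
- case: (pselect (exists2 X, F X & X !=set0)) => [[X FX [x Xx]]|hn]; last first.
    right; apply/seteqP; split=> // x [X FX Xx]; exfalso; apply: hn.
    by exists X => //; exists x.
  have sF Y y : F Y -> Y y -> sub Y /\ ~ Y v.
    by move=> FY Yy; case: (FP _ FY) => // Y0; move: Yy; rewrite Y0.
  left; split; first split.
  + by exists X => //; case: (sF _ _ FX Xx) => -[].
  + move=> k y z [Y FY Yy] [Z FZ Zz]; case: (Ftot _ _ FY FZ) => h.
      by exists Z => //; case: (sF _ _ FZ Zz) => -[_ hZ] _; apply: hZ => //; exact: h.
    by exists Y => //; case: (sF _ _ FY Yy) => -[_ hY] _; apply: hY => //; exact: h.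
  + by move=> [Y FY Yv]; case: (sF _ _ FY Yv).
- have dec x : exists k, W (x - k *: v).
    case: (pselect (W x)) => [Wx|nWx]; first by exists 0; rewrite scale0r subr0.
    pose W' := [set y : V | exists k, W (y - k *: x)].
    have WW' : (W `<=` W').
      by move=> y Wy; exists 0; rewrite scale0r subr0.
    have W'x : W' x by exists 1; rewrite scale1r subrr.
    case: (pselect (W' v)) => [[k Wk]|nv].
      have k0 : k != 0 by apply/eqP => k0; move: Wk; rewrite k0 scale0r subr0.
      exists k^-1; have := WD (- k^-1) _ _ Wk W0.
      rewrite addr0 scalerBr scalerA mulNr mulVf // !scaleNr scale1r opprK.
      by rewrite addrC.
    exfalso; apply: (Wmax W'); first by split=> // h; exact/nWx/h.
    left; split=> //; split=> [|k y z [a Wa] [b Wb]]; first exact: WW'.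
    exists (k * a + b); have := WD k _ _ Wa Wb.
    by rewrite scalerBr scalerA scalerDl opprD addrACA.
  pose f x := projT1 (cid (dec x)).
  have fP x : W (x - f x *: v) by rewrite /f; case: cid.
  have WB x y : W x -> W y -> W (x - y).
    by move=> Wx Wy; have := WD (-1) _ _ Wy Wx; rewrite scaleN1r addrC.
  have fE x k : W (x - k *: v) -> f x = k.
    move=> Wx; apply/eqP; rewrite -subr_eq0; apply/negPn/negP => d0; apply: Wv.
    have := WB _ _ Wx (fP x); rewrite opprB addrC addrA subrK -scalerBl => h.
    by have := WD (f x - k)^-1 _ _ h W0; rewrite scalerA mulVf // scale1r addr0.
  exists f; last by apply: fE; rewrite scale1r subrr.
  move=> k x y /=; apply: fE; have := WD k _ _ (fP x) (fP y).
  by rewrite scalerBr scalerA scalerDl opprD addrACA.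
- subst W; exfalso.
  apply: (Wmax [set 0]); last first.
    left; split; last by move/eqP; rewrite (negPf v0).
    by split=> // k x y -> ->; rewrite scaler0 addr0.
  by split=> // h; exact: (h 0).
Qed.

Lemma pure_neq0 (K : fieldType) (M N : lmodType K) (m : M) (n : N) :
  m != 0 -> n != 0 -> m \ox n != 0.
Proof.
move=> /exists_form[f lf fm] /exists_form[g lg gn]; apply/eqP => h.
pose b (x : M) (y : N) : K^o := f x * g y.
have bb : bilin b.
  split=> [x k y y'|y k x x']; rewrite /b /=.
    by rewrite lg mulrDr; congr (_ + _); rewrite /GRing.scale /= mulrCA.
  by rewrite lf mulrDl; congr (_ + _); rewrite /GRing.scale /= mulrA.
have := tlift_pure bb m n; rewrite h (lin0 (tlift_linear bb)) /b fm gn mulr1.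
by move/esym/eqP; rewrite oner_eq0.
Qed.

Section TensorAlgebra.
Variables (K : fieldType) (A B : algType K).

Definition tmul (x y : tens A B) : tens A B :=
  tlift (fun a b => tmap ( *%R a) ( *%R b) y) x.

Let mull_linear (C : algType K) (c : C) : linear ( *%R c).
Proof. by move=> k x y; rewrite mulrDr -scalerAr. Qed.

Let tmul_bilin y : bilin (fun (a : A) (b : B) => tmap ( *%R a) ( *%R b) y).
Proof.
split=> [a k b b'|b k a a'] /=; rewrite /tmap /tlift scaler_sumr -big_split /=;
  by apply: eq_bigr => p _; rewrite mulrDl -scalerAl ?(pureDr, pureZr, pureDl, pureZl).
Qed.

Lemma tmul_pure a b a' b' : tmul (a \ox b) (a' \ox b') = (a * a') \ox (b * b').
Proof.
rewrite /tmul tlift_pure; last exact: tmul_bilin.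
by rewrite tmap_pure //; exact: mull_linear.
Qed.

Let tmul_linl y : linear (tmul^~ y).
Proof. exact: (tlift_linear (tmul_bilin y)). Qed.

Let tmul_linr x : linear (tmul x).
Proof.
move=> k y z; rewrite /tmul /tlift scaler_sumr -big_split /=.
by apply: eq_bigr => p _; rewrite (tmap_linear (mull_linear _) (mull_linear _)).
Qed.

Let tmulDl : left_distributive tmul +%R.
Proof. by move=> x y z; exact: (linD (tmul_linl z)). Qed.
Let tmulDr : right_distributive tmul +%R.
Proof. by move=> x y z; exact: (linD (tmul_linr x)). Qed.
Let tmul0l x : tmul 0 x = 0. Proof. exact: (lin0 (tmul_linl x)). Qed.
Let tmul0r x : tmul x 0 = 0. Proof. exact: (lin0 (tmul_linr x)). Qed.

Let tmulA : associative tmul.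
Proof.
move=> x y z.
elim/tens_ind_pure: x => [a b|x x' h h'|]; rewrite ?tmul0l ?tmulDl ?h ?h' //.
elim/tens_ind_pure: y => [a' b'|x x' h h'|];
  rewrite ?tmul0l ?tmul0r ?tmul0l ?tmulDl ?tmulDr ?tmulDl ?h ?h' //.
elim/tens_ind_pure: z => [a2 b2|x x' h h'|]; rewrite ?tmul0r ?tmulDr ?h ?h' //.
by rewrite !tmul_pure !mulrA.
Qed.
Let tmul1l : left_id (1 \ox 1) tmul.
Proof.
elim/tens_ind_pure => [a b|x y h h'|]; rewrite ?tmul0r ?tmulDr ?h ?h' //.
by rewrite tmul_pure !mul1r.
Qed.
Let tmul1r : right_id (1 \ox 1) tmul.
Proof.
elim/tens_ind_pure => [a b|x y h h'|]; rewrite ?tmul0l ?tmulDl ?h ?h' //.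
by rewrite tmul_pure !mulr1.
Qed.
Let tone_neq0 : (1 \ox 1 : tens A B) != 0.
Proof. by apply: pure_neq0; exact: oner_neq0. Qed.

HB.instance Definition _ := GRing.Zmodule_isNzRing.Build (tens A B)
  tmulA tmul1l tmul1r tmulDl tmulDr tone_neq0.

Let tscalerAl k (x y : tens A B) : k *: (x * y) = (k *: x) * y.
Proof. by rewrite [RHS](linZ (tmul_linl y)). Qed.
Let tscalerAr k (x y : tens A B) : k *: (x * y) = x * (k *: y).
Proof. by rewrite [RHS](linZ (tmul_linr x)). Qed.

HB.instance Definition _ :=
  GRing.Lmodule_isLalgebra.Build K (tens A B) tscalerAl.
HB.instance Definition _ :=
  GRing.Lalgebra_isAlgebra.Build K (tens A B) tscalerAr.

Lemma tensM_pure (a a' : A) (b b' : B) :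
  (a \ox b) * (a' \ox b') = (a * a') \ox (b * b').
Proof. exact: tmul_pure. Qed.
Lemma tens1E : (1 : tens A B) = 1 \ox 1.
Proof. by []. Qed.

End TensorAlgebra.

Section SerreSum.
Variables (K : fieldType) (C : algType K) (p q : K).

Definition serre_form (x y z : C) : C :=
  x * y * z - (p + q) *: (x * z * y) + (p * q) *: (z * x * y).

Definition serre_form' (x y z : C) : C :=
  x * y * z - (p + q) *: (y * x * z) + (p * q) *: (y * z * x).

Let addr6 (a b c a' b' c' : C) :
  a + a' - (b + b') + (c + c') = (a - b + c) + (a' - b' + c').
Proof. by rewrite opprD (addrACA a a') (addrACA (a - b)). Qed.

Let SD1 x x' y z :
  serre_form (x + x') y z = serre_form x y z + serre_form x' y z.
Proof. by rewrite /serre_form !(mulrDl, mulrDr) !scalerDr addr6. Qed.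
Let SD2 x y y' z :
  serre_form x (y + y') z = serre_form x y z + serre_form x y' z.
Proof. by rewrite /serre_form !(mulrDl, mulrDr) !scalerDr addr6. Qed.
Let SD3 x y z z' :
  serre_form x y (z + z') = serre_form x y z + serre_form x y z'.
Proof. by rewrite /serre_form !(mulrDl, mulrDr) !scalerDr addr6. Qed.
Let SD1' x x' y z :
  serre_form' (x + x') y z = serre_form' x y z + serre_form' x' y z.
Proof. by rewrite /serre_form' !(mulrDl, mulrDr) !scalerDr addr6. Qed.
Let SD2' x y y' z :
  serre_form' x (y + y') z = serre_form' x y z + serre_form' x y' z.
Proof. by rewrite /serre_form' !(mulrDl, mulrDr) !scalerDr addr6. Qed.
Let SD3' x y z z' :
  serre_form' x y (z + z') = serre_form' x y z + serre_form' x y z'.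
Proof. by rewrite /serre_form' !(mulrDl, mulrDr) !scalerDr addr6. Qed.

Let L (u v : C) a b := a *: u + b *: v.
Let LD u v a b a' b' : L u v a b + L u v a' b' = L u v (a + a') (b + b').
Proof. by rewrite /L addrACA -!scalerDl. Qed.
Let LZ u v k a b : k *: L u v a b = L u v (k * a) (k * b).
Proof. by rewrite /L scalerDr ?scalerA. Qed.
Let LN u v a b : - L u v a b = L u v (- a) (- b).
Proof. by rewrite /L opprD !scaleNr. Qed.
Let Ll u v a : a *: u = L u v a 0.
Proof. by rewrite /L scale0r addr0. Qed.
Let Lr u v b : b *: v = L u v 0 b.
Proof. by rewrite /L scale0r add0r. Qed.
Let L0 u v a b : a = 0 -> b = 0 -> L u v a b = 0.
Proof. by move=> -> ->; rewrite /L !scale0r addr0. Qed.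

Variables x y x' y' : C.
Hypotheses (p0 : p != 0) (q0 : q != 0).
Hypothesis x'x : x' * x = (p / q) *: (x * x').
Hypothesis y'y : y' * y = (p / q) *: (y * y').
Hypothesis x'y : x' * y = q *: (y * x').
Hypothesis y'x : y' * x = p^-1 *: (x * y').

Let comm3r k (a c d : C) : c * d = k *: (d * c) ->
  a * c * d = k *: (a * d * c).
Proof. by move=> h; rewrite -mulrA h -scalerAr mulrA. Qed.
Let comm3l k (b c d : C) : c * d = k *: (d * c) ->
  c * d * b = k *: (d * c * b).
Proof. by move=> h; rewrite h -scalerAl. Qed.

Let X'X := (fun a => comm3r a x'x, fun a => comm3l a x'x).
Let Y'Y := (fun a => comm3r a y'y, fun a => comm3l a y'y).
Let X'Y := (fun a => comm3r a x'y, fun a => comm3l a x'y).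
Let Y'X := (fun a => comm3r a y'x, fun a => comm3l a y'x).

Lemma serre_form_sum : serre_form x x y = 0 -> serre_form x' x' y' = 0 ->
  serre_form (x + x') (x + x') (y + y') = 0.
Proof.
move=> h h'; rewrite !(SD1, SD2, SD3) h h'.
have e1 : serre_form x x y' = 0.
  rewrite /serre_form !Y'X ?scalerA -[x * x * y']scale1r.
  rewrite !(Ll (x * x * y') 0) ?LZ !LN !LD; apply: L0; by field; rewrite ?p0 ?q0.
have e2 : serre_form x' x' y = 0.
  rewrite /serre_form !X'Y ?scalerA -[y * x' * x']scale1r.
  rewrite !(Ll (y * x' * x') 0) ?LZ !LN !LD; apply: L0; by field; rewrite ?p0 ?q0.
have e3 : serre_form x x' y + serre_form x' x y = 0.
  rewrite /serre_form.
  rewrite !(X'X, X'Y) ?scalerA; rewrite ?(X'X, X'Y) ?scalerA.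
  rewrite -[x * y * x']scale1r -[y * x * x']scale1r ?scalerA.
  rewrite !(Ll (x * y * x') (y * x * x')) !(Lr (x * y * x') (y * x * x')).
  rewrite ?LZ !LN !LD; apply: L0; by field; rewrite ?p0 ?q0.
have e4 : serre_form x x' y' + serre_form x' x y' = 0.
  rewrite /serre_form.
  rewrite !(Y'X, X'X) ?scalerA; rewrite ?(X'X, Y'X) ?scalerA.
  rewrite -[x * x' * y']scale1r -[x * y' * x']scale1r ?scalerA.
  rewrite !(Ll (x * x' * y') (x * y' * x')) !(Lr (x * x' * y') (x * y' * x')).
  rewrite ?LZ !LN !LD; apply: L0; by field; rewrite ?p0 ?q0.
rewrite e1 e2 !add0r !addr0.
by rewrite addrACA e3 e4 addr0.
Qed.

Lemma serre_form_sum' : serre_form' x y y = 0 -> serre_form' x' y' y' = 0 ->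
  serre_form' (x + x') (y + y') (y + y') = 0.
Proof.
move=> h h'; rewrite !(SD1', SD2', SD3') h h'.
have e1 : serre_form' x y' y' = 0.
  rewrite /serre_form' !Y'X ?scalerA; rewrite ?Y'X ?scalerA.
  rewrite -[x * y' * y']scale1r ?scalerA.
  rewrite !(Ll (x * y' * y') 0) ?LZ !LN !LD; apply: L0; by field; rewrite ?p0 ?q0.
have e2 : serre_form' x' y y = 0.
  rewrite /serre_form' !X'Y ?scalerA; rewrite ?X'Y ?scalerA.
  rewrite -[y * y * x']scale1r ?scalerA.
  rewrite !(Ll (y * y * x') 0) ?LZ !LN !LD; apply: L0; by field; rewrite ?p0 ?q0.
have e3 : serre_form' x y y' + serre_form' x y' y = 0.
  rewrite /serre_form'.
  rewrite !(Y'X, Y'Y) ?scalerA; rewrite ?(Y'X, Y'Y) ?scalerA.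
  rewrite -[x * y * y']scale1r -[y * x * y']scale1r ?scalerA.
  rewrite !(Ll (x * y * y') (y * x * y')) !(Lr (x * y * y') (y * x * y')).
  rewrite ?LZ !LN !LD; apply: L0; by field; rewrite ?p0 ?q0.
have e4 : serre_form' x' y y' + serre_form' x' y' y = 0.
  rewrite /serre_form'.
  rewrite !(X'Y, Y'Y) ?scalerA; rewrite ?(X'Y, Y'Y) ?scalerA.
  rewrite -[y * x' * y']scale1r -[y * y' * x']scale1r ?scalerA.
  rewrite !(Ll (y * x' * y') (y * y' * x')) !(Lr (y * x' * y') (y * y' * x')).
  rewrite ?LZ !LN !LD; apply: L0; by field; rewrite ?p0 ?q0.
rewrite e1 e2 !add0r !addr0.
by rewrite e3 e4 addr0.
Qed.

End SerreSum.

Section Weights.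
Variable n : nat.

(* Indices are 0-based: [eps k] is the (k+1)-st basis vector.  It is 0 for
   n <= k, so that [alpha n.-1] is the last basis vector, as required. *)
Definition eps (k : nat) : 'rV[int]_n := \row_(i < n) ((i : nat) == k)%:R.
Definition alpha (k : nat) : 'rV[int]_n := eps k - eps k.+1.
Definition dot (u v : 'rV[int]_n) : int := \sum_(i < n) u 0 i * v 0 i.

(* The indices of the generators e_j and f_j are j : 'I_n.-1; [lo j] and [hi j]
   are j and j + 1 seen in 'I_n. *)
Definition lo (j : 'I_n.-1) : 'I_n := widen_ord (leq_pred n) j.
Lemma hi_subproof (j : 'I_n.-1) : (j.+1 < n)%N.
Proof. by rewrite -ltn_predRL. Qed.
Definition hi (j : 'I_n.-1) : 'I_n := Ordinal (hi_subproof j).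

Definition Qplus : set 'rV[int]_n :=
  [set z | exists c : 'I_n.-1 -> nat, z = \sum_(j < n.-1) alpha j *+ c j].

Definition acoord (l : 'rV[int]_n) (j : 'I_n) : int :=
  \sum_(i < n | (i <= j)%N) l 0 i.

Lemma acoordE l : l = \sum_(j < n) acoord l j *: alpha j.
Proof.
apply/rowP => i; rewrite summxE.
have -> : \sum_(j < n) (acoord l j *: alpha j) 0 i =
    acoord l i - \sum_(j < n | (j.+1 == i)%N) acoord l j.
  transitivity (\sum_(j < n) (acoord l j * (i == j)%:R
                              - acoord l j * ((i : nat) == j.+1)%:R)).
    by apply: eq_bigr => j _; rewrite !mxE mulrBr.
  rewrite sumrB; congr (_ - _).
    rewrite (bigD1 i) //= eqxx mulr1 big1 ?addr0 // => j /negPf.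
    by rewrite eq_sym => ->; rewrite mulr0.
  rewrite [RHS]big_mkcond; apply: eq_bigr => j _; rewrite eq_sym.
  by case: eqP; rewrite ?mulr1 ?mulr0.
rewrite /acoord (bigD1 i) //= -[l 0 i in LHS]addr0 -addrA; congr (_ + _).
apply/esym/eqP; rewrite subr_eq0; apply/eqP.
case: i => -[|k] hk /=.
  rewrite !big_pred0 // => j; apply/negbTE.
  by rewrite leqn0 -val_eqE; case: (_ == _).
rewrite [RHS](big_pred1 (Ordinal (ltnW hk))) /=; last first.
  by move=> j; rewrite /= eqSS -val_eqE.
by apply: eq_bigl => j; rewrite -val_eqE /= andbC -ltn_neqAle ltnS.
Qed.

End Weights.

Section Uterms.
Variables (K : fieldType) (n : nat).

Inductive ugen : Type :=
| GE of 'I_n.-1 | GF of 'I_n.-1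
| GA of 'I_n | GAV of 'I_n | GB of 'I_n | GBV of 'I_n.

Definition torus_gen (g : ugen) : bool :=
  match g with GE _ | GF _ => false | _ => true end.

Inductive uterm : Type :=
| TGen of ugen | TCst of K | TAdd of uterm & uterm | TMul of uterm & uterm.

Fixpoint ueval (C : algType K) (h : ugen -> C) (t : uterm) : C :=
  match t with
  | TGen g => h g
  | TCst k => k%:A
  | TAdd t t' => ueval h t + ueval h t'
  | TMul t t' => ueval h t * ueval h t'
  end.

End Uterms.

Arguments GE {n} j.
Arguments GF {n} j.
Arguments GA {n} i.
Arguments GAV {n} i.
Arguments GB {n} i.
Arguments GBV {n} i.

Declare Scope uterm_scope.
Delimit Scope uterm_scope with ut.
Bind Scope uterm_scope with uterm.
Notation "x + y" := (TAdd x y) : uterm_scope.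
Notation "x * y" := (TMul x y) : uterm_scope.
Notation "k *: x" := (TMul (TCst _ k%R) x) : uterm_scope.
Notation "x - y" := (TAdd x (TMul (TCst _ (-1)%R) y)) : uterm_scope.
Notation "0" := (TCst _ 0%R) : uterm_scope.
Notation "1" := (TCst _ 1%R) : uterm_scope.

Section Udef.
Variables (K : fieldType) (r s : K) (n : nat).

Local Notation uterm := (uterm K n).
Local Notation eps := (eps n).
Local Notation alpha := (alpha n).
Local Notation E j := (TGen K (GE j)).
Local Notation F j := (TGen K (GF j)).
Local Notation A i := (TGen K (GA i)).
Local Notation AV i := (TGen K (GAV i)).
Local Notation B i := (TGen K (GB i)).
Local Notation BV i := (TGen K (GBV i)).

Definition far (i j : 'I_n.-1) : bool := (i.+1 < j)%N || (j.+1 < i)%N.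

Inductive urel : uterm -> uterm -> Prop :=
| R1_comm g h : torus_gen g -> torus_gen h ->
    urel (TGen K g * TGen K h)%ut (TGen K h * TGen K g)%ut
| R1_a (i : 'I_n) : urel (A i * AV i)%ut 1%ut
| R1_b (i : 'I_n) : urel (B i * BV i)%ut 1%ut
| R2_e (i : 'I_n) (j : 'I_n.-1) :
    urel (A i * E j)%ut (r ^ dot (eps i) (alpha j) *: (E j * A i))%ut
| R2_f (i : 'I_n) (j : 'I_n.-1) :
    urel (A i * F j)%ut (r ^ (- dot (eps i) (alpha j)) *: (F j * A i))%ut
| R3_e (i : 'I_n) (j : 'I_n.-1) :
    urel (B i * E j)%ut (s ^ dot (eps i) (alpha j) *: (E j * B i))%ut
| R3_f (i : 'I_n) (j : 'I_n.-1) :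
    urel (B i * F j)%ut (s ^ (- dot (eps i) (alpha j)) *: (F j * B i))%ut
| R4 (i j : 'I_n.-1) :
    urel (E i * F j - F j * E i)%ut
      (((i == j)%:R / (r - s)) *: (A (lo i) * B (hi i) - A (hi i) * B (lo i)))%ut
| R5_e (i j : 'I_n.-1) : far i j -> urel (E i * E j - E j * E i)%ut 0%ut
| R5_f (i j : 'I_n.-1) : far i j -> urel (F i * F j - F j * F i)%ut 0%ut
| R6_1 (i j : 'I_n.-1) : j = i.+1 :> nat ->
    urel (E i * E i * E j - (r + s) *: (E i * E j * E i)
          + (r * s) *: (E j * E i * E i))%ut 0%ut
| R6_2 (i j : 'I_n.-1) : j = i.+1 :> nat ->
    urel (E i * E j * E j - (r + s) *: (E j * E i * E j)
          + (r * s) *: (E j * E j * E i))%ut 0%ut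
| R7_1 (i j : 'I_n.-1) : j = i.+1 :> nat ->
    urel (F i * F i * F j - (r^-1 + s^-1) *: (F i * F j * F i)
          + (r^-1 * s^-1) *: (F j * F i * F i))%ut 0%ut
| R7_2 (i j : 'I_n.-1) : j = i.+1 :> nat ->
    urel (F i * F j * F j - (r^-1 + s^-1) *: (F j * F i * F j)
          + (r^-1 * s^-1) *: (F j * F j * F i))%ut 0%ut.

Inductive ucong : uterm -> uterm -> Prop :=
| uc_refl x : ucong x x
| uc_sym x y : ucong x y -> ucong y x
| uc_trans x y z : ucong x y -> ucong y z -> ucong x z
| uc_add x x' y y' : ucong x x' -> ucong y y' -> ucong (x + y)%ut (x' + y')%ut
| uc_mul x x' y y' : ucong x x' -> ucong y y' -> ucong (x * y)%ut (x' * y')%ut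
| uc_addA x y z : ucong (x + (y + z))%ut (x + y + z)%ut
| uc_addC x y : ucong (x + y)%ut (y + x)%ut
| uc_add0 x : ucong (0 + x)%ut x
| uc_mulA x y z : ucong (x * (y * z))%ut (x * y * z)%ut
| uc_mul1l x : ucong (1 * x)%ut x
| uc_mul1r x : ucong (x * 1)%ut x
| uc_mul0 x : ucong (0 * x)%ut 0%ut
| uc_mulDl x y z : ucong ((x + y) * z)%ut (x * z + y * z)%ut
| uc_mulDr x y z : ucong (x * (y + z))%ut (x * y + x * z)%ut
| uc_cstD k l : ucong (TCst n (k + l)) (TCst n k + TCst n l)%ut
| uc_cstM k l : ucong (TCst n (k * l)) (TCst n k * TCst n l)%ut
| uc_cstC k x : ucong (TCst n k * x)%ut (x * TCst n k)%ut
| uc_rel x y : urel x y -> ucong x y.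

HB.instance Definition _ := gen_eqMixin uterm.
HB.instance Definition _ := gen_choiceMixin uterm.

Definition ucongb (x y : uterm) : bool := `[< ucong x y >].

Lemma ucongb_refl : reflexive ucongb.
Proof. by move=> x; apply/asboolP; exact: uc_refl. Qed.
Lemma ucongb_sym : symmetric ucongb.
Proof. by move=> x y; apply/asboolP/asboolP; exact: uc_sym. Qed.
Lemma ucongb_trans : transitive ucongb.
Proof. by move=> y x z /asboolP h /asboolP h'; apply/asboolP/(uc_trans h). Qed.

Canonical ucong_equiv := EquivRel ucongb ucongb_refl ucongb_sym ucongb_trans.

Definition U : Type := {eq_quot ucong_equiv}.
HB.instance Definition _ := Choice.on U.

Definition uclass (x : uterm) : U := \pi_({eq_quot ucong_equiv}) x.
Definition urepr (x : U) : uterm := repr (x : {eq_quot ucong_equiv}).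

Lemma ureprK x : uclass (urepr x) = x. Proof. exact: reprK. Qed.

Lemma uclassP x y : uclass x = uclass y <-> ucong x y.
Proof. by split=> [/eqquotP /asboolP //|h]; apply/eqquotP/asboolP. Qed.

Lemma urepr_class x : ucong (urepr (uclass x)) x.
Proof. by apply/uclassP; rewrite ureprK. Qed.

Section Eval.
Variables (C : algType K) (h : ugen n -> C).
Hypothesis h_rel : forall x y, urel x y -> ueval h x = ueval h y.
Lemma ueval_cong x y : ucong x y -> ueval h x = ueval h y.
Proof.
elim=> {x y} //=.
- by move=> x y z _ -> _ ->.
- by move=> x x' y y' _ -> _ ->.
- by move=> x x' y y' _ -> _ ->.
- by move=> x y z; rewrite addrA.
- by move=> x y; rewrite addrC.
- by move=> x; rewrite scale0r add0r.
- by move=> x y z; rewrite mulrA.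
- by move=> x; rewrite scale1r mul1r.
- by move=> x; rewrite scale1r mulr1.
- by move=> x; rewrite scale0r mul0r.
- by move=> x y z; rewrite mulrDl.
- by move=> x y z; rewrite mulrDr.
- by move=> k l; rewrite scalerDl.
- by move=> k l; rewrite -scalerAl mul1r scalerA.
- by move=> k x; rewrite -scalerAl -scalerAr mul1r mulr1.
Qed.
End Eval.

Definition counit_gen (g : ugen n) : K^o := if torus_gen g then 1 else 0.

Lemma counit_rel x y : urel x y -> ueval counit_gen x = ueval counit_gen y.
Proof.
rewrite /counit_gen; case=> {x y} /=.
- by move=> g h -> ->; rewrite mulr1.
all: move=> *; rewrite ?(mulr0, mul0r, mulr1, subr0, subrr, addr0, scale0r, scaler0, scale1r) //.
all: by rewrite -?scalerAl ?(mulr1, mul1r, scale1r, scaleN1r, subrr, scaler0).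
Qed.

Let uadd x y := uclass (urepr x + urepr y)%ut.
Let umul x y := uclass (urepr x * urepr y)%ut.
Let uscale k x := uclass (k *: urepr x)%ut.
Let uopp x := uscale (-1) x.

Let uaddE x y : uadd (uclass x) (uclass y) = uclass (x + y)%ut.
Proof. by apply/uclassP/uc_add; exact: urepr_class. Qed.
Let umulE x y : umul (uclass x) (uclass y) = uclass (x * y)%ut.
Proof. by apply/uclassP/uc_mul; exact: urepr_class. Qed.
Let uscaleE k x : uscale k (uclass x) = uclass (k *: x)%ut.
Proof. by apply/uclassP/uc_mul; [exact: uc_refl|exact: urepr_class]. Qed.

Let uaddA : associative uadd.
Proof.
move=> x y z; rewrite -[x]ureprK -[y]ureprK -[z]ureprK !uaddE.
exact/uclassP/uc_addA.
Qed.
Let uaddC : commutative uadd.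
Proof. by move=> x y; apply/uclassP/uc_addC. Qed.
Let uadd0 : left_id (uclass 0%ut) uadd.
Proof. by move=> x; rewrite -[x]ureprK uaddE; apply/uclassP/uc_add0. Qed.
Let uscaleDl x k l : uscale (k + l) x = uadd (uscale k x) (uscale l x).
Proof.
rewrite -[x]ureprK !uscaleE uaddE; apply/uclassP.
apply: uc_trans (uc_mulDl _ _ _); apply: uc_mul (uc_refl _); exact: uc_cstD.
Qed.
Let uscale1 x : uscale 1 x = x.
Proof. by rewrite -[x]ureprK uscaleE; apply/uclassP/uc_mul1l. Qed.
Let uaddN : left_inverse (uclass 0%ut) uopp uadd.
Proof.
move=> x; rewrite -[X in uadd _ X]uscale1 -uscaleDl addNr.
by rewrite -[x]ureprK uscaleE; apply/uclassP/uc_mul0.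
Qed.

HB.instance Definition _ := GRing.isZmodule.Build U uaddA uaddC uadd0 uaddN.

Let umulA : associative umul.
Proof.
move=> x y z; rewrite -[x]ureprK -[y]ureprK -[z]ureprK !umulE.
exact/uclassP/uc_mulA.
Qed.
Let umul1l : left_id (uclass 1%ut) umul.
Proof. by move=> x; rewrite -[x]ureprK umulE; apply/uclassP/uc_mul1l. Qed.
Let umul1r : right_id (uclass 1%ut) umul.
Proof. by move=> x; rewrite -[x]ureprK umulE; apply/uclassP/uc_mul1r. Qed.
Let umulDl : left_distributive umul +%R.
Proof.
move=> x y z; rewrite -[x]ureprK -[y]ureprK -[z]ureprK.
rewrite [_ + _]uaddE !umulE [RHS]uaddE; exact/uclassP/uc_mulDl.
Qed.
Let umulDr : right_distributive umul +%R.
Proof.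
move=> x y z; rewrite -[x]ureprK -[y]ureprK -[z]ureprK.
rewrite [_ + _]uaddE !umulE [RHS]uaddE; exact/uclassP/uc_mulDr.
Qed.
Let uone_neq0 : uclass 1%ut != 0.
Proof.
apply/eqP => /uclassP /(ueval_cong counit_rel) /= /eqP.
by rewrite scale1r scale0r oner_eq0.
Qed.

HB.instance Definition _ := GRing.Zmodule_isNzRing.Build U
  umulA umul1l umul1r umulDl umulDr uone_neq0.

Let uscaleA k l x : uscale k (uscale l x) = uscale (k * l) x.
Proof.
rewrite -[x]ureprK !uscaleE; apply/uclassP.
apply: uc_trans (uc_mulA _ _ _) _; apply: uc_mul (uc_refl _).
exact: uc_sym (uc_cstM _ _).
Qed.
Let uscaleDr : right_distributive uscale +%R.
Proof.
move=> k x y; rewrite -[x]ureprK -[y]ureprK [_ + _]uaddE !uscaleE [RHS]uaddE.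
exact/uclassP/uc_mulDr.
Qed.

HB.instance Definition _ := GRing.Zmodule_isLmodule.Build K U
  uscaleA uscale1 uscaleDr uscaleDl.

Let uscalerAl k (x y : U) : k *: (x * y) = (k *: x) * y.
Proof.
rewrite -[x]ureprK -[y]ureprK [_ * _]umulE [LHS]uscaleE [_ *: _]uscaleE.
rewrite [RHS]umulE; exact/uclassP/uc_mulA.
Qed.
HB.instance Definition _ := GRing.Lmodule_isLalgebra.Build K U uscalerAl.

Let uscalerAr k (x y : U) : k *: (x * y) = x * (k *: y).
Proof.
rewrite -[x]ureprK -[y]ureprK [_ * _]umulE [LHS]uscaleE [_ *: _]uscaleE.
rewrite [RHS]umulE; apply/uclassP.
apply: uc_trans (uc_mulA _ _ _) _; apply: uc_trans (uc_sym (uc_mulA _ _ _)).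
exact: uc_mul (uc_cstC _ _) (uc_refl _).
Qed.
HB.instance Definition _ := GRing.Lalgebra_isAlgebra.Build K U uscalerAr.

Definition ugenU (g : ugen n) : U := uclass (TGen K g).
Definition ue j := ugenU (GE j).
Definition uf j := ugenU (GF j).
Definition ua i := ugenU (GA i).
Definition uaV i := ugenU (GAV i).
Definition ub i := ugenU (GB i).
Definition ubV i := ugenU (GBV i).

Lemma uclassE x : uclass x = ueval ugenU x.
Proof.
elim: x => //= [k|x <- y <-|x <- y <-].
- rewrite -[1]/(uclass 1%ut) [RHS]uscaleE; exact/uclassP/uc_sym/uc_mul1r.
- by rewrite [RHS]uaddE.
- by rewrite [RHS]umulE.
Qed.

Lemma urelE x y : urel x y -> ueval ugenU x = ueval ugenU y.
Proof. by move=> h; rewrite -!uclassE; apply/uclassP/uc_rel. Qed.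

(* The algebra map sending each generator g to h g, when h is compatible with
   the defining relations. *)
Definition ulift (C : algType K) (h : ugen n -> C) (x : U) : C :=
  ueval h (urepr x).

Section Lift.
Variables (C : algType K) (h : ugen n -> C).
Hypothesis h_rel : forall x y, urel x y -> ueval h x = ueval h y.

Lemma ulift_class x : ulift h (uclass x) = ueval h x.
Proof. exact: ueval_cong (urepr_class x). Qed.

Lemma ulift_gen g : ulift h (ugenU g) = h g.
Proof. by rewrite ulift_class. Qed.

Lemma ulift_linear : linear (ulift h).
Proof.
move=> k x y; rewrite -[x]ureprK -[y]ureprK [_ *: _]uscaleE [_ + _]uaddE.
by rewrite !ulift_class /= -scalerAl mul1r.
Qed.

Lemma ulift_monoid : monoid_morphism (ulift h).
Proof.
split=> [|x y]; first by rewrite ulift_class /= scale1r.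
by rewrite -[x]ureprK -[y]ureprK [_ * _]umulE !ulift_class.
Qed.
End Lift.

Definition counit : U -> K^o := ulift counit_gen.
HB.instance Definition _ :=
  GRing.isLinear.Build K U K^o *:%R counit (ulift_linear counit_rel).
HB.instance Definition _ :=
  GRing.isMonoidMorphism.Build U K^o counit (ulift_monoid counit_rel).

End Udef.

Section Coproduct.
Variables (K : fieldType) (r s : K) (n : nat).

Local Notation U := (U r s n).
Local Notation ue := (ue r s).
Local Notation uf := (uf r s).
Local Notation ua := (ua r s).
Local Notation uaV := (uaV r s).
Local Notation ub := (ub r s).
Local Notation ubV := (ubV r s).

(* For j : 'I_n, [omega j] is omega_{j+1} = a_{j+1} b_{j+2} (1-based indices),
   except that it is a_n when j is the last index; likewise [omega' j] is
   omega'_{j+1} = a_{j+2} b_{j+1}, except that it is b_n for the last index.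
   [omegaV] and [omega'V] are the inverses. *)
Definition omega (j : 'I_n) : U :=
  ua j * (if insub j.+1 is Some k then ub k else 1).
Definition omegaV (j : 'I_n) : U :=
  uaV j * (if insub j.+1 is Some k then ubV k else 1).
Definition omega' (j : 'I_n) : U :=
  (if insub j.+1 is Some k then ua k else 1) * ub j.
Definition omega'V (j : 'I_n) : U :=
  (if insub j.+1 is Some k then uaV k else 1) * ubV j.

Definition Delta_gen (g : ugen n) : tens U U :=
  match g with
  | GE j => ue j \ox 1 + omega (lo j) \ox ue j
  | GF j => 1 \ox uf j + uf j \ox omega' (lo j)
  | _ => ugenU r s g \ox ugenU r s g
  end.

Definition Delta : U -> tens U U := ulift Delta_gen.

Lemma insub_lo (j : 'I_n.-1) : insub (lo j).+1 = Some (hi j) :> option 'I_n.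
Proof.
case: insubP => [k _ hk|]; last by rewrite hi_subproof.
by congr Some; apply: val_inj.
Qed.
Lemma omega_lo (j : 'I_n.-1) : omega (lo j) = ua (lo j) * ub (hi j).
Proof. by rewrite /omega insub_lo. Qed.
Lemma omega'_lo (j : 'I_n.-1) : omega' (lo j) = ua (hi j) * ub (lo j).
Proof. by rewrite /omega' insub_lo. Qed.

Lemma dotE (i : 'I_n) (j : nat) :
  dot (eps n i) (alpha n j) = ((i : nat) == j)%:R - ((i : nat) == j.+1)%:R.
Proof.
rewrite /dot (bigD1 i) //= big1 ?addr0; last first.
  by move=> k /negPf; rewrite -val_eqE /= !mxE => ->; rewrite mul0r.
by rewrite !mxE eqxx mul1r.
Qed.

Lemma torusC (g h : ugen n) : torus_gen g -> torus_gen h ->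
  ugenU r s g * ugenU r s h = ugenU r s h * ugenU r s g.
Proof. by move=> tg th; exact: (urelE (R1_comm r s tg th)). Qed.

Let ckE (c : K) (x : U) : c%:A * x = c *: x.
Proof. by rewrite -scalerAl mul1r. Qed.
Let ckE2 (c : K) (x : tens U U) : c%:A * x = c *: x.
Proof. by rewrite -scalerAl mul1r. Qed.

Lemma ua_ue (i : 'I_n) (j : 'I_n.-1) : ua i * ue j = r ^ dot (eps n i) (alpha n j) *: (ue j * ua i).
Proof. by have := urelE (R2_e r s i j); rewrite /= ckE. Qed.
Lemma ua_uf (i : 'I_n) (j : 'I_n.-1) :
  ua i * uf j = r ^ (- dot (eps n i) (alpha n j)) *: (uf j * ua i).
Proof. by have := urelE (R2_f r s i j); rewrite /= ckE. Qed.
Lemma ub_ue (i : 'I_n) (j : 'I_n.-1) : ub i * ue j = s ^ dot (eps n i) (alpha n j) *: (ue j * ub i).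
Proof. by have := urelE (R3_e r s i j); rewrite /= ckE. Qed.
Lemma ub_uf (i : 'I_n) (j : 'I_n.-1) :
  ub i * uf j = s ^ (- dot (eps n i) (alpha n j)) *: (uf j * ub i).
Proof. by have := urelE (R3_f r s i j); rewrite /= ckE. Qed.
Lemma ue_uf (i j : 'I_n.-1) : ue i * uf j - uf j * ue i =
  ((i == j)%:R / (r - s)) *: (omega (lo i) - omega' (lo i)).
Proof.
have := urelE (R4 r s i j).
by rewrite /= !ckE !scaleN1r omega_lo omega'_lo.
Qed.
Lemma ue_far (i j : 'I_n.-1) : far i j -> ue i * ue j = ue j * ue i.
Proof.
move=> h; have := urelE (R5_e r s h); rewrite /= scale0r ckE scaleN1r.
by move/eqP; rewrite subr_eq0 => /eqP.
Qed.
Lemma uf_far (i j : 'I_n.-1) : far i j -> uf i * uf j = uf j * uf i.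
Proof.
move=> h; have := urelE (R5_f r s h); rewrite /= scale0r ckE scaleN1r.
by move/eqP; rewrite subr_eq0 => /eqP.
Qed.
Lemma ue_serre (i j : 'I_n.-1) : j = i.+1 :> nat ->
  serre_form r s (ue i) (ue i) (ue j) = 0.
Proof.
by move=> h; have := urelE (R6_1 r s h); rewrite /= scale0r !ckE scaleN1r.
Qed.
Lemma ue_serre' (i j : 'I_n.-1) : j = i.+1 :> nat ->
  serre_form' r s (ue i) (ue j) (ue j) = 0.
Proof.
by move=> h; have := urelE (R6_2 r s h); rewrite /= scale0r !ckE scaleN1r.
Qed.
Lemma uf_serre (i j : 'I_n.-1) : j = i.+1 :> nat ->
  serre_form s^-1 r^-1 (uf i) (uf i) (uf j) = 0.
Proof.
move=> h; have := urelE (R7_1 r s h); rewrite /= scale0r !ckE scaleN1r.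
by rewrite /serre_form addrC [_ + r^-1]addrC [s^-1 * _]mulrC addrC.
Qed.
Lemma uf_serre' (i j : 'I_n.-1) : j = i.+1 :> nat ->
  serre_form' s^-1 r^-1 (uf i) (uf j) (uf j) = 0.
Proof.
move=> h; have := urelE (R7_2 r s h); rewrite /= scale0r !ckE scaleN1r.
by rewrite /serre_form' addrC [_ + r^-1]addrC [s^-1 * _]mulrC addrC.
Qed.

Lemma omegaC (i j : 'I_n.-1) : omega (lo i) * omega (lo j) = omega (lo j) * omega (lo i).
Proof.
rewrite !omega_lo -!mulrA [ub (hi i) * _]mulrA [ub (hi j) * _]mulrA.
rewrite [ub (hi i) * _]torusC // [ub (hi j) * _]torusC // !mulrA.
by rewrite [ua (lo i) * _]torusC // -!mulrA [ub (hi i) * _]torusC.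
Qed.
Lemma omega'C (i j : 'I_n.-1) :
  omega' (lo i) * omega' (lo j) = omega' (lo j) * omega' (lo i).
Proof.
rewrite !omega'_lo -!mulrA [ub (lo i) * _]mulrA [ub (lo j) * _]mulrA.
rewrite [ub (lo i) * _]torusC // [ub (lo j) * _]torusC // !mulrA.
by rewrite [ua (hi i) * _]torusC // -!mulrA [ub (lo i) * _]torusC.
Qed.

Let qcomm2 (x y z : U) k l : x * z = k *: (z * x) -> y * z = l *: (z * y) ->
  (x * y) * z = (k * l) *: (z * (x * y)).
Proof.
move=> h h'.
by rewrite -mulrA h' -scalerAr (mulrA x) h -scalerAl scalerA -mulrA [l * k]mulrC.
Qed.

Let ce (i j : nat) : K := r ^ ((i == j)%:R - (i == j.+1)%:R : int)
                        * s ^ ((i.+1 == j)%:R - (i == j)%:R : int).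
Let ce' (i j : nat) : K := r ^ ((i.+1 == j)%:R - (i == j)%:R : int)
                         * s ^ ((i == j)%:R - (i == j.+1)%:R : int).
Let cf (i j : nat) : K := r ^ (- ((i == j)%:R - (i == j.+1)%:R) : int)
                        * s ^ (- ((i.+1 == j)%:R - (i == j)%:R) : int).
Let cf' (i j : nat) : K := r ^ (- ((i.+1 == j)%:R - (i == j)%:R) : int)
                         * s ^ (- ((i == j)%:R - (i == j.+1)%:R) : int).

Let omega_ue (i j : 'I_n.-1) :
  omega (lo i) * ue j = ce i j *: (ue j * omega (lo i)).
Proof. by rewrite omega_lo (qcomm2 (ua_ue _ _) (ub_ue _ _)) !dotE. Qed.
Let omega_uf (i j : 'I_n.-1) :
  omega (lo i) * uf j = cf i j *: (uf j * omega (lo i)).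
Proof. by rewrite omega_lo (qcomm2 (ua_uf _ _) (ub_uf _ _)) !dotE. Qed.
Let omega'_ue (i j : 'I_n.-1) :
  omega' (lo i) * ue j = ce' i j *: (ue j * omega' (lo i)).
Proof. by rewrite omega'_lo (qcomm2 (ua_ue _ _) (ub_ue _ _)) !dotE. Qed.
Let omega'_uf (i j : 'I_n.-1) :
  omega' (lo i) * uf j = cf' i j *: (uf j * omega' (lo i)).
Proof. by rewrite omega'_lo (qcomm2 (ua_uf _ _) (ub_uf _ _)) !dotE. Qed.

Let cf_ce' i j : cf i j = ce' j i.
Proof.
by rewrite /cf /ce' !opprB ![(j == _)]eq_sym ![(j.+1 == _)]eq_sym.
Qed.

Let farE (i j : 'I_n.-1) : far i j ->
  [/\ (i == j :> nat) = false, (i.+1 == j :> nat) = false,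
      (j == i :> nat) = false & (j.+1 == i :> nat) = false].
Proof. by rewrite /far => h; split; apply/negbTE; lia. Qed.

Let ce_far (i j : 'I_n.-1) : far i j -> ce i j = 1.
Proof.
by case/farE=> h1 h2 _ h3; rewrite /ce h1 h2 [_ == j.+1]eq_sym h3 !subr0 mul1r.
Qed.
Let cf'_far (i j : 'I_n.-1) : far i j -> cf' i j = 1.
Proof.
by case/farE=> h1 h2 _ h3; rewrite /cf' h1 h2 [_ == j.+1]eq_sym h3 !subr0 mul1r.
Qed.

Let mul3 (v w : U) : v * w = w * v ->
  [/\ v * w * v = v * v * w, w * v * v = v * v * w,
      w * v * w = v * w * w & w * w * v = v * w * w].
Proof.
move=> h; have e : v * w * v = v * v * w by rewrite -mulrA -h mulrA.
by split=> //; rewrite -?h ?e //; rewrite -mulrA -h mulrA -h.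
Qed.

Let serre_tens (p q : K) (v w x y : U) : v * w = w * v ->
  serre_form p q (v \ox x) (v \ox x) (w \ox y) = (v * v * w) \ox serre_form p q x x y.
Proof.
move=> /mul3[e1 e2 _ _]; rewrite /serre_form !tensM_pure e1 e2.
by rewrite !pureDr -!scaleN1r !pureZr.
Qed.
Let serre_tens' (p q : K) (v w x y : U) : v * w = w * v ->
  serre_form' p q (v \ox x) (w \ox y) (w \ox y) = (v * w * w) \ox serre_form' p q x y y.
Proof.
move=> /mul3[_ _ e1 e2]; rewrite /serre_form' !tensM_pure e1 e2.
by rewrite !pureDr -!scaleN1r !pureZr.
Qed.
Let serre_tens2 (p q : K) (v w x y : U) : v * w = w * v ->
  serre_form p q (x \ox v) (x \ox v) (y \ox w) = serre_form p q x x y \ox (v * v * w).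
Proof.
move=> /mul3[e1 e2 _ _]; rewrite /serre_form !tensM_pure e1 e2.
by rewrite !pureDl -!scaleN1r !pureZl.
Qed.
Let serre_tens2' (p q : K) (v w x y : U) : v * w = w * v ->
  serre_form' p q (x \ox v) (y \ox w) (y \ox w) = serre_form' p q x y y \ox (v * w * w).
Proof.
move=> /mul3[_ _ e1 e2]; rewrite /serre_form' !tensM_pure e1 e2.
by rewrite !pureDl -!scaleN1r !pureZl.
Qed.

Hypotheses (r0 : r != 0) (s0 : s != 0).

Let torus_omega (g : ugen n) (j : 'I_n.-1) : torus_gen g ->
  ugenU r s g * omega (lo j) = omega (lo j) * ugenU r s g.
Proof.
move=> tg; rewrite omega_lo mulrA [_ * ua _]torusC // -mulrA.
by rewrite [_ * ub _]torusC // mulrA.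
Qed.
Let torus_omega' (g : ugen n) (j : 'I_n.-1) : torus_gen g ->
  ugenU r s g * omega' (lo j) = omega' (lo j) * ugenU r s g.
Proof.
move=> tg; rewrite omega'_lo mulrA [_ * ua _]torusC // -mulrA.
by rewrite [_ * ub _]torusC // mulrA.
Qed.

Let grp_e (g : ugen n) (j : 'I_n.-1) (k : K) : torus_gen g ->
  ugenU r s g * ue j = k *: (ue j * ugenU r s g) ->
  (ugenU r s g \ox ugenU r s g) * (ue j \ox 1 + omega (lo j) \ox ue j)
  = k *: ((ue j \ox 1 + omega (lo j) \ox ue j)
          * (ugenU r s g \ox ugenU r s g)).
Proof.
move=> tg h; rewrite mulrDr mulrDl !tensM_pure h torus_omega // mulr1 mul1r.
by rewrite pureZl pureZr scalerDr.
Qed.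
Let grp_f (g : ugen n) (j : 'I_n.-1) (k : K) : torus_gen g ->
  ugenU r s g * uf j = k *: (uf j * ugenU r s g) ->
  (ugenU r s g \ox ugenU r s g) * (1 \ox uf j + uf j \ox omega' (lo j))
  = k *: ((1 \ox uf j + uf j \ox omega' (lo j))
          * (ugenU r s g \ox ugenU r s g)).
Proof.
move=> tg h; rewrite mulrDr mulrDl !tensM_pure h torus_omega' // mulr1 mul1r.
by rewrite pureZl pureZr scalerDr.
Qed.

Let sum4 (V : zmodType) (a b c d b' c' : V) :
  a + b + (c + d) - (a + c' + (b' + d)) = (b - b') + (c - c').
Proof.
rewrite [c + d]addrC (addrACA a b) [b' + d]addrC (addrACA a c').
by rewrite opprD (addrACA (a + d)) subrr add0r [c' + b']addrC opprD addrACA.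
Qed.

Let ceE (i j : nat) : j = i.+1 ->
  [/\ forall k, ce k k = r / s, ce i j = s & ce j i = r^-1].
Proof.
move=> ->; have h k : (k == k.+1 = false) * (k.+1 == k = false).
  by split; apply/negbTE; lia.
have h2 : (i.+2 == i) = false by apply/negbTE; lia.
have h3 : (i == i.+2) = false by apply/negbTE; lia.
rewrite /ce; split=> [k||]; rewrite ?eqxx ?h ?h2 ?h3 /=.
- by rewrite subr0 sub0r.
- by rewrite subrr !subr0 mul1r.
- by rewrite sub0r subrr mulr1.
Qed.
Let cfE (i j : nat) : j = i.+1 ->
  [/\ forall k, cf' k k = s^-1 / r^-1, cf' i j = r^-1 & cf' j i = s^-1^-1].
Proof.
move=> ->; have h k : (k == k.+1 = false) * (k.+1 == k = false).
  by split; apply/negbTE; lia.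
have h2 : (i.+2 == i) = false by apply/negbTE; lia.
have h3 : (i == i.+2) = false by apply/negbTE; lia.
rewrite /cf' !invrK; split=> [k||]; rewrite ?eqxx ?h ?h2 ?h3 /=.
- by rewrite sub0r opprK subr0 mulrC.
- by rewrite subr0 subrr oppr0 mulr1.
- by rewrite subrr oppr0 mul1r sub0r opprK.
Qed.

Lemma Delta_rel x y : urel r s x y -> ueval Delta_gen x = ueval Delta_gen y.
Proof.
case=> {x y}.
- move=> g h tg th; have D g' : torus_gen g' ->
    Delta_gen g' = ugenU r s g' \ox ugenU r s g' by case: g'.
  by rewrite /= !D // !tensM_pure torusC.
- move=> i /=; have := urelE (R1_a r s i); rewrite /= !scale1r => h.
  by rewrite tensM_pure h.
- move=> i /=; have := urelE (R1_b r s i); rewrite /= !scale1r => h.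
  by rewrite tensM_pure h.
- by move=> i j; rewrite /= ckE2; apply: grp_e => //; exact: ua_ue.
- by move=> i j; rewrite /= ckE2; apply: grp_f => //; exact: ua_uf.
- by move=> i j; rewrite /= ckE2; apply: grp_e => //; exact: ub_ue.
- by move=> i j; rewrite /= ckE2; apply: grp_f => //; exact: ub_uf.
- move=> i j; rewrite /= !ckE2 !scaleN1r !tensM_pure.
  rewrite !(mulrDl, mulrDr) !tensM_pure !(mulr1, mul1r).
  have -> : (omega (lo i) * uf j) \ox (ue i * omega' (lo j))
          = (uf j * omega (lo i)) \ox (omega' (lo j) * ue i).
    by rewrite omega_uf omega'_ue pureZl pureZr cf_ce'.
  rewrite sum4 -pureBl -pureBr !ue_uf -!omega_lo -!omega'_lo.
  rewrite pureZl pureZr -scalerDr; case: eqP => [<-|]; last first.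
    by rewrite mul0r !scale0r.
  by congr (_ *: _); rewrite pureBl pureBr addrC addrA subrK.
- move=> i j h; rewrite /= scale0r ckE2 scaleN1r; apply/eqP; rewrite subr_eq0.
  apply/eqP; rewrite !(mulrDl, mulrDr) !tensM_pure !(mulr1, mul1r).
  rewrite !omega_ue (ce_far h) ce_far ?scale1r; last by rewrite /far orbC.
  by rewrite (ue_far h) omegaC !addrA; congr (_ + _); rewrite addrAC.
- move=> i j h; rewrite /= scale0r ckE2 scaleN1r; apply/eqP; rewrite subr_eq0.
  apply/eqP; rewrite !(mulrDl, mulrDr) !tensM_pure !(mulr1, mul1r).
  rewrite !omega'_uf (cf'_far h) cf'_far ?scale1r; last by rewrite /far orbC.
  by rewrite (uf_far h) omega'C !addrA; congr (_ + _); rewrite addrAC.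
- move=> i j h; have [h1 h2 h3] := ceE h.
  rewrite /= scale0r !ckE2 scaleN1r; apply: (serre_form_sum r0 s0).
  + by rewrite !tensM_pure mulr1 mul1r omega_ue pureZl h1.
  + by rewrite !tensM_pure mulr1 mul1r omega_ue pureZl h2.
  + by rewrite !tensM_pure mulr1 mul1r omega_ue pureZl h3.
  + rewrite serre_tens2; last by [].
    by rewrite (ue_serre h) pure0l.
  + rewrite serre_tens; last exact: omegaC.
    by rewrite (ue_serre h) pure0r.
- move=> i j h; have [h1 h2 h3] := ceE h.
  rewrite /= scale0r !ckE2 scaleN1r; apply: (serre_form_sum' r0 s0).
  + by rewrite !tensM_pure mulr1 mul1r omega_ue pureZl h1.
  + by rewrite !tensM_pure mulr1 mul1r omega_ue pureZl h2.
  + by rewrite !tensM_pure mulr1 mul1r omega_ue pureZl h3.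
  + rewrite serre_tens2'; last by [].
    by rewrite (ue_serre' h) pure0l.
  + rewrite serre_tens'; last exact: omegaC.
    by rewrite (ue_serre' h) pure0r.
- move=> i j h; have [h1 h2 h3] := cfE h.
  rewrite /= scale0r !ckE2 scaleN1r [r^-1 + _]addrC [r^-1 * _]mulrC.
  have [r0' s0'] : r^-1 != 0 /\ s^-1 != 0 by rewrite !invr_eq0.
  apply: (serre_form_sum s0' r0').
  + by rewrite !tensM_pure mulr1 mul1r omega'_uf pureZr h1.
  + by rewrite !tensM_pure mulr1 mul1r omega'_uf pureZr h2.
  + by rewrite !tensM_pure mulr1 mul1r omega'_uf pureZr h3.
  + rewrite serre_tens; last by [].
    by rewrite (uf_serre h) pure0r.
  + rewrite serre_tens2; last exact: omega'C.
    by rewrite (uf_serre h) pure0l.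
- move=> i j h; have [h1 h2 h3] := cfE h.
  rewrite /= scale0r !ckE2 scaleN1r [r^-1 + _]addrC [r^-1 * _]mulrC.
  have [r0' s0'] : r^-1 != 0 /\ s^-1 != 0 by rewrite !invr_eq0.
  apply: (serre_form_sum' s0' r0').
  + by rewrite !tensM_pure mulr1 mul1r omega'_uf pureZr h1.
  + by rewrite !tensM_pure mulr1 mul1r omega'_uf pureZr h2.
  + by rewrite !tensM_pure mulr1 mul1r omega'_uf pureZr h3.
  + rewrite serre_tens'; last by [].
    by rewrite (uf_serre' h) pure0r.
  + rewrite serre_tens2'; last exact: omega'C.
    by rewrite (uf_serre' h) pure0l.
Qed.

Lemma Delta_ugen g : Delta (ugenU r s g) = Delta_gen g.
Proof. exact: ulift_gen Delta_rel g. Qed.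
Lemma Delta_linear : linear Delta.
Proof. exact: ulift_linear Delta_rel. Qed.
Lemma Delta_monoid : monoid_morphism Delta.
Proof. exact: ulift_monoid Delta_rel. Qed.

End Coproduct.

Record amod (K : fieldType) (A : algType K) := Amod {
  amod_sort :> lmodType K;
  act : A -> amod_sort -> amod_sort;
  act_linl : forall m, linear (act^~ m);
  act_linr : forall a, linear (act a);
  act1 : forall m, act 1 m = m;
  actM : forall a b m, act (a * b) m = act a (act b m)
}.
Arguments act {K A} M a m : rename.

Section TensorModule.
Variables (K : fieldType) (A B : algType K) (M : amod A) (N : amod B).

Definition tact (t : tens A B) (x : tens M N) : tens M N :=
  tlift (fun a b => tmap (act M a) (act N b) x) t.

Let tact_bilin (x : tens M N) :
  bilin (fun (a : A) (b : B) => tmap (act M a) (act N b) x).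
Proof.
split=> [a k b b'|b k a a'] /=; rewrite /tmap /tlift scaler_sumr -big_split /=;
  apply: eq_bigr => p _.
  by rewrite (act_linl p.2) pureDr pureZr.
by rewrite (act_linl p.1) pureDl pureZl.
Qed.

Lemma tact_pure a b m n : tact (a \ox b) (m \ox n) = act M a m \ox act N b n.
Proof.
rewrite /tact (tlift_pure (tact_bilin _)) tmap_pure //; exact: act_linr.
Qed.

Lemma tact_linl x : linear (tact^~ x).
Proof. exact: (tlift_linear (tact_bilin x)). Qed.

Lemma tact_linr t : linear (tact t).
Proof.
move=> k x y; rewrite /tact /tlift scaler_sumr -big_split /=.
apply: eq_bigr => p _; apply: tmap_linear; exact: act_linr.
Qed.

Lemma tact1 x : tact 1 x = x.
Proof.
elim/tens_ind_pure: x => [m n|x y hx hy|].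
- by rewrite tact_pure !act1.
- by rewrite (linD (tact_linr _)) hx hy.
- exact: lin0 (tact_linr _).
Qed.

Lemma tactM t t' x : tact (t * t') x = tact t (tact t' x).
Proof.
have D := fun a => linD (tact_linr a); have Z := fun a => lin0 (tact_linr a).
have D' := fun a => linD (tact_linl a); have Z' := fun a => lin0 (tact_linl a).
rewrite /= in D' Z'.
elim/tens_ind_pure: x => [m n|x y hx hy|]; last 2 first.
- by rewrite !D hx hy.
- by rewrite !Z.
elim/tens_ind_pure: t => [a b|x y hx hy|]; last 2 first.
- by rewrite mulrDl !D' hx hy.
- by rewrite mul0r !Z'.
elim/tens_ind_pure: t' => [a' b'|x y hx hy|]; last 2 first.
- by rewrite mulrDr !D' D hx hy.
- by rewrite mulr0 !Z' Z.
by rewrite tensM_pure !tact_pure !actM.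
Qed.

Definition tmod : amod (tens A B) := Amod tact_linl tact_linr tact1 tactM.

End TensorModule.

Section Subspaces.
Variables (K : fieldType) (V : lmodType K).

Definition span_set (S : set V) : set V :=
  [set x | exists t : seq (K * V),
     (forall p, p \in t -> S p.2) /\ x = \sum_(p <- t) p.1 *: p.2].

Definition is_basis (W : set V) (d : nat) (u : 'I_d -> V) : Prop :=
  (forall k, W (u k)) /\
  (forall x, W x -> exists! c : {ffun 'I_d -> K}, x = \sum_(k < d) c k *: u k).

End Subspaces.

Inductive subalg_gen (K : fieldType) (A : algType K) (S : set A) : set A :=
| sg_gen x : S x -> subalg_gen S x
| sg_one : subalg_gen S 1
| sg_scale k x : subalg_gen S x -> subalg_gen S (k *: x)
| sg_add x y : subalg_gen S x -> subalg_gen S y -> subalg_gen S (x + y)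
| sg_mul x y : subalg_gen S x -> subalg_gen S y -> subalg_gen S (x * y).

(* The sum of the t z for z in Q^+, acting on X.  It is meaningful at the
   vectors that are annihilated by all but finitely many of the t z. *)
Definition sum_act (K : fieldType) (A : algType K) (n : nat) (X : amod A)
    (t : 'rV[int]_n -> A) (x : X) : X :=
  \sum_(z \in @Qplus n) act X (t z) x.

Arguments tflip {K M N} x.
Arguments Delta {K r s n} x.

Section Quantum.
Variables (K : fieldType) (r s : K) (n : nat).

Local Notation U := (U r s n).
Local Notation Lambda := 'rV[int]_n.
Local Notation ue := (ue r s).
Local Notation uf := (uf r s).
Local Notation ua := (ua r s).
Local Notation ub := (ub r s).
Local Notation omega := (omega r s).
Local Notation omegaV := (omegaV r s).
Local Notation omega' := (omega' r s).
Local Notation omega'V := (omega'V r s).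
Local Notation eps := (eps n).
Local Notation alpha := (alpha n).

Definition omega_pm (b : bool) (j : 'I_n) : U :=
  if b then omega j else omegaV j.
Definition omega'_pm (b : bool) (j : 'I_n) : U :=
  if b then omega' j else omega'V j.

Definition UB : set U := subalg_gen
  [set x | (exists j, x = ue j) \/ (exists b j, x = omega_pm b j)].
Definition UB' : set U := subalg_gen
  [set x | (exists j, x = uf j) \/ (exists b j, x = omega'_pm b j)].

(* The value of (omega'_i, omega_j); recall that the last omega'_i is b_n and
   the last omega_j is a_n. *)
Definition torus_pair (i j : 'I_n) : K :=
  if (i.+1 < n)%N then
    if (j.+1 < n)%N then
      r ^ dot (eps j) (alpha i) * s ^ dot (eps j.+1) (alpha i)
    else r ^ dot (eps j) (alpha i)
  else
    if (j.+1 < n)%N then s ^ (- dot (eps i) (alpha j)) else 1.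

(* Only the restriction of [form] to UB' x UB matters.  The coproduct of UB' is
   opposite to Delta, whence the exchange of p.1 and p.2 in [hp_mulr]. *)
Record hopf_pairing (form : U -> U -> K) : Prop := {
  hp_linr : forall y x x' k, UB' y -> UB x -> UB x' ->
    form y (k *: x + x') = k * form y x + form y x';
  hp_linl : forall y y' x k, UB' y -> UB' y' -> UB x ->
    form (k *: y + y') x = k * form y x + form y' x;
  hp_1l : forall x, UB x -> form 1 x = counit x;
  hp_1r : forall y, UB' y -> form y 1 = counit y;
  hp_mulr : forall y x x' (t : seq (U * U)), UB' y -> UB x -> UB x' ->
    (forall p, p \in t -> UB' p.1 /\ UB' p.2) ->
    Delta y = \sum_(p <- t) p.1 \ox p.2 ->
    form y (x * x') = \sum_(p <- t) form p.2 x * form p.1 x';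
  hp_mull : forall y y' x (t : seq (U * U)), UB' y -> UB' y' -> UB x ->
    (forall p, p \in t -> UB p.1 /\ UB p.2) ->
    Delta x = \sum_(p <- t) p.1 \ox p.2 ->
    form (y * y') x = \sum_(p <- t) form y p.1 * form y' p.2;
  hp_fe : forall i j, form (uf i) (ue j) = (i == j)%:R / (s - r);
  hp_torus : forall b c i j, form (omega'_pm b i) (omega_pm c j) =
    if b == c then torus_pair i j else (torus_pair i j)^-1;
  hp_f_torus : forall i c j, form (uf i) (omega_pm c j) = 0;
  hp_torus_e : forall b i j, form (omega'_pm b i) (ue j) = 0
}.

Definition upow (x xV : U) (z : int) : U :=
  match z with Posz k => x ^+ k | Negz k => xV ^+ k.+1 end.

Definition omega_wt (l : Lambda) : U :=
  \prod_(j < n) upow (omega j) (omegaV j) (acoord l j).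
Definition omega'_wt (l : Lambda) : U :=
  \prod_(j < n) upow (omega' j) (omega'V j) (acoord l j).

Definition fwt (form : U -> U -> K) (l m : Lambda) : K :=
  (form (omega'_wt m) (omega_wt l))^-1.

(* [Uplus z] is U^+_z and [Uminus z] is U^-_{-z}. *)
Definition Uplus (z : Lambda) : set U := span_set
  [set x | exists w : seq 'I_n.-1,
     \sum_(j <- w) alpha j = z /\ x = \prod_(j <- w) ue j].
Definition Uminus (z : Lambda) : set U := span_set
  [set x | exists w : seq 'I_n.-1,
     \sum_(j <- w) alpha j = z /\ x = \prod_(j <- w) uf j].

Definition dual_bases (form : U -> U -> K) (d : Lambda -> nat)
    (v u : forall z, 'I_(d z) -> U) : Prop :=
  forall z, Qplus z ->
    [/\ is_basis (Uplus z) (@u z), is_basis (Uminus z) (@v z) &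
        forall k l, form (v z k) (u z l) = (k == l)%:R].

Definition Theta_ (d : Lambda -> nat) (v u : forall z, 'I_(d z) -> U)
    (z : Lambda) : tens U U :=
  \sum_(k < d z) v z k \ox u z k.

Definition wtspace (M : amod U) (l : Lambda) : set M :=
  [set m | forall i : 'I_n, act M (ua i) m = r ^ dot (eps i) l *: m /\
                            act M (ub i) m = s ^ dot (eps i) l *: m].

Definition wt (M : amod U) : set Lambda :=
  [set l | exists2 m : M, m != 0 & wtspace l m].

Record catO (M : amod U) : Prop := {
  catO_sum : forall m : M, exists (t : seq Lambda) (c : Lambda -> M),
    [/\ uniq t, forall l, l \in t -> wt M l /\ wtspace l (c l)
      & m = \sum_(l <- t) c l];
  catO_direct : forall (t : seq Lambda) (c : Lambda -> M),
    uniq t -> (forall l, l \in t -> wtspace l (c l)) ->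
    \sum_(l <- t) c l = 0 -> forall l, l \in t -> c l = 0;
  catO_fin : forall l, wt M l -> exists d (b : 'I_d -> M),
    is_basis (@wtspace M l) b;
  catO_bound : exists F : seq Lambda, forall l, wt M l ->
    exists2 mu, mu \in F & Qplus (mu - l)
}.

(* A definite description; see [ftildeP] for existence. *)
Definition ftilde (form : U -> U -> K) (N' N : amod U) :
    tens N' N -> tens N' N :=
  @xget (tens N' N -> tens N' N) id [set g : tens N' N -> tens N' N | linear g /\
    forall l mu (m' : N') (m : N), wtspace l m' -> wtspace mu m ->
      g (m' \ox m) = fwt form l mu *: (m' \ox m)].

Definition Rmx (form : U -> U -> K) (d : Lambda -> nat)
    (v u : forall z, 'I_(d z) -> U) (N N' : amod U) (x : tens N N') :
    tens N' N :=
  sum_act (X := tmod N' N) (Theta_ v u) (ftilde form (tflip x)).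

(* (1 (x) Delta)(Theta_z) in (U (x) U) (x) U and (Delta (x) 1)(Theta_z) in
   U (x) (U (x) U): the bracketings are those of the modules on which they act
   in the hexagon identities. *)
Definition idDelta_Theta_ (d : Lambda -> nat) (v u : forall z, 'I_(d z) -> U)
    (z : Lambda) : tens (tens U U) U :=
  tassoc (tmap id Delta (Theta_ v u z)).
Definition Deltaid_Theta_ (d : Lambda -> nat) (v u : forall z, 'I_(d z) -> U)
    (z : Lambda) : tens U (tens U U) :=
  tassocV (tmap Delta id (Theta_ v u z)).

End Quantum.

Arguments Rmx {K r s n} form {d} v u N N' x.

Section FtildeExists.
Variables (K : fieldType) (r s : K) (n : nat).
Local Notation U := (U r s n).
Local Notation Lambda := 'rV[int]_n.

Lemma wtspace0 (M : amod U) l : wtspace l (0 : M).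
Proof. by move=> i; rewrite !(lin0 (act_linr _)) !scaler0. Qed.

Lemma wtspace_lin (M : amod U) l k (x y : M) :
  wtspace l x -> wtspace l y -> wtspace l (k *: x + y).
Proof.
move=> hx hy i; have [h1 h2] := hx i; have [h3 h4] := hy i.
rewrite !act_linr h1 h2 h3 h4 !scalerDr !scalerA.
by rewrite ![k * _]mulrC.
Qed.

Section WeightSums.
Variables (M : amod U) (hM : catO M).

Definition wtseq (t : seq (Lambda * M)) : Prop :=
  forall p, p \in t -> wtspace p.1 p.2.

Lemma wtseq_sum0 (V : lmodType K) (g : Lambda -> M -> V) (t : seq (Lambda * M)) :
  (forall l, linear (g l)) -> wtseq t -> \sum_(p <- t) p.2 = 0 ->
  \sum_(p <- t) g p.1 p.2 = 0.
Proof.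
move=> lg ht h0.
have part (W : zmodType) (F : Lambda * M -> W) : \sum_(p <- t) F p =
    \sum_(l <- undup (unzip1 t)) \sum_(p <- t | p.1 == l) F p.
  under [RHS]eq_bigr do rewrite big_mkcond.
  rewrite exchange_big /= big_seq [RHS]big_seq; apply: eq_bigr => p pt.
  have pu : p.1 \in undup (unzip1 t) by rewrite mem_undup map_f.
  rewrite (bigD1_seq p.1) ?undup_uniq //= eqxx big1 ?addr0 // => l.
  by rewrite eq_sym => /negPf ->.
pose c l : M := \sum_(p <- t | p.1 == l) p.2.
have wc l : wtspace l (c l).
  rewrite /c big_seq_cond; elim/big_ind: _ => [|x y hx hy|p /andP[pt /eqP <-]].
  - exact: wtspace0.
  - by rewrite -[x]scale1r; exact: wtspace_lin.
  - exact: ht.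
rewrite part; apply: big1_seq => l /andP[_ lt].
rewrite (eq_bigr (fun p => g l p.2)) => [|p /eqP-> //].
have -> : \sum_(p <- t | p.1 == l) g l p.2 = g l (c l).
  rewrite -big_filter -(lin_sum (lg l)); congr (g l _).
  by rewrite /c big_filter.
rewrite (catO_direct hM (undup_uniq _) (fun l _ => wc l) _ lt) ?(lin0 (lg l)) //.
by rewrite -part.
Qed.

Lemma wtseq_exists (m : M) : exists t, wtseq t /\ m = \sum_(p <- t) p.2.
Proof.
have [t [c [_ h ->]]] := catO_sum hM m.
exists [seq (l, c l) | l <- t]; split; last by rewrite big_map.
by move=> _ /mapP[l /h[_ hl] ->].
Qed.

Definition wtdec (m : M) : seq (Lambda * M) := projT1 (cid (wtseq_exists m)).

Lemma wtdec_wt m : wtseq (wtdec m).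
Proof. by rewrite /wtdec; case: cid => t []. Qed.
Lemma wtdec_sum m : \sum_(p <- wtdec m) p.2 = m.
Proof. by rewrite /wtdec; case: cid => t []. Qed.

Definition wtext (V : lmodType K) (g : Lambda -> M -> V) (m : M) : V :=
  \sum_(p <- wtdec m) g p.1 p.2.

Lemma wtextE (V : lmodType K) (g : Lambda -> M -> V) (t : seq (Lambda * M)) :
  (forall l, linear (g l)) -> wtseq t ->
  wtext g (\sum_(p <- t) p.2) = \sum_(p <- t) g p.1 p.2.
Proof.
move=> lg ht; set m := \sum_(p <- t) p.2; apply/esym/eqP.
rewrite -subr_eq0 -scaleN1r /wtext scaler_sumr.
pose t' := t ++ [seq (p.1, -1 *: p.2) | p <- wtdec m].
have /(_ _ _) h := @wtseq_sum0 V g t' lg.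
move: h; rewrite !big_cat !big_map /= -scaler_sumr wtdec_sum scaleN1r subrr.
under [X in _ -> _ -> _ + X = _]eq_bigr do rewrite (linZ (lg _)).
move=> -> //; move=> p; rewrite mem_cat => /orP[|/mapP[q qt ->]]; first exact: ht.
by have := wtspace_lin (-1) (wtdec_wt qt) (wtspace0 M q.1); rewrite addr0.
Qed.

Lemma wtext_wt (V : lmodType K) (g : Lambda -> M -> V) l m :
  (forall l, linear (g l)) -> wtspace l m -> wtext g m = g l m.
Proof.
move=> lg hm; have := @wtextE V g [:: (l, m)] lg; rewrite !big_seq1 /=.
by apply=> p; rewrite inE => /eqP->.
Qed.

Lemma wtext_linear (V : lmodType K) (g : Lambda -> M -> V) :
  (forall l, linear (g l)) -> linear (wtext g).
Proof.
move=> lg k x y.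
pose t := [seq (p.1, k *: p.2) | p <- wtdec x] ++ wtdec y.
have ht : wtseq t.
  move=> p; rewrite mem_cat => /orP[/mapP[q qt ->]|]; last exact: wtdec_wt.
  by have := wtspace_lin k (wtdec_wt qt) (wtspace0 M q.1); rewrite addr0.
have := wtextE lg ht; rewrite !big_cat !big_map /= -scaler_sumr !wtdec_sum => ->.
rewrite /wtext scaler_sumr; congr (_ + _).
by apply: eq_bigr => p _; rewrite (linZ (lg _)).
Qed.

End WeightSums.

Lemma ftildeP (form : U -> U -> K) (N' N : amod U) : catO N' -> catO N ->
  linear (@ftilde K r s n form N' N) /\
  forall l mu (m' : N') (m : N), wtspace l m' -> wtspace mu m ->
    ftilde form (m' \ox m) = fwt form l mu *: (m' \ox m).
Proof.
move=> hN' hN; rewrite /ftilde; case: xgetP => [g _ //|hno]; exfalso.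
pose S l : N -> N := wtext hN (fun mu m => fwt form l mu *: m).
have lS l : linear (S l).
  apply: wtext_linear => mu k x y /=; rewrite scalerDr !scalerA.
  by rewrite [k * _]mulrC.
pose b (m' : N') (m : N) := wtext hN' (fun l m' => m' \ox S l m) m'.
have lb m : forall l, linear (fun m' : N' => m' \ox S l m).
  by move=> l k x y /=; rewrite pureDl pureZl.
have bb : bilin b.
  split=> [m' k x y|m]; last exact: wtext_linear.
  rewrite /b /wtext scaler_sumr -big_split /=.
  by apply: eq_bigr => p _; rewrite lS pureDr pureZr.
apply: (hno (tlift b)); split; first exact: tlift_linear.
move=> l mu m' m hm' hm; rewrite tlift_pure // /b (wtext_wt hN' _ hm') //.
rewrite /S (wtext_wt hN _ hm) ?pureZr // => nu k x y /=.
by rewrite scalerDr !scalerA [k * _]mulrC.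
Qed.

End FtildeExists.

(* Main.v *)
Require Import Defs.
From mathcomp Require Import all_boot all_order all_algebra.
From mathcomp Require Import boolp classical_sets fsbigop.
From mathcomp Require Import zify.

(* Evaluated on vectors of weights lambda, mu, nu, each side of a hexagon is a
   finite sum, and the two sums agree term by term provided
     (1 (x) Delta)(u_z) = sum_{p + q = z} (v_l^p v_k^q, u_z) u_l^p omega_q (x) u_k^q,
   because omega_q acts on the weight space of weight lambda by the scalar
   (omega'_lambda, omega_q) = f(- q, lambda) and f is bimultiplicative.  This
   expansion follows from Delta(u_z) lying in the span of the
   U^+_p omega_q (x) U^+_q, from (y, x omega_q) = (y, x) for y in U^-, and from
   the orthogonality of U^-_{-p} and U^+_q for p <> q.  Reading the pairing from
   right to left and replacing Delta by its opposite exchanges the roles of e_j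
   and f_j, so that one abstract argument on words covers both hexagons. *)

Set Implicit Arguments.
Unset Strict Implicit.
Unset Printing Implicit Defensive.

Import Order.TTheory GRing.Theory Num.Theory.
Local Open Scope ring_scope.

(** No basis of U^+ is written down and no commutation scalar between group-likes and e_j is used in
    the expansion. The coproduct of a word in the e_j has some anonymous coefficients; since the
    pairing is multiplicative, the same coefficients occur in (v_p v_q, word), so they never need to
    be known. The factor omega_q is not a scalar in U. The expansion of Delta is therefore stated
    behind a bilinear map [phi] that has already applied both tensor factors to vectors. Duality is
    then used a second time, in the other direction: sum_z (v_p v_q, u_z) v_z = v_p v_q. This turns
    the expanded coproduct into a product acting on one factor, which is what two successive
    R-matrices produce. The obstacle is finiteness. Theta is an infinite sum, and the sum over Q^+
    takes the default value 0 at vectors with infinitely many nonzero terms, so even its linearity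
    needs local finiteness. Each vector is given a finite [box] of degrees outside which U^+ kills
    it, and one box is chosen to serve all the sums of a hexagon. *)

(** * Pairings on words and the expansion of the coproduct in dual bases *)

Section WordPairing.
Variables (K : fieldType) (n : nat) (A : algType K).
Local Notation I := 'I_n.-1.
Local Notation Lambda := 'rV[int]_n.

Definition wordwt (a : seq I) : Lambda := \sum_(j <- a) alpha n j.
Definition word (x : I -> A) (a : seq I) : A := \prod_(j <- a) x j.
(** At the families e_j and f_j this is convertible to [Uplus z] and [Uminus z], so the results
    below apply to those spaces directly. *)
Definition word_span (x : I -> A) (z : Lambda) : set A :=
  span_set [set y | exists a, wordwt a = z /\ y = word x a].

Lemma word_cat x a b : word x (a ++ b) = word x a * word x b.
Proof. exact: big_cat. Qed.
Lemma word_cons x j a : word x (j :: a) = x j * word x a.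
Proof. exact: big_cons. Qed.
Lemma word_nil x : word x [::] = 1.
Proof. exact: big_nil. Qed.
Lemma word_seq1 x j : word x [:: j] = x j.
Proof. exact: big_seq1. Qed.
Lemma wordwt_cat a b : wordwt (a ++ b) = wordwt a + wordwt b.
Proof. exact: big_cat. Qed.
Lemma wordwt_cons j a : wordwt (j :: a) = alpha n j + wordwt a.
Proof. exact: big_cons. Qed.
Lemma wordwt_nil : wordwt [::] = 0.
Proof. exact: big_nil. Qed.

Lemma word_in_span x a : word_span x (wordwt a) (word x a).
Proof.
exists [:: (1, word x a)]; split; last by rewrite big_seq1 scale1r.
by move=> p; rewrite inE => /eqP ->; exists a.
Qed.

Lemma word_sg x S a : (forall j, S (x j)) -> subalg_gen S (word x a).
Proof.
move=> Sx; elim: a => [|j a IH]; first by rewrite word_nil; exact: sg_one.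
by rewrite word_cons; apply: sg_mul IH; exact: sg_gen.
Qed.

Lemma sg_sum S (T : Type) (t : seq T) (g : T -> A) :
  (forall i, subalg_gen S (g i)) -> subalg_gen S (\sum_(i <- t) g i).
Proof.
move=> Sg; elim/big_ind: _ => [|x y|i _]; [|exact: sg_add|exact: Sg].
by rewrite -(scale0r 1); apply/sg_scale/sg_one.
Qed.

(** The partial sum [y] keeps its membership in the span because the pairing is known to be additive
    only on subalgebras. *)
Lemma word_span_ind x z (P : A -> Prop) :
  P 0 -> (forall k a y, wordwt a = z -> word_span x z y -> P y ->
    P (k *: word x a + y)) ->
  forall y, word_span x z y -> P y.
Proof.
move=> P0 PD _ [t [ht ->]]; elim: t ht => [|p t IH] ht; first by rewrite big_nil.
have {}IH := IH (fun q qt => ht q (mem_behead (s := p :: t) qt)).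
rewrite big_cons; have [a [az ->]] := ht p (mem_head _ _).
apply: PD => //; exists t; split=> // q qt; apply: ht.
exact: (mem_behead (s := p :: t) qt).
Qed.

Lemma word_span_sg x S z y : (forall j, S (x j)) -> word_span x z y ->
  subalg_gen S y.
Proof.
move=> Sx; elim/word_span_ind => [|k a x' _ _]; last first.
  by apply: sg_add; apply: sg_scale; exact: word_sg.
by rewrite -(scale0r 1); apply/sg_scale/sg_one.
Qed.

Lemma word_span_lin x z k p q :
  word_span x z p -> word_span x z q -> word_span x z (k *: p + q).
Proof.
move=> [t [ht ->]] [t' [ht' ->]].
exists ([seq (k * p.1, p.2) | p <- t] ++ t'); split.
  by move=> i; rewrite mem_cat => /orP[/mapP[c /ht hc ->]|/ht'].
rewrite big_cat big_map scaler_sumr; congr (_ + _).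
by apply: eq_bigr => i _; rewrite scalerA.
Qed.

Lemma word_span0 x z : word_span x z 0.
Proof. by exists [::]; rewrite big_nil. Qed.

Lemma word_span_mul x z z' y y' :
  word_span x z y -> word_span x z' y' -> word_span x (z + z') (y * y').
Proof.
move=> hy hy'; elim/word_span_ind: hy => [|k a p az _ hp].
  by rewrite mul0r; exact: word_span0.
rewrite mulrDl -scalerAl; apply: word_span_lin hp.
elim/word_span_ind: hy' => [|l b q bz _ hq]; first by rewrite mulr0; exact: word_span0.
rewrite mulrDr -scalerAr -word_cat; apply: word_span_lin hq.
by rewrite -az -bz -wordwt_cat; exact: word_in_span.
Qed.

Variables (e w f : I -> A) (D : A -> tens A A) (F : A -> A -> K).
Variables (eps : A -> K) (chi : I -> A -> K).

(** The domains on which the laws of [F] are assumed. [BY] has no group-like generators: the left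
    arguments come from one nilpotent half. *)
Let BX := subalg_gen [set x | (exists j, x = e j) \/ (exists j, x = w j)].
Let BY := subalg_gen [set x | exists j, x = f j].

(** What remains of a Hopf pairing when only the coproduct of words in [e] is to be expanded: [f]
    merely supplies test elements. [wp_F_fM] is the twisted derivation property dual to the
    coproduct of [f j]. Exchanging the two halves of U, with the opposite coproduct, gives a second
    instance. *)
Record word_pairing : Prop := {
  wp_D_lin : linear D;
  wp_D_1 : D 1 = 1;
  wp_D_M : forall x y, D (x * y) = D x * D y;
  wp_D_e : forall j, D (e j) = e j \ox 1 + w j \ox e j;
  wp_D_w : forall j, D (w j) = w j \ox w j;
  wp_comm : forall i j, exists c, w i * e j = c *: (e j * w i);
  wp_eps_1 : eps 1 = 1;
  wp_eps_M : forall x y, eps (x * y) = eps x * eps y;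
  wp_eps_e : forall j, eps (e j) = 0;
  wp_eps_w : forall j, eps (w j) = 1;
  wp_F_linr : forall y x x' k, BY y -> BX x -> BX x' ->
    F y (k *: x + x') = k * F y x + F y x';
  wp_F_linl : forall y y' x k, BY y -> BY y' -> BX x ->
    F (k *: y + y') x = k * F y x + F y' x;
  wp_F_1l : forall x, BX x -> F 1 x = eps x;
  wp_F_mull : forall y y' x (t : seq (A * A)), BY y -> BY y' -> BX x ->
    (forall p, p \in t -> BX p.1 /\ BX p.2) ->
    D x = \sum_(p <- t) p.1 \ox p.2 ->
    F (y * y') x = \sum_(p <- t) F y p.1 * F y' p.2;
  wp_F_f1 : forall j, F (f j) 1 = 0;
  wp_F_fe : forall i j, i != j -> F (f i) (e j) = 0;
  wp_F_fw : forall i j, F (f i) (w j) = 0;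
  (* [chi j] is the pairing with the group-like element attached to [f j] *)
  wp_F_fM : forall j x x', BX x -> BX x' ->
    F (f j) (x * x') = F (f j) x * eps x' + chi j x * F (f j) x';
  wp_chi_e : forall i j, chi i (e j) = 0
}.

Hypothesis wp : word_pairing.

Local Notation Ee := (word e).
Local Notation Ew := (word w).
Local Notation Ef := (word f).

Let BXee a : BX (Ee a).
Proof. by apply: word_sg => j; left; exists j. Qed.
Let BXww a : BX (Ew a).
Proof. by apply: word_sg => j; right; exists j. Qed.
Let BYff a : BY (Ef a).
Proof. by apply: word_sg => j; exists j. Qed.
Let BXew a b : BX (Ee a * Ew b).
Proof. by apply: sg_mul; [exact: BXee|exact: BXww]. Qed.
Let BYf j : BY (f j).
Proof. by apply: sg_gen; exists j. Qed.
Let BXe j : BX (e j).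
Proof. by apply: sg_gen; left; exists j. Qed.
Let BXw j : BX (w j).
Proof. by apply: sg_gen; right; exists j. Qed.
Let BX0 : BX 0.
Proof. by rewrite -(scale0r 1); apply/sg_scale/sg_one. Qed.
Let BY0 : BY 0.
Proof. by rewrite -(scale0r 1); apply/sg_scale/sg_one. Qed.

Lemma pairing0r y : BY y -> F y 0 = 0.
Proof.
move=> hy; have := wp_F_linr wp 1 hy BX0 BX0.
by rewrite scale1r addr0 mul1r => /(congr1 (fun x => x - F y 0)); rewrite addrK subrr.
Qed.
Lemma pairing0l x : BX x -> F 0 x = 0.
Proof.
move=> hx; have := wp_F_linl wp 1 BY0 BY0 hx.
by rewrite scale1r addr0 mul1r => /(congr1 (fun y => y - F 0 x)); rewrite addrK subrr.
Qed.
Lemma pairingZr k y x : BY y -> BX x -> F y (k *: x) = k * F y x.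
Proof.
by move=> hy hx; have := wp_F_linr wp k hy hx BX0; rewrite !addr0 pairing0r // addr0.
Qed.

Lemma word_w_e b j : exists c, Ew b * e j = c *: (e j * Ew b).
Proof.
elim: b => [|i b [c IH]]; first by exists 1; rewrite word_nil mul1r mulr1 scale1r.
have [c' hc'] := wp_comm wp i j; exists (c * c').
by rewrite word_cons -mulrA IH -scalerAr (mulrA (w i)) hc' -scalerAl scalerA mulrA.
Qed.

Lemma Delta_word_w b : D (Ew b) = Ew b \ox Ew b.
Proof.
elim: b => [|i b IH]; first by rewrite word_nil (wp_D_1 wp).
by rewrite word_cons (wp_D_M wp) IH (wp_D_w wp) tensM_pure.
Qed.

(** Each letter contributes either e_j to the left factor, or w_j to the left and e_j to the right.
    Hence the group-like part on the left is spelled by the very word on the right. Letters are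
    appended at the end, and a new e_j on the left is moved past the group-likes at the cost of a
    scalar. *)
Lemma Delta_word_e c : exists t : seq (K * (seq I * seq I)),
  (forall p, p \in t -> wordwt p.2.1 + wordwt p.2.2 = wordwt c) /\
  D (Ee c) = \sum_(p <- t) p.1 *: ((Ee p.2.1 * Ew p.2.2) \ox Ee p.2.2).
Proof.
elim/last_ind: c => [|c j [t [ht IH]]].
  exists [:: (1, ([::], [::]))]; split.
    by move=> p; rewrite inE => /eqP ->; rewrite !wordwt_nil addr0.
  by rewrite big_seq1 /= !word_nil mulr1 scale1r (wp_D_1 wp).
(* The scalar depends on [b]; it is chosen as a function of [b] so that the new list of terms can be
   written explicitly. *)
have [c' hc'] : exists c', forall b, Ew b * e j = c' b *: (e j * Ew b).
  exists (fun b => projT1 (cid (word_w_e b j))) => b; by case: cid.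
exists (flatten [seq [:: (p.1 * c' p.2.2, (rcons p.2.1 j, p.2.2));
                     (p.1, (p.2.1, rcons p.2.2 j))] | p <- t]); split.
  move=> p /flatten_mapP[q /ht hq]; rewrite -(cats1 c) wordwt_cat -hq !inE.
  by case/orP=> /eqP -> /=; rewrite -cats1 wordwt_cat; [rewrite addrAC|rewrite addrA].
rewrite -cats1 word_cat word_seq1 (wp_D_M wp) IH (wp_D_e wp).
rewrite big_flatten big_map mulr_suml; apply: eq_bigr => p _.
rewrite big_cons big_seq1 /= -scalerAl mulrDr !tensM_pure !mulr1 scalerDr.
rewrite -!cats1 !word_cat !word_seq1 !mulrA; congr (_ + _).
by rewrite -mulrA hc' -scalerAr pureZl scalerA mulrA.
Qed.

(** The trailing group-like [Ew g] multiplies both tensor factors and is kept general so that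
    inductions on the left argument close. *)
Lemma pairing_mull_word y y' c g : BY y -> BY y' ->
  forall t : seq (K * (seq I * seq I)),
  D (Ee c) = \sum_(p <- t) p.1 *: ((Ee p.2.1 * Ew p.2.2) \ox Ee p.2.2) ->
  F (y * y') (Ee c * Ew g) = \sum_(p <- t) p.1 *
    (F y (Ee p.2.1 * Ew (p.2.2 ++ g)) * F y' (Ee p.2.2 * Ew g)).
Proof.
move=> hy hy' t ht.
pose t' := [seq (p.1 *: (Ee p.2.1 * Ew (p.2.2 ++ g)), Ee p.2.2 * Ew g) | p <- t].
rewrite (wp_F_mull wp (t := t')) //.
- rewrite big_map; apply: eq_bigr => p _ /=.
  by rewrite pairingZr // mulrA.
- by move=> _ /mapP[p _ ->]; split; [apply/sg_scale/BXew|exact: BXew].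
- rewrite (wp_D_M wp) ht Delta_word_w big_map mulr_suml; apply: eq_bigr => p _.
  by rewrite -scalerAl tensM_pure pureZl word_cat mulrA.
Qed.

Lemma eps_word_w g : eps (Ew g) = 1.
Proof.
elim: g => [|j g IH]; first by rewrite word_nil (wp_eps_1 wp).
by rewrite word_cons (wp_eps_M wp) (wp_eps_w wp) IH mulr1.
Qed.

Lemma eps_word_e a : a != [::] -> eps (Ee a) = 0.
Proof.
by case: a => // j a _; rewrite word_cons (wp_eps_M wp) (wp_eps_e wp) mul0r.
Qed.

Lemma pairing_f_word_w j g : F (f j) (Ew g) = 0.
Proof.
elim: g => [|i g IH]; first by rewrite word_nil (wp_F_f1 wp).
by rewrite word_cons (wp_F_fM wp) // IH (wp_F_fw wp) mul0r mulr0 addr0.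
Qed.

Lemma pairing_f_mulw j x g : BX x -> F (f j) (x * Ew g) = F (f j) x.
Proof.
by move=> hx; rewrite (wp_F_fM wp) // pairing_f_word_w eps_word_w mulr1 mulr0 addr0.
Qed.

(** Peeling a letter off [b] leaves extra group-likes in both factors of the coproduct. Against a
    single f_j they disappear by the derivation rule; against the shorter word they disappear by
    induction, and both sides become the same sum. *)
Lemma pairing_mulw b a g : F (Ef b) (Ee a * Ew g) = F (Ef b) (Ee a).
Proof.
elim: b a g => [|j b IH] a g.
  by rewrite word_nil !(wp_F_1l wp) // (wp_eps_M wp) eps_word_w mulr1.
have [t [_ ht]] := Delta_word_e a.
rewrite -[in RHS](mulr1 (Ee a)) -[in RHS](word_nil w) word_cons.
rewrite !(pairing_mull_word _ _ _ ht) //; apply: eq_bigr => p _.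
by rewrite !pairing_f_mulw // !IH.
Qed.

(** By the derivation rule f_j pairs to 0 with every word in e of length other than one: [chi] kills
    a leading e, and the counit kills a nonempty remainder. *)
Lemma pairing_f_word_e (j : I) a : wordwt a != alpha n j -> F (f j) (Ee a) = 0.
Proof.
case: a => [|i a] h; first by rewrite word_nil (wp_F_f1 wp).
rewrite word_cons (wp_F_fM wp) // (wp_chi_e wp) mul0r addr0.
case: a h => [|k a] h; last by rewrite eps_word_e // mulr0.
rewrite (wp_F_fe wp) ?mul0r //; apply: contraNneq h => ->.
by rewrite wordwt_cons wordwt_nil addr0.
Qed.

(** The coproduct preserves total weight. A nonzero term needs weight alpha_j in its left part and
    the weight of the remaining letters in its right part, which add up to the weight of the word in
    f. *)
Lemma pairing_word_orth b a : wordwt b != wordwt a -> F (Ef b) (Ee a) = 0.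
Proof.
elim: b a => [|j b IH] a h.
  rewrite word_nil (wp_F_1l wp) // eps_word_e //.
  by apply: contraNneq h => ->.
have [t [hw ht]] := Delta_word_e a.
rewrite -(mulr1 (Ee a)) -(word_nil w) word_cons.
rewrite (pairing_mull_word _ _ _ ht) // big_seq big1 // => p /hw hp.
rewrite !pairing_mulw pairing_f_mulw //.
have [h1|h1] := eqVneq (wordwt p.2.1) (alpha n j); last first.
  by rewrite pairing_f_word_e // mul0r mulr0.
rewrite IH ?mulr0 //; apply: contraNneq h => h2.
by rewrite wordwt_cons h2 -h1 hp.
Qed.


Lemma pairing_sumr (T : Type) (t : seq T) (c : T -> K) (g : T -> A) y :
  BY y -> (forall i, BX (g i)) ->
  F y (\sum_(i <- t) c i *: g i) = \sum_(i <- t) c i * F y (g i).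
Proof.
move=> hy hg; elim: t => [|i t IH]; first by rewrite !big_nil pairing0r.
rewrite !big_cons (wp_F_linr wp) // ?IH //.
by apply: sg_sum => k; apply: sg_scale; exact: hg.
Qed.
Lemma pairing_suml (T : Type) (t : seq T) (c : T -> K) (g : T -> A) x :
  BX x -> (forall i, BY (g i)) ->
  F (\sum_(i <- t) c i *: g i) x = \sum_(i <- t) c i * F (g i) x.
Proof.
move=> hx hg; elim: t => [|i t IH]; first by rewrite !big_nil pairing0l.
rewrite !big_cons (wp_F_linl wp) // ?IH //.
by apply: sg_sum => k; apply: sg_scale; exact: hg.
Qed.

Lemma span_e_BX z x : word_span e z x -> BX x.
Proof. by apply: word_span_sg => j; left; exists j. Qed.
Lemma span_f_BY z y : word_span f z y -> BY y.
Proof. by apply: word_span_sg => j; exists j. Qed.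

Lemma pairing_span_mulw z y a g : word_span f z y ->
  F y (Ee a * Ew g) = F y (Ee a).
Proof.
elim/word_span_ind => [|k b y' _ hy' IH]; first by rewrite !pairing0l.
by have hb := span_f_BY hy'; rewrite !(wp_F_linl wp) // IH pairing_mulw.
Qed.

Lemma pairing_orth z z' y x : word_span f z y -> word_span e z' x -> z != z' ->
  F y x = 0.
Proof.
move=> hy hx zz'; elim/word_span_ind: hy => [|k b y' hb hy' IH].
  by rewrite pairing0l //; exact: span_e_BX hx.
rewrite (wp_F_linl wp) ?IH ?addr0 //; [|exact: span_f_BY hy'|exact: span_e_BX hx].
elim/word_span_ind: hx {IH} => [|l a x' ha hx' IH]; first by rewrite pairing0r ?mulr0.
rewrite (wp_F_linr wp) //; last exact: span_e_BX hx'.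
by rewrite pairing_word_orth ?hb ?ha // mulr0 add0r.
Qed.

Lemma wordwt_Qplus a : @Qplus n (wordwt a).
Proof.
exists (fun j => count_mem j a); elim: a => [|i a IH].
  by rewrite wordwt_nil big1.
rewrite wordwt_cons IH; under [RHS]eq_bigr do rewrite /= mulrnDr.
rewrite big_split /=; congr (_ + _); rewrite (bigD1 i) //= eqxx big1 ?addr0 // => j.
by rewrite eq_sym => /negPf ->.
Qed.

Variables (d : Lambda -> nat) (v u : forall z, 'I_(d z) -> A).
Hypothesis vu_dual : forall z, @Qplus n z ->
  [/\ is_basis (word_span e z) (@u z), is_basis (word_span f z) (@v z) &
      forall k l, F (@v z k) (@u z l) = (k == l)%:R].

Lemma dual_expand_e z x : Qplus z -> word_span e z x ->
  x = \sum_k F (@v z k) x *: @u z k.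
Proof.
move=> zQ hx; have [[hu bu] [hv _] dual] := vu_dual zQ.
have [c [hc _]] := bu _ hx; rewrite {1}hc; apply: eq_bigr => k _; congr (_ *: _).
rewrite hc pairing_sumr; [|exact: span_f_BY (hv k)|by move=> l; exact: span_e_BX (hu l)].
rewrite (bigD1 k) //= dual eqxx mulr1 big1 ?addr0 // => l.
by rewrite dual eq_sym => /negPf ->; rewrite mulr0.
Qed.

Lemma dual_expand_f z y : Qplus z -> word_span f z y ->
  y = \sum_k F y (@u z k) *: @v z k.
Proof.
move=> zQ hy; have [[hu _] [hv bv] dual] := vu_dual zQ.
have [c [hc _]] := bv _ hy; rewrite {1}hc; apply: eq_bigr => k _; congr (_ *: _).
rewrite hc pairing_suml; [|exact: span_e_BX (hu k)|by move=> l; exact: span_f_BY (hv l)].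
rewrite (bigD1 k) //= dual eqxx mulr1 big1 ?addr0 // => l.
by rewrite dual => /negPf ->; rewrite mulr0.
Qed.

(** By orthogonality only the degree of [y] survives, where the sum is its expansion in the dual
    basis. This is the recombination that replaces a double sum over v_z by the single element v_p
    v_q. *)
Lemma dual_collapse_f (V : lmodType K) (g : A -> V) (S : seq Lambda) z y :
  linear g -> uniq S -> (forall t, t \in S -> Qplus t) -> z \in S ->
  word_span f z y ->
  \sum_(t <- S) \sum_k F y (@u t k) *: g (@v t k) = g y.
Proof.
move=> lg uS SQ zS hy; rewrite (bigD1_seq z) //= [X in _ + X]big1_seq ?addr0
  => [|t /andP[tz tS]].
  rewrite [in RHS](dual_expand_f (SQ _ zS) hy) (lin_sum lg).
  by apply: eq_bigr => k _; rewrite (linZ lg).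
apply: big1 => k _; have [[hu _] _ _] := vu_dual (SQ _ tS).
by rewrite (pairing_orth hy (hu k)) ?scale0r // eq_sym.
Qed.

Lemma Delta_dual_expand (V : lmodType K) (phi : A -> A -> V) (kappa : Lambda -> K)
    (S : seq Lambda) (z : Lambda) (x : A) :
  bilin phi -> (forall a b c, phi (a * Ew c) b = kappa (wordwt c) *: phi a b) ->
  uniq S -> (forall t, t \in S -> Qplus t) ->
  (forall a b, wordwt a + wordwt b = z -> wordwt a \in S /\ wordwt b \in S) ->
  word_span e z x ->
  tlift phi (D x) = \sum_(p <- S) \sum_(q <- S) \sum_l \sum_k
    (kappa q * F (@v p l * @v q k) x) *: phi (@u p l) (@u q k).
Proof.
move=> bphi hk uS SQ Sz; have phiD := tlift_linear bphi.
have BYv p l : p \in S -> BY (@v p l).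
  by move=> /SQ/vu_dual[_ [hv _] _]; exact: span_f_BY (hv l).
elim/word_span_ind => [|c W y hW hy IH].
  rewrite (lin0 (wp_D_lin wp)) (lin0 phiD) big1_seq // => p /andP[_ pS].
  rewrite big1_seq // => q /andP[_ qS]; rewrite big1 // => l _; rewrite big1 // => k _.
  by rewrite pairing0r ?mulr0 ?scale0r //; apply: sg_mul; exact: BYv.
rewrite (wp_D_lin wp) phiD IH.
have -> : tlift phi (D (word e W)) = \sum_(p <- S) \sum_(q <- S) \sum_l \sum_k
    (kappa q * F (@v p l * @v q k) (word e W)) *: phi (@u p l) (@u q k).
  have [t [tW ht]] := Delta_word_e W.
  rewrite ht (lin_sum phiD).
  transitivity (\sum_(i <- t) \sum_(p <- S) \sum_(q <- S) \sum_l \sum_k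
     (i.1 * kappa q * (F (@v p l) (Ee i.2.1) * F (@v q k) (Ee i.2.2)))
       *: phi (@u p l) (@u q k)).
    rewrite big_seq [RHS]big_seq; apply: eq_bigr => i /tW hi.
    have [aS bS] : wordwt i.2.1 \in S /\ wordwt i.2.2 \in S by apply: Sz; rewrite hi.
    rewrite (linZ phiD) tlift_pure // hk.
    (* For a given term of the coproduct, orthogonality leaves only p and q equal to the weights of
       its left and right subwords. *)
    rewrite [RHS](bigD1_seq (wordwt i.2.1)) //= [X in _ + X]big1_seq ?addr0; last first.
      move=> p /andP[pa pS]; rewrite big1 // => q _; rewrite big1 // => l _.
      rewrite big1 // => k _; have [_ [hv _] _] := vu_dual (SQ _ pS).
      by rewrite (pairing_orth (hv l) (word_in_span _ _)) // mul0r mulr0 scale0r.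
    rewrite [RHS](bigD1_seq (wordwt i.2.2)) //= [X in _ + X]big1_seq ?addr0; last first.
      move=> q /andP[qb qS]; rewrite big1 // => l _.
      rewrite big1 // => k _; have [_ [hv _] _] := vu_dual (SQ _ qS).
      by rewrite (pairing_orth (hv k) (word_in_span _ _)) // !mulr0 scale0r.
    rewrite {1}(dual_expand_e (SQ _ aS) (word_in_span _ _)).
    rewrite {1}(dual_expand_e (SQ _ bS) (word_in_span _ _)).
    rewrite (lin_sum (bphi.2 _)) scalerA scaler_sumr; apply: eq_bigr => l _ /=.
    rewrite (linZ (bphi.2 _)) (lin_sum (bphi.1 _)) !scaler_sumr.
    apply: eq_bigr => k _; rewrite (linZ (bphi.1 _)) !scalerA.
    by rewrite !mulrA.
  rewrite exchange_big /=; rewrite big_seq [RHS]big_seq; apply: eq_bigr => p pS.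
  rewrite exchange_big /=; rewrite big_seq [RHS]big_seq; apply: eq_bigr => q qS.
  rewrite exchange_big /=; apply: eq_bigr => l _.
  rewrite exchange_big /=; apply: eq_bigr => k _.
  rewrite -scaler_suml; congr (_ *: _).
  (* With an empty group-like word attached, multiplicativity gives back the coefficients of [t];
     the group-likes it leaves are then absorbed by the pairing. *)
  rewrite -(mulr1 (word e W)) -(word_nil w).
  have [_ [hvp _] _] := vu_dual (SQ _ pS); have [_ [hvq _] _] := vu_dual (SQ _ qS).
  rewrite (pairing_mull_word _ (BYv _ _ pS) (BYv _ _ qS) ht) mulr_sumr.
  apply: eq_bigr => i _.
  rewrite (pairing_span_mulw _ _ (hvp l)) (pairing_span_mulw _ _ (hvq k)).
  by rewrite [RHS]mulrCA -mulrA.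
rewrite scaler_sumr -big_split /=; rewrite big_seq [RHS]big_seq; apply: eq_bigr => p pS.
rewrite scaler_sumr -big_split /=; rewrite big_seq [RHS]big_seq; apply: eq_bigr => q qS.
rewrite scaler_sumr -big_split /=; apply: eq_bigr => l _.
rewrite scaler_sumr -big_split /=; apply: eq_bigr => k _.
rewrite scalerA -scalerDl (wp_F_linr wp) //; last first.
- exact: span_e_BX hy.
- by apply: sg_mul; exact: BYv.
by rewrite mulrDr mulrCA.
Qed.

End WordPairing.

(** * Coordinates in simple roots and finite boxes in Q^+ *)

Section Boxes.
Variable n : nat.
Local Notation I := 'I_n.-1.
Local Notation Lambda := 'rV[int]_n.

Lemma acoordD (l m : Lambda) j : acoord (l + m) j = acoord l j + acoord m j.
Proof. by rewrite /acoord -big_split; apply: eq_bigr => i _; rewrite mxE. Qed.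
Lemma acoord0 (j : 'I_n) : acoord 0 j = 0.
Proof. by rewrite /acoord big1 // => i _; rewrite mxE. Qed.
Lemma acoordN (l : Lambda) j : acoord (- l) j = - acoord l j.
Proof. by rewrite /acoord -sumrN; apply: eq_bigr => i _; rewrite mxE. Qed.
Lemma acoordMn (l : Lambda) k j : acoord (l *+ k) j = acoord l j *+ k.
Proof.
by elim: k => [|k IH]; rewrite ?mulr0n ?acoord0 // !mulrS acoordD IH.
Qed.
Lemma acoord_sum (T : Type) (t : seq T) (g : T -> Lambda) j :
  acoord (\sum_(i <- t) g i) j = \sum_(i <- t) acoord (g i) j.
Proof.
by elim: t => [|i t IH]; rewrite ?big_nil ?acoord0 // !big_cons acoordD IH.
Qed.

Lemma acoord_eps (k : nat) (i : 'I_n) : acoord (eps n k) i = (k <= i)%N%:R.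
Proof.
have [ki|ki] := leqP k i; last first.
  rewrite /acoord big1 // => j ji; rewrite mxE; case: eqP => // jk.
  by move: ki ji; rewrite jk ltnNge => /negbTE ->.
rewrite /acoord (bigD1 (Ordinal (leq_ltn_trans ki (ltn_ord i)))) //= mxE eqxx.
rewrite big1 ?addr0 // => j /andP[_ jk]; rewrite mxE.
by move: jk; rewrite -val_eqE /= => /negPf ->.
Qed.

Lemma acoord_alpha (k : nat) (i : 'I_n) : acoord (alpha n k) i = (k == i)%N%:R.
Proof. by rewrite /alpha acoordD acoordN !acoord_eps; case: ltngtP. Qed.

Lemma acoord_Qplus (c : I -> nat) j :
  acoord (\sum_(k < n.-1) alpha n k *+ c k) (lo j) = (c j)%:Z.
Proof.
rewrite acoord_sum (bigD1 j) //= acoordMn acoord_alpha eqxx /= big1 ?addr0.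
  exact: natz.
move=> k kj; rewrite acoordMn acoord_alpha /=.
by move: kj; rewrite -val_eqE /= => /negPf ->; rewrite mul0rn.
Qed.

Lemma Qplus_acoord_ge0 (z : Lambda) (j : I) : Qplus z -> 0 <= acoord z (lo j).
Proof. by move=> [c ->]; rewrite acoord_Qplus. Qed.

Lemma QplusD (y z : Lambda) : Qplus y -> Qplus z -> Qplus (y + z).
Proof.
move=> [b ->] [c ->]; exists (fun j => (b j + c j)%N).
by rewrite -big_split; apply: eq_bigr => j _; rewrite mulrnDr.
Qed.

(** A finite exhaustion of Q^+; it is used as an index set, so repetitions are removed. *)
Definition box (N : nat) : seq Lambda :=
  undup [seq \sum_j alpha n (j : I) *+ (c j : nat) | c : {ffun I -> 'I_N}].

Lemma box_uniq N : uniq (box N).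
Proof. exact: undup_uniq. Qed.

Lemma mem_box N (z : Lambda) :
  z \in box N <-> Qplus z /\ forall j : I, acoord z (lo j) < N%:Z.
Proof.
rewrite mem_undup; split=> [/mapP[c _ ->]|[[c ->] h]].
  split; first by exists (fun j => c j : nat).
  by move=> j; rewrite (acoord_Qplus (fun j => c j : nat)) ltz_nat.
have hc j : (c j < N)%N by rewrite -ltz_nat -acoord_Qplus.
apply/mapP; exists [ffun j => Ordinal (hc j)]; first by rewrite mem_enum.
by apply: eq_bigr => j _; rewrite ffunE.
Qed.

Lemma box_Qplus N z : z \in box N -> Qplus z.
Proof. by case/mem_box. Qed.

Lemma box_mono N N' z : (N <= N')%N -> z \in box N -> z \in box N'.
Proof.
move=> le /mem_box[zQ h]; apply/mem_box; split=> // j.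
by apply: lt_le_trans (h j) _; rewrite lez_nat.
Qed.

Lemma box_split N y z : Qplus y -> Qplus z -> y + z \in box N ->
  y \in box N /\ z \in box N.
Proof.
move=> yQ zQ /mem_box[_ h]; split; apply/mem_box; split=> // j;
  have := h j; rewrite acoordD;
  have := Qplus_acoord_ge0 j yQ; have := Qplus_acoord_ge0 j zQ; lia.
Qed.

Lemma box_add N N' y z : y \in box N -> z \in box N' -> y + z \in box (N + N').
Proof.
move=> /mem_box[yQ hy] /mem_box[zQ hz]; apply/mem_box; split.
  exact: QplusD.
by move=> j; rewrite acoordD; have := hy j; have := hz j; lia.
Qed.

Lemma sub_box (y : Lambda) : exists N, forall z z', Qplus z -> Qplus z' ->
  z + z' = y -> z \in box N.
Proof.
(* Each coordinate of [z] lies between 0 and that of [y]; the sum of absolute values bounds them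
   all, and the successor makes the bound strict. *)
exists (\sum_(j < n.-1) `|acoord y (lo j)|%N).+1 => z z' zQ z'Q <-.
apply/mem_box; split=> // j; rewrite (bigD1 j) //= acoordD.
by have := Qplus_acoord_ge0 j zQ; have := Qplus_acoord_ge0 j z'Q; lia.
Qed.

Lemma Qplus_box (z : Lambda) : Qplus z -> exists N, z \in box N.
Proof.
move=> zQ; have [N hN] := sub_box z; exists N; apply: (hN _ 0); rewrite ?addr0 //.
by exists (fun => 0%N); rewrite big1.
Qed.

End Boxes.

(** * Locally finite sums over Q^+ *)

Section SumAct.
Variables (K : fieldType) (A : algType K) (n : nat) (X : amod A).
Variable t : 'rV[int]_n -> A.

Definition vanishes_off (N : nat) (x : X) : Prop :=
  forall z, Qplus z -> z \notin box n N -> act X (t z) x = 0.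

Lemma vanishes_off_mono N N' x : (N <= N')%N -> vanishes_off N x ->
  vanishes_off N' x.
Proof. by move=> le h z zQ /(contra (box_mono le)); exact: h. Qed.

Lemma sum_act_box N x : vanishes_off N x ->
  sum_act t x = \sum_(z <- box n N) act X (t z) x.
Proof.
move=> h; rewrite /sum_act (fsbigE (box n N)) ?box_uniq //.
- by rewrite big_seq_cond [RHS]big_seq_cond; apply: eq_bigl => z; case zb: (z \in _);
    rewrite //= mem_set //; exact: box_Qplus zb.
- by move=> z; exact: box_Qplus.
Qed.

(** Local finiteness allows both vectors to be summed over one box; without it the default value 0
    could break additivity. *)
Lemma sum_act_linear : (forall x, exists N, vanishes_off N x) ->
  linear (sum_act (X := X) t).
Proof.
move=> lf k x y; have [N1 h1] := lf x; have [N2 h2] := lf y.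
pose N := (N1 + N2)%N.
have hx : vanishes_off N x by apply: vanishes_off_mono h1; exact: leq_addr.
have hy : vanishes_off N y by apply: vanishes_off_mono h2; exact: leq_addl.
rewrite !(@sum_act_box N) //; last first.
  by move=> z zQ zN; rewrite act_linr hx // hy // scaler0 addr0.
by rewrite scaler_sumr -big_split; apply: eq_bigr => z _; rewrite act_linr.
Qed.

Lemma vanishes_off_sum x y :
  (exists N, vanishes_off N x) -> (exists N, vanishes_off N y) ->
  exists N, vanishes_off N (x + y).
Proof.
move=> [N1 h1] [N2 h2]; exists (N1 + N2)%N => z zQ zN.
rewrite (linD (act_linr _)) (vanishes_off_mono (leq_addr _ _) h1 zQ zN).
by rewrite (vanishes_off_mono (leq_addl _ _) h2 zQ zN) addr0.
Qed.

End SumAct.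

(** * Weight vectors and local nilpotency of U^+ in category O *)

Section WeightModules.
Variables (K : fieldType) (r s : K) (n : nat).
Hypotheses (r0 : r != 0) (s0 : s != 0).
Local Notation I := 'I_n.-1.
Local Notation U := (U r s n).
Local Notation Lambda := 'rV[int]_n.

Lemma dotDr (u v w : Lambda) : dot u (v + w) = dot u v + dot u w.
Proof. by rewrite /dot -big_split; apply: eq_bigr => i _; rewrite mxE mulrDr. Qed.
Lemma dotNr (u v : Lambda) : dot u (- v) = - dot u v.
Proof. by rewrite /dot -sumrN; apply: eq_bigr => i _; rewrite mxE mulrN. Qed.

Section OneModule.
Variable M : amod U.

Lemma act_ue_wt (j : I) l (m : M) : wtspace l m ->
  wtspace (l + alpha n j) (act M (ue r s j) m).
Proof.
move=> hm i; have [ha hb] := hm i.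
rewrite -!actM ua_ue ub_ue !(linZ (act_linl _)) !actM ha hb.
by rewrite !(linZ (act_linr _)) !scalerA !(dotDr _ l) !expfzDr // ![_ ^ dot _ l * _]mulrC.
Qed.
Lemma act_uf_wt (j : I) l (m : M) : wtspace l m ->
  wtspace (l - alpha n j) (act M (uf r s j) m).
Proof.
move=> hm i; have [ha hb] := hm i.
rewrite -!actM ua_uf ub_uf !(linZ (act_linl _)) !actM ha hb.
by rewrite !(linZ (act_linr _)) !scalerA !(dotDr _ l) !dotNr !expfzDr //
  ![_ ^ dot _ l * _]mulrC.
Qed.

Lemma act_Uplus_wt z x l (m : M) : Uplus z x -> wtspace l m ->
  wtspace (l + z) (act M x m).
Proof.
move=> hx hm; elim/word_span_ind: hx => [|k a y az _ hy].
  by rewrite (lin0 (act_linl _)); exact: wtspace0.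
rewrite (act_linl m); apply: wtspace_lin hy; rewrite -az.
elim: a {az} => [|j a IH]; first by rewrite wordwt_nil word_nil act1 addr0.
by rewrite word_cons wordwt_cons actM addrCA addrC; apply: act_ue_wt.
Qed.
Lemma act_Uminus_wt z x l (m : M) : Uminus z x -> wtspace l m ->
  wtspace (l - z) (act M x m).
Proof.
move=> hx hm; elim/word_span_ind: hx => [|k a y az _ hy].
  by rewrite (lin0 (act_linl _)); exact: wtspace0.
rewrite (act_linl m); apply: wtspace_lin hy; rewrite -az.
elim: a {az} => [|j a IH]; first by rewrite wordwt_nil word_nil act1 subr0.
by rewrite word_cons wordwt_cons actM opprD addrCA addrC; apply: act_uf_wt.
Qed.

Hypothesis hM : catO M.

(** All elements of U^+_z are quantified, not only basis vectors, so that the property also applies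
    to products u_p u_q. *)
Definition killed_off (N : nat) (m : M) : Prop :=
  forall z x, Qplus z -> z \notin box n N -> Uplus z x -> act M x m = 0.

Lemma killed_off_mono N N' m : (N <= N')%N -> killed_off N m -> killed_off N' m.
Proof. by move=> le h z x zQ /(contra (box_mono le)); exact: h. Qed.

Lemma killed_off_wt l m : wtspace l m -> exists N, killed_off N m.
Proof.
move=> hm; have [F hF] := catO_bound hM.
have [N hN] : exists N, forall mu, mu \in F -> forall z, Qplus z ->
    Qplus (mu - (l + z)) -> z \in box n N.
  elim: F {hF} => [|mu F [N IH]]; first by exists 0%N.
  have [N' hN'] := sub_box (mu - l); exists (N + N')%N => mu'.
  rewrite inE => /orP[/eqP-> z zQ hz|hmu z zQ hz].
    (* Here mu - l is the sum of z and mu - (l + z), both in Q^+, so z is one of the boundedly many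
       parts of mu - l. *)
    apply: (box_mono (leq_addl _ _)); apply: hN' zQ hz _.
    by rewrite addrC opprD addrA subrK.
  by apply: (box_mono (leq_addr _ _)); exact: IH hmu _ zQ hz.
exists N => z x zQ /negP zN hx; apply/eqP/negPn/negP => h; apply: zN.
have [|mu muF hmu] := hF (l + z); last exact: hN muF _ zQ hmu.
by exists (act M x m) => //; exact: act_Uplus_wt.
Qed.

Lemma exists_killed_off m : exists N, killed_off N m.
Proof.
have [t [ht ->]] := wtseq_exists hM m.
elim: t ht => [|p t IH] ht.
  by exists 0%N => z x *; rewrite big_nil (lin0 (act_linr _)).
have [|N hN] := IH; first by move=> q qt; apply: ht; rewrite inE qt orbT.
have [|N' hN'] := @killed_off_wt p.1 p.2; first by apply: ht; rewrite mem_head.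
exists (N + N')%N => z x zQ zN hx.
rewrite big_cons (linD (act_linr _)) (killed_off_mono (leq_addl _ _) hN' zQ zN hx).
by rewrite (killed_off_mono (leq_addr _ _) hN zQ zN hx) addr0.
Qed.

Lemma weight_linear_ext (V : lmodType K) (g h : M -> V) :
  linear g -> linear h -> (forall l m, wtspace l m -> g m = h m) -> g =1 h.
Proof.
move=> lg lh gh m; have [t [ht ->]] := wtseq_exists hM m.
rewrite (lin_sum lg) (lin_sum lh); rewrite big_seq [RHS]big_seq.
by apply: eq_bigr => p /ht; exact: gh.
Qed.

End OneModule.

End WeightModules.

(** * The Hopf pairing on the torus and the scalars f *)

Lemma subalg_gen_sub (K : fieldType) (A : algType K) (S T : set A) :
  (forall x, S x -> subalg_gen T x) -> forall x, subalg_gen S x -> subalg_gen T x.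
Proof.
move=> ST x; elim=> [y /ST //||k y _|y z _ hy _|y z _ hy _].
- exact: sg_one.
- exact: sg_scale.
- exact: sg_add.
- exact: sg_mul.
Qed.

Lemma tflipM (K : fieldType) (A B : algType K) (x y : tens A B) :
  tflip (x * y) = tflip x * tflip y.
Proof.
have lf := @tflip_linear K A B.
elim/tens_ind_pure: x => [a b|x x' h h'|]; last 2 first.
- by rewrite mulrDl !(linD lf) h h' mulrDl.
- by rewrite mul0r (lin0 lf) mul0r.
elim/tens_ind_pure: y => [c d|y y' h h'|]; last 2 first.
- by rewrite mulrDr !(linD lf) h h' mulrDr.
- by rewrite mulr0 (lin0 lf) mulr0.
by rewrite tensM_pure !tflip_pure tensM_pure.
Qed.

Lemma tflipK (K : fieldType) (M N : lmodType K) : cancel (@tflip K M N) tflip.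
Proof.
move=> x; elim/tens_ind_pure: x => [m n|x y hx hy|].
- by rewrite !tflip_pure.
- by rewrite !(linD (@tflip_linear _ _ _)) hx hy.
- by rewrite !(lin0 (@tflip_linear _ _ _)).
Qed.

Section HopfPairing.
Variables (K : fieldType) (r s : K) (n : nat).
Hypotheses (r0 : r != 0) (s0 : s != 0).
Local Notation I := 'I_n.-1.
Local Notation U := (U r s n).
Local Notation Lambda := 'rV[int]_n.
Local Notation ue := (@ue K r s n).
Local Notation uf := (@uf K r s n).
Local Notation ua := (@ua K r s n).
Local Notation ub := (@ub K r s n).
Local Notation uaV := (@uaV K r s n).
Local Notation ubV := (@ubV K r s n).
Local Notation omega := (@omega K r s n).
Local Notation omega' := (@omega' K r s n).
Local Notation omega_pm := (@omega_pm K r s n).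
Local Notation omega'_pm := (@omega'_pm K r s n).
Local Notation counit := (@counit K r s n).
Local Notation tp := (@torus_pair K r s n).

Variable form : U -> U -> K.
Hypothesis hform : hopf_pairing form.

Lemma DeltaM (x y : U) : Delta (x * y) = Delta x * Delta y.
Proof. by have [_ h] := @Delta_monoid K r s n r0 s0; rewrite h. Qed.
Lemma Delta1 : Delta (1 : U) = 1.
Proof. by have [h _] := @Delta_monoid K r s n r0 s0. Qed.

Lemma counitM (x y : U) : counit (x * y) = counit x * counit y.
Proof. exact: rmorphM. Qed.
Lemma counit1 : counit 1 = 1.
Proof. exact: rmorph1. Qed.

Definition grouplike_in (B : set U) (x : U) : Prop :=
  [/\ B x, counit x = 1 & Delta x = x \ox x].

Section Grouplike.
Variable S : set U.
Local Notation B := (subalg_gen S).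

Lemma grouplike1 : grouplike_in B 1.
Proof. by split; [exact: sg_one|exact: counit1|exact: Delta1]. Qed.

Lemma grouplikeM x y : grouplike_in B x -> grouplike_in B y ->
  grouplike_in B (x * y).
Proof.
move=> [Bx cx Dx] [By cy Dy]; split; first exact: sg_mul.
  by rewrite counitM cx cy mulr1.
by rewrite DeltaM Dx Dy tensM_pure.
Qed.

Lemma grouplikeX x k : grouplike_in B x -> grouplike_in B (x ^+ k).
Proof.
move=> hx; elim: k => [|k IH]; first exact: grouplike1.
by rewrite exprS; exact: grouplikeM.
Qed.

Lemma grouplike_upow x xV z : grouplike_in B x -> grouplike_in B xV ->
  grouplike_in B (upow x xV z).
Proof. by move=> hx hxV; case: z => k; exact: grouplikeX. Qed.

Lemma grouplike_prod (T : Type) (t : seq T) (g : T -> U) :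
  (forall i, grouplike_in B (g i)) -> grouplike_in B (\prod_(i <- t) g i).
Proof.
move=> hg; elim/big_ind: _ => //; [exact: grouplike1|exact: grouplikeM].
Qed.

End Grouplike.

Lemma torus_grouplike g : torus_gen g ->
  counit (ugenU r s g) = 1 /\
  Delta (ugenU r s g) = ugenU r s g \ox ugenU r s g.
Proof.
move=> tg; split; last by rewrite (Delta_ugen r0 s0); case: g tg.
by rewrite /counit ulift_gen /counit_gen ?tg //; exact: counit_rel.
Qed.


Lemma omega_grouplike b (j : 'I_n) : grouplike_in (@UB K r s n) (omega_pm b j).
Proof.
have [tA tAV] := (@torus_grouplike (GA j) isT, @torus_grouplike (GAV j) isT).
split; first by apply: sg_gen; right; exists b, j.
  rewrite /omega_pm /omega /omegaV; case: b; rewrite counitM.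
    rewrite tA.1 mul1r; case: insubP => [k _ _|_]; last exact: counit1.
    exact: (@torus_grouplike (GB k) isT).1.
  rewrite tAV.1 mul1r; case: insubP => [k _ _|_]; last exact: counit1.
  exact: (@torus_grouplike (GBV k) isT).1.
rewrite /omega_pm /omega /omegaV; case: b; rewrite DeltaM.
  rewrite tA.2; case: insubP => [k _ _|_]; last by rewrite Delta1 !mulr1.
  by rewrite (@torus_grouplike (GB k) isT).2 tensM_pure.
rewrite tAV.2; case: insubP => [k _ _|_]; last by rewrite Delta1 !mulr1.
by rewrite (@torus_grouplike (GBV k) isT).2 tensM_pure.
Qed.

Lemma omega'_grouplike b (j : 'I_n) : grouplike_in (@UB' K r s n) (omega'_pm b j).
Proof.
have [tA tAV] := (@torus_grouplike (GB j) isT, @torus_grouplike (GBV j) isT).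
split; first by apply: sg_gen; right; exists b, j.
  rewrite /omega'_pm /omega' /omega'V; case: b; rewrite counitM.
    rewrite tA.1 mulr1; case: insubP => [k _ _|_]; last exact: counit1.
    exact: (@torus_grouplike (GA k) isT).1.
  rewrite tAV.1 mulr1; case: insubP => [k _ _|_]; last exact: counit1.
  exact: (@torus_grouplike (GAV k) isT).1.
rewrite /omega'_pm /omega' /omega'V; case: b; rewrite DeltaM.
  rewrite tA.2; case: insubP => [k _ _|_]; last by rewrite Delta1 !mul1r.
  by rewrite (@torus_grouplike (GA k) isT).2 tensM_pure.
rewrite tAV.2; case: insubP => [k _ _|_]; last by rewrite Delta1 !mul1r.
by rewrite (@torus_grouplike (GAV k) isT).2 tensM_pure.
Qed.

Lemma form_grouplike_mulr y x x' : grouplike_in (@UB' K r s n) y -> UB x -> UB x' ->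
  form y (x * x') = form y x * form y x'.
Proof.
move=> [By _ Dy] Bx Bx'; rewrite (hp_mulr hform (t := [:: (y, y)])) //.
- by rewrite big_seq1.
- by move=> p; rewrite inE => /eqP ->.
- by rewrite big_seq1.
Qed.
Lemma form_grouplike_mull y y' x : grouplike_in (@UB K r s n) x -> UB' y -> UB' y' ->
  form (y * y') x = form y x * form y' x.
Proof.
move=> [Bx _ Dx] By By'; rewrite (hp_mull hform (t := [:: (x, x)])) //.
- by rewrite big_seq1.
- by move=> p; rewrite inE => /eqP ->.
- by rewrite big_seq1.
Qed.

Section Characters.
Variables (B : set U) (chi : U -> K).
Hypotheses (chi1 : chi 1 = 1) (B1 : B 1).
Hypothesis BM : forall x y, B x -> B y -> B (x * y).
Hypothesis chiM : forall x y, B x -> B y -> chi (x * y) = chi x * chi y.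

Let BX x k : B x -> B (x ^+ k).
Proof. by move=> Bx; elim: k => [|k IH] //; rewrite exprS; exact: BM. Qed.
Let chiX x k : B x -> chi (x ^+ k) = chi x ^+ k.
Proof.
move=> Bx; elim: k => [|k IH]; first by rewrite !expr0.
by rewrite !exprS chiM ?IH //; exact: BX.
Qed.

(** [upow] builds negative powers from the separate element [xV]; only its value under the character
    has to be inverse. *)
Lemma char_upow x xV z : B x -> B xV -> chi xV = (chi x)^-1 ->
  B (upow x xV z) /\ chi (upow x xV z) = chi x ^ z.
Proof.
move=> Bx BxV cV; case: z => k /=; first by split; [exact: BX|exact: chiX].
by split; [exact: BX|rewrite chiX // cV exprVn].
Qed.

Lemma char_prod (T : Type) (t : seq T) (g : T -> U) :
  (forall i, B (g i)) ->
  B (\prod_(i <- t) g i) /\ chi (\prod_(i <- t) g i) = \prod_(i <- t) chi (g i).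
Proof.
move=> hg; elim: t => [|i t [IB IH]]; first by rewrite !big_nil.
by rewrite !big_cons chiM // IH; split=> //; exact: BM.
Qed.

End Characters.

Lemma form_omega_wt y l : grouplike_in (@UB' K r s n) y ->
  (forall j, form y (omegaV r s j) = (form y (omega j))^-1) ->
  form y (omega_wt r s l) = \prod_j form y (omega j) ^ acoord l j.
Proof.
move=> gy hV; have [By cy _] := gy.
have UBo b (j : 'I_n) : UB (omega_pm b j) by case: (omega_grouplike b j).
have chiM x x' : UB x -> UB x' -> form y (x * x') = form y x * form y x'.
  exact: form_grouplike_mulr.
have chi1 : form y 1 = 1 by rewrite (hp_1r hform).
have up (j : 'I_n) := @char_upow _ _ chi1 (sg_one _) (@sg_mul _ _ _) chiM
  _ _ (acoord l j) (UBo true j) (UBo false j) (hV j).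
rewrite /omega_wt (char_prod chi1 (sg_one _) (@sg_mul _ _ _) chiM _ _).2; last first.
  by move=> j; case: (up j).
by apply: eq_bigr => j _; case: (up j).
Qed.

Lemma form_omega'_wt x m : grouplike_in (@UB K r s n) x ->
  (forall i, form (omega'V r s i) x = (form (omega' i) x)^-1) ->
  form (omega'_wt r s m) x = \prod_i form (omega' i) x ^ acoord m i.
Proof.
move=> gx hV; have [Bx cx _] := gx.
have UBo b (j : 'I_n) : UB' (omega'_pm b j) by case: (omega'_grouplike b j).
have chiM y y' : UB' y -> UB' y' -> form (y * y') x = form y x * form y' x.
  exact: form_grouplike_mull.
have chi1 : form 1 x = 1 by rewrite (hp_1l hform).
have up (j : 'I_n) := @char_upow _ (form^~ x) chi1 (sg_one _) (@sg_mul _ _ _) chiM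
  _ _ (acoord m j) (UBo true j) (UBo false j) (hV j).
rewrite /omega'_wt
  (char_prod (chi := form^~ x) chi1 (sg_one _) (@sg_mul _ _ _) chiM _ _).2; last first.
  by move=> j; case: (up j).
by apply: eq_bigr => j _; case: (up j).
Qed.

(** A group-like element in one slot makes the pairing a character in the other. Using this once in
    each slot reduces f to the values on generators, and bimultiplicativity is then visible. *)
Lemma fwtE l m : fwt form l m =
  \prod_(j < n) \prod_(i < n) tp i j ^ (- (acoord m i * acoord l j)).
Proof.
have ho b c (i j : 'I_n) : form (omega'_pm b i) (omega_pm c j) =
    if b == c then tp i j else (tp i j)^-1 := hp_torus hform b c i j.
(* The inverse generators are included because the character in the second slot must be known to
   invert on [omegaV]. *)
have fo b (j : 'I_n) : form (omega'_wt r s m) (omega_pm b j) =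
    \prod_i (if b then tp i j else (tp i j)^-1) ^ acoord m i.
  rewrite form_omega'_wt; last first.
  - move=> i; rewrite (ho false b i j) (ho true b i j).
    by case: b; rewrite /= ?invrK.
  - exact: omega_grouplike.
  by apply: eq_bigr => i _; rewrite (ho true b i j); case: b.
rewrite /fwt form_omega_wt; last first.
- move=> j; rewrite (fo false j) (fo true j) -prodfV; apply: eq_bigr => i _.
  by rewrite exprz_inv invr_expz.
- apply: grouplike_prod => i; apply: grouplike_upow.
    exact: (omega'_grouplike true).
  exact: (omega'_grouplike false).
rewrite -prodfV; apply: eq_bigr => j _; rewrite (fo true j).
rewrite invr_expz -[LHS]/(_ ^ _).
elim/big_ind2: _ => [|x x' y y' <- <-|i _]; first exact: exp1rz.
  by rewrite expfzMl.
by rewrite exprz_exp mulrN.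
Qed.

Lemma torus_pair_neq0 (i j : 'I_n) : tp i j != 0.
Proof.
rewrite /torus_pair; case: ifP => _; case: ifP => _;
  by rewrite ?mulf_neq0 ?expfz_neq0 ?oner_eq0.
Qed.

Lemma fwtDl l l' m : fwt form (l + l') m = fwt form l m * fwt form l' m.
Proof.
rewrite !fwtE -big_split; apply: eq_bigr => j _ /=; rewrite -big_split.
apply: eq_bigr => i _ /=.
by rewrite acoordD mulrDr opprD expfzDr // torus_pair_neq0.
Qed.
Lemma fwtDr l m m' : fwt form l (m + m') = fwt form l m * fwt form l m'.
Proof.
rewrite !fwtE -big_split; apply: eq_bigr => j _ /=; rewrite -big_split.
apply: eq_bigr => i _ /=.
by rewrite acoordD mulrDl opprD expfzDr // torus_pair_neq0.
Qed.
Lemma fwt0l m : fwt form 0 m = 1.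
Proof.
rewrite fwtE big1 // => j _; rewrite big1 // => i _.
by rewrite acoord0 mulr0 oppr0 expr0z.
Qed.
Lemma fwt0r l : fwt form l 0 = 1.
Proof.
rewrite fwtE big1 // => j _; rewrite big1 // => i _.
by rewrite acoord0 mul0r oppr0 expr0z.
Qed.

Lemma expfz_sum (x : K) (T : Type) (t : seq T) (g : T -> int) : x != 0 ->
  x ^ (\sum_(i <- t) g i) = \prod_(i <- t) x ^ g i.
Proof.
move=> x0; elim: t => [|i t IH]; first by rewrite !big_nil expr0z.
by rewrite !big_cons expfzDr // IH.
Qed.

Lemma dot_acoord (k : nat) (l : Lambda) :
  dot (eps n k) l = \sum_(i < n) dot (eps n k) (alpha n i) * acoord l i.
Proof.
rewrite {1}[l]acoordE /dot; under [RHS]eq_bigr do rewrite mulr_suml.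
rewrite exchange_big /=; apply: eq_bigr => i _; rewrite summxE mulr_sumr.
by apply: eq_bigr => j _; rewrite -mulrA; congr (_ * _); rewrite mxE mulrC.
Qed.

Lemma expfz_dot (x : K) (k : nat) (l : Lambda) : x != 0 ->
  x ^ dot (eps n k) l = \prod_(i < n) (x ^ dot (eps n k) (alpha n i)) ^ acoord l i.
Proof.
move=> x0; rewrite dot_acoord expfz_sum //.
by apply: eq_bigr => i _; rewrite exprz_exp.
Qed.

Lemma dot_eps_alpha (i k : nat) : (i < n)%N ->
  dot (eps n i) (alpha n k) = (i == k)%N%:R - (i == k.+1)%N%:R.
Proof. by move=> hi; rewrite -(dotE (Ordinal hi)). Qed.

(** The separate value prescribed for b_n fits the general formula, because the last simple root is
    eps_n. Hence the scalar identity below holds for all weights in Lambda and not only for the span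
    of the alpha_i with i < n. *)
Lemma torus_pair_lo_r (i : 'I_n) (j : I) :
  tp i (lo j) = r ^ dot (eps n j) (alpha n i) * s ^ dot (eps n j.+1) (alpha n i).
Proof.
rewrite /torus_pair hi_subproof; case: ifP => // /negbT; rewrite -leqNgt => ni.
have hj := hi_subproof j.
rewrite !dot_eps_alpha ?(ltnW hj) //=.
have -> : (j == i :> nat) = false by apply/negbTE; lia.
have -> : (j == i.+1 :> nat) = false by apply/negbTE; lia.
have -> : (i == j :> nat) = false by apply/negbTE; lia.
have -> : (j.+1 == i.+1 :> nat) = false by apply/negbTE; lia.
by rewrite !subr0 sub0r opprK expr0z mul1r eq_sym.
Qed.

(** This rests on the antisymmetries <eps_k, alpha_j> = - <eps_(j+1), alpha_k> and <eps_(k+1),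
    alpha_j> = - <eps_j, alpha_k>; for the last k, the factor in s is trivial. *)
Lemma torus_pair_lo_l (j : I) (k : 'I_n) :
  (tp (lo j) k)^-1 =
  r ^ dot (eps n j.+1) (alpha n k) * s ^ dot (eps n j) (alpha n k).
Proof.
rewrite /torus_pair hi_subproof; have hj := hi_subproof j.
case: ifP => [nk|/negbT]; last rewrite -leqNgt => nk.
  rewrite invfM !invr_expz !dot_eps_alpha ?(ltnW hj) //= !eqSS !opprB.
  by rewrite ![(k == _ :> nat)]eq_sym ![(k.+1 == _ :> nat)]eq_sym.
rewrite invr_expz !dot_eps_alpha ?(ltnW hj) //= !eqSS !opprB.
have -> : (j == k :> nat) = false by apply/negbTE; lia.
have -> : (k == j :> nat) = false by apply/negbTE; lia.
have -> : (j == k.+1 :> nat) = false by apply/negbTE; lia.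
by rewrite subrr expr0z mulr1 eq_sym.
Qed.

(** The right-hand side is the scalar of a_j b_(j+1), that is of omega_j, on the weight space of
    [l]. *)
Lemma fwt_alpha_l (j : I) l : fwt form (- alpha n j) l =
  r ^ dot (eps n j) l * s ^ dot (eps n j.+1) l.
Proof.
rewrite fwtE (bigD1 (lo j)) //= [X in _ * X]big1 ?mulr1; last first.
  move=> k kj; rewrite big1 // => i _; rewrite acoordN acoord_alpha.
  by rewrite eq_sym -val_eqE /= in kj; rewrite (negPf kj) oppr0 mulr0 oppr0 expr0z.
rewrite !expfz_dot // -big_split; apply: eq_bigr => i _ /=.
by rewrite acoordN acoord_alpha eqxx mulrN1 opprK torus_pair_lo_r expfzMl.
Qed.

(** The right-hand side is the scalar of a_(j+1) b_j, that is of omega'_j, on the weight space of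
    [l]. *)
Lemma fwt_alpha_r (j : I) l : fwt form l (alpha n j) =
  r ^ dot (eps n j.+1) l * s ^ dot (eps n j) l.
Proof.
rewrite fwtE !expfz_dot // -big_split; apply: eq_bigr => k _ /=.
rewrite (bigD1 (lo j)) //= [X in _ * X]big1 ?mulr1; last first.
  move=> i kj; rewrite acoord_alpha.
  by rewrite eq_sym -val_eqE /= in kj; rewrite (negPf kj) mul0r oppr0 expr0z.
rewrite acoord_alpha eqxx mul1r -expfzMl -torus_pair_lo_l.
by rewrite exprz_inv.
Qed.

Section TorusAction.
Variable M : amod U.

Lemma act_word_omega b l (m : M) : wtspace l m ->
  act M (word (fun j : I => omega (lo j)) b) m = fwt form (- wordwt b) l *: m.
Proof.
move=> hm; elim: b => [|j b IH].
  by rewrite word_nil wordwt_nil oppr0 fwt0l act1 scale1r.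
rewrite word_cons wordwt_cons actM IH (linZ (act_linr _)) omega_lo actM.
rewrite (hm (hi j)).2 (linZ (act_linr _)) (hm (lo j)).1 !scalerA.
rewrite opprD fwtDl fwt_alpha_l -mulrA; congr (_ *: _); rewrite [LHS]mulrC; congr (_ * _).
by rewrite [s ^ _ * _]mulrC.
Qed.

Lemma act_word_omega' b l (m : M) : wtspace l m ->
  act M (word (fun j : I => omega' (lo j)) b) m = fwt form l (wordwt b) *: m.
Proof.
move=> hm; elim: b => [|j b IH].
  by rewrite word_nil wordwt_nil fwt0r act1 scale1r.
rewrite word_cons wordwt_cons actM IH (linZ (act_linr _)) omega'_lo actM.
rewrite (hm (lo j)).2 (linZ (act_linr _)) (hm (hi j)).1 !scalerA.
rewrite fwtDr fwt_alpha_r -mulrA; congr (_ *: _); rewrite [LHS]mulrC; congr (_ * _).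
by rewrite [s ^ _ * _]mulrC.
Qed.

End TorusAction.

(** * The two pairings on words obtained from the Hopf pairing *)

Lemma omega_ue_comm (i j : I) : exists c,
  omega (lo i) * ue j = c *: (ue j * omega (lo i)).
Proof.
exists (r ^ dot (eps n (lo i)) (alpha n j) * s ^ dot (eps n (hi i)) (alpha n j)).
rewrite omega_lo -mulrA ub_ue -scalerAr (mulrA (ua _)) ua_ue -scalerAl scalerA -!mulrA.
by rewrite [s ^ _ * _]mulrC.
Qed.
Lemma omega'_uf_comm (i j : I) : exists c,
  omega' (lo i) * uf j = c *: (uf j * omega' (lo i)).
Proof.
exists (r ^ (- dot (eps n (hi i)) (alpha n j)) * s ^ (- dot (eps n (lo i)) (alpha n j))).
rewrite omega'_lo -mulrA ub_uf -scalerAr (mulrA (ua _)) ua_uf -scalerAl scalerA -!mulrA.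
by rewrite mulrC.
Qed.

Let counit_e (j : I) : counit (ue j) = 0.
Proof. by rewrite /counit ulift_gen //; exact: counit_rel. Qed.
Let counit_f (j : I) : counit (uf j) = 0.
Proof. by rewrite /counit ulift_gen //; exact: counit_rel. Qed.

Lemma UB_words x : subalg_gen [set x | (exists j : I, x = ue j) \/
  (exists j : I, x = omega (lo j))] x -> UB x.
Proof.
apply: subalg_gen_sub => _ [[j ->]|[j ->]]; apply: sg_gen; first by left; exists j.
by right; exists true, (lo j).
Qed.
Lemma UB'_words x : subalg_gen [set x | (exists j : I, x = uf j) \/
  (exists j : I, x = omega' (lo j))] x -> UB' x.
Proof.
apply: subalg_gen_sub => _ [[j ->]|[j ->]]; apply: sg_gen; first by left; exists j.
by right; exists true, (lo j).
Qed.
Lemma UB_ewords x : subalg_gen [set x | exists j : I, x = ue j] x -> UB x.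
Proof. by apply: subalg_gen_sub => _ [j ->]; apply: sg_gen; left; exists j. Qed.
Lemma UB'_fwords x : subalg_gen [set x | exists j : I, x = uf j] x -> UB' x.
Proof. by apply: subalg_gen_sub => _ [j ->]; apply: sg_gen; left; exists j. Qed.

Lemma word_pairing_e : word_pairing ue (fun j => omega (lo j)) uf Delta form
  counit (fun j => form (omega' (lo j))).
Proof.
have Bf (j : I) : UB' (uf j) by apply: sg_gen; left; exists j.
have Be (j : I) : UB (ue j) by apply: sg_gen; left; exists j.
split.
- exact: Delta_linear.
- exact: Delta1.
- exact: DeltaM.
- by move=> j; rewrite (Delta_ugen r0 s0).
- by move=> j; case: (omega_grouplike true (lo j)).
- exact: omega_ue_comm.
- exact: counit1.
- exact: counitM.
- exact: counit_e.
- by move=> j; case: (omega_grouplike true (lo j)).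
- by move=> y x x' k /UB'_fwords hy /UB_words hx /UB_words hx'; exact: (hp_linr hform).
- by move=> y y' x k /UB'_fwords hy /UB'_fwords hy' /UB_words hx; exact: (hp_linl hform).
- by move=> x /UB_words hx; exact: (hp_1l hform).
- move=> y y' x t /UB'_fwords hy /UB'_fwords hy' /UB_words hx ht.
  by apply: (hp_mull hform) => // p /ht[/UB_words ? /UB_words].
- by move=> j; rewrite (hp_1r hform) // counit_f.
- by move=> i j /negPf ij; rewrite (hp_fe hform) ij mul0r.
- by move=> i j; exact: (hp_f_torus hform i true (lo j)).
- move=> j x x' /UB_words hx /UB_words hx'.
  (* The two terms of Delta(f_j), read in opposite order by [hp_mulr], give the twisted derivation
     rule with character (omega'_j, -). *)
  rewrite (hp_mulr hform (t := [:: (1, uf j); (uf j, omega' (lo j))])) //.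
  + by rewrite big_cons big_seq1 /= (hp_1l hform).
  + move=> p; rewrite !inE => /orP[] /eqP -> /=; split=> //; first exact: sg_one.
    by case: (omega'_grouplike true (lo j)).
  + by rewrite big_cons big_seq1 (Delta_ugen r0 s0).
- by move=> i j; exact: (hp_torus_e hform true (lo i) j).
Qed.

(* The coproduct of [UB'] is the opposite of [Delta]. *)
Lemma word_pairing_f : word_pairing uf (fun j => omega' (lo j)) ue
  (fun x => tflip (Delta x)) (fun y x => form x y)
  counit (fun j x => form x (omega (lo j))).
Proof.
have Bf (j : I) : UB' (uf j) by apply: sg_gen; left; exists j.
have Be (j : I) : UB (ue j) by apply: sg_gen; left; exists j.
have lf := @tflip_linear K U U.
split.
- by move=> k x y; rewrite (Delta_linear r0 s0) lf.
- by rewrite Delta1 tflip_pure.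
- by move=> x y; rewrite DeltaM tflipM.
- by move=> j; rewrite (Delta_ugen r0 s0) /= (linD lf) !tflip_pure addrC.
- move=> j; have [_ _] := omega'_grouplike true (lo j).
  by rewrite /= => ->; rewrite tflip_pure.
- exact: omega'_uf_comm.
- exact: counit1.
- exact: counitM.
- exact: counit_f.
- by move=> j; case: (omega'_grouplike true (lo j)).
- by move=> y x x' k /UB_ewords hy /UB'_words hx /UB'_words hx'; exact: (hp_linl hform).
- by move=> y y' x k /UB_ewords hy /UB_ewords hy' /UB'_words hx; exact: (hp_linr hform).
- by move=> x /UB'_words hx; exact: (hp_1r hform).
- move=> y y' x t /UB_ewords hy /UB_ewords hy' /UB'_words hx ht hD.
  (* The list decomposes the flipped coproduct; swapping its pairs decomposes Delta itself, and the
     exchange built into [hp_mulr] restores the order. *)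
  rewrite (hp_mulr hform (t := [seq (p.2, p.1) | p <- t])) //.
  + by rewrite big_map.
  + by move=> _ /mapP[p /ht[/UB'_words h1 /UB'_words h2] ->].
  + rewrite -[LHS]tflipK hD (lin_sum lf) big_map.
    by apply: eq_bigr => p _; rewrite tflip_pure.
- by move=> j; rewrite (hp_1l hform) // counit_e.
- by move=> i j; rewrite eq_sym => /negPf ij; rewrite (hp_fe hform) ij mul0r.
- by move=> i j; exact: (hp_torus_e hform true (lo j) i).
- move=> j x x' /UB'_words hx /UB'_words hx'.
  rewrite (hp_mull hform (t := [:: (ue j, 1); (omega (lo j), ue j)])) //.
  + by rewrite big_cons big_seq1 /= (hp_1r hform).
  + move=> p; rewrite !inE => /orP[] /eqP -> /=; split=> //; first exact: sg_one.
    by case: (omega_grouplike true (lo j)).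
  + by rewrite big_cons big_seq1 (Delta_ugen r0 s0).
- by move=> i j; exact: (hp_f_torus hform j true (lo i)).
Qed.

End HopfPairing.

(** * Both hexagons on weight vectors *)

Lemma exchange_big_dsum (V : nmodType) (Z T : Type) (d : Z -> nat) (S : seq Z)
    (t : seq T) (G : forall z, 'I_(d z) -> T -> V) :
  \sum_(z <- S) \sum_(i < d z) \sum_(p <- t) G z i p =
  \sum_(p <- t) \sum_(z <- S) \sum_(i < d z) G z i p.
Proof. by rewrite [RHS]exchange_big; apply: eq_bigr => z _; exact: exchange_big. Qed.

Section Hexagon.
Variables (K : fieldType) (r s : K) (n : nat).
Hypotheses (r0 : r != 0) (s0 : s != 0).
Local Notation I := 'I_n.-1.
Local Notation U := (U r s n).
Local Notation Lambda := 'rV[int]_n.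

Variable form : U -> U -> K.
Hypothesis hform : hopf_pairing form.
Variables (d : Lambda -> nat) (v u : forall z, 'I_(d z) -> U).
Hypothesis hvu : dual_bases form v u.

Let wpe := word_pairing_e r0 s0 hform.
Let wpf := word_pairing_f r0 s0 hform.

Lemma dual_bases_sym z : Qplus z ->
  [/\ is_basis (Uminus z) (@v z), is_basis (Uplus z) (@u z) &
      forall k l, form (@v z l) (@u z k) = (k == l)%:R].
Proof.
by move=> /hvu[h1 h2 h3]; split=> // k l; rewrite h3 eq_sym.
Qed.

Lemma dual_Uplus z k : Qplus z -> Uplus z (@u z k).
Proof. by move=> /hvu[[hu _] _ _]. Qed.
Lemma dual_Uminus z k : Qplus z -> Uminus z (@v z k).
Proof. by move=> /hvu[_ [hv _] _]. Qed.

Section TwoModules.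
Variables N' N : amod U.

Lemma act_Theta z (m' : N') (m : N) :
  act (tmod N' N) (Theta_ v u z) (m' \ox m) =
  \sum_k act N' (@v z k) m' \ox act N (@u z k) m.
Proof.
rewrite /Theta_ (lin_sum (act_linl _)); apply: eq_bigr => k _.
exact: tact_pure.
Qed.

Lemma Theta_vanishes_off B (m' : N') (m : N) : killed_off B m ->
  vanishes_off (X := tmod N' N) (Theta_ v u) B (m' \ox m).
Proof.
move=> h z zQ zB; rewrite act_Theta big1 // => k _.
by rewrite (h z) ?pure0r //; exact: dual_Uplus.
Qed.

Hypotheses (hN' : catO N') (hN : catO N).

Lemma Theta_vanishes (x : tens N' N) :
  exists B, vanishes_off (X := tmod N' N) (Theta_ v u) B x.
Proof.
elim/tens_ind_pure: x => [m' m|x y hx hy|].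
- have [B hB] := exists_killed_off r0 s0 hN m.
  by exists B; exact: Theta_vanishes_off.
- exact: (vanishes_off_sum (X := tmod N' N)).
- by exists 0%N => z _ _; exact: lin0 (act_linr _).
Qed.

Lemma Rmx_linear : linear (Rmx form v u N N').
Proof.
move=> k x y; rewrite /Rmx (tflip_linear _ _ _) ((ftildeP form hN' hN).1 _ _ _).
exact: (sum_act_linear (X := tmod N' N) Theta_vanishes).
Qed.

Lemma Rmx_pure B l l' (m : N) (m' : N') :
  wtspace l m -> wtspace l' m' -> killed_off B m ->
  Rmx form v u N N' (m \ox m') = fwt form l' l *:
    \sum_(z <- box n B) \sum_k act N' (@v z k) m' \ox act N (@u z k) m.
Proof.
move=> hm hm' hB; rewrite /Rmx tflip_pure ((ftildeP form hN' hN).2 _ _ _ _ hm' hm).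
rewrite (linZ (sum_act_linear (X := tmod N' N) Theta_vanishes)).
rewrite (sum_act_box (X := tmod N' N) (Theta_vanishes_off m' hB)); congr (_ *: _).
by apply: eq_bigr => z _; exact: act_Theta.
Qed.

End TwoModules.

Variables M M' M'' : amod U.

Lemma act_tassoc (y : tens U U) a (m : M) (m' : M') (m'' : M'') :
  act (tmod (tmod M'' M) M') (tassoc (a \ox y)) ((m'' \ox m) \ox m') =
  tlift (fun b c => (act M'' a m'' \ox act M b m) \ox act M' c m') y.
Proof.
pose phi b c := (act M'' a m'' \ox act M b m) \ox act M' c m'.
have bphi : bilin phi.
  split=> [b k c c'|c k b b']; rewrite /phi /= (act_linl _) pureDr pureZr //.
  by rewrite pureDl pureZl.
have la : linear (fun y : tens U U => tassoc (a \ox y)).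
  by move=> k x z; rewrite ((pure_bilin _ _).1 _ _ _ _) (tassoc_linear _ _ _).
elim/tens_ind_pure: y => [b c|x y hx hy|].
- rewrite tassoc_pure (tlift_pure bphi).
  by rewrite [LHS]tact_pure; congr (_ \ox _); exact: tact_pure.
- by rewrite (linD la) (linD (act_linl _)) hx hy (linD (tlift_linear bphi)).
- by rewrite (lin0 la) (lin0 (act_linl _)) (lin0 (tlift_linear bphi)).
Qed.

(** The coproduct is read flipped, with [b] on M'' and [c] on M', so as to match the opposite
    coproduct of the second pairing on words. The group-likes omega' then land on M''. *)
Lemma act_tassocV (y : tens U U) a (m : M) (m' : M') (m'' : M'') :
  act (tmod M' (tmod M'' M)) (tassocV (y \ox a)) (m' \ox (m'' \ox m)) =
  tlift (fun b c => act M' c m' \ox (act M'' b m'' \ox act M a m)) (tflip y).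
Proof.
pose phi b c := act M' c m' \ox (act M'' b m'' \ox act M a m).
have bphi : bilin phi.
  split=> [b k c c'|c k b b']; rewrite /phi /= (act_linl _) pureDl pureZl //.
  by rewrite pureDr pureZr.
have la : linear (fun y : tens U U => tassocV (y \ox a)).
  by move=> k x z; rewrite ((pure_bilin _ _).2 _ _ _ _) (tassocV_linear _ _ _).
have lf := @tflip_linear K U U.
elim/tens_ind_pure: y => [b c|x y hx hy|].
- rewrite tassocV_pure tflip_pure (tlift_pure bphi).
  by rewrite [LHS]tact_pure; congr (_ \ox _); exact: tact_pure.
- by rewrite (linD la) (linD (act_linl _)) hx hy (linD lf) (linD (tlift_linear bphi)).
- by rewrite (lin0 la) (lin0 (act_linl _)) (lin0 lf) (lin0 (tlift_linear bphi)).
Qed.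

Let Delta_lin : linear (@Delta K r s n) := @Delta_linear K r s n r0 s0.

Lemma act_idDelta z (m : M) (m' : M') (m'' : M'') :
  act (tmod (tmod M'' M) M') (idDelta_Theta_ v u z) ((m'' \ox m) \ox m') =
  \sum_k tlift (fun b c => (act M'' (@v z k) m'' \ox act M b m) \ox act M' c m')
    (Delta (@u z k)).
Proof.
rewrite /idDelta_Theta_ /Theta_ (lin_sum (tmap_linear (@id_linear _ U) Delta_lin)).
rewrite (lin_sum (@tassoc_linear _ U U U)) (lin_sum (act_linl _)).
by apply: eq_bigr => k _; rewrite tmap_pure ?act_tassoc //; exact: Delta_lin.
Qed.

Lemma act_Deltaid z (m : M) (m' : M') (m'' : M'') :
  act (tmod M' (tmod M'' M)) (Deltaid_Theta_ v u z) (m' \ox (m'' \ox m)) =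
  \sum_k tlift (fun b c => act M' c m' \ox (act M'' b m'' \ox act M (@u z k) m))
    (tflip (Delta (@v z k))).
Proof.
rewrite /Deltaid_Theta_ /Theta_ (lin_sum (tmap_linear Delta_lin (@id_linear _ U))).
rewrite (lin_sum (@tassocV_linear _ U U U)) (lin_sum (act_linl _)).
by apply: eq_bigr => k _; rewrite tmap_pure ?act_tassocV //; exact: Delta_lin.
Qed.

Lemma idDelta_expand B z x a l (m : M) (m' : M') (m'' : M'') :
  wtspace l m -> z \in box n B -> Uplus z x ->
  tlift (fun b c => (act M'' a m'' \ox act M b m) \ox act M' c m') (Delta x) =
  \sum_(p <- box n B) \sum_(q <- box n B) \sum_i \sum_j
    (fwt form (- q) l * form (@v p i * @v q j) x) *:
      ((act M'' a m'' \ox act M (@u p i) m) \ox act M' (@u q j) m').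
Proof.
move=> hm zB hx.
apply: (Delta_dual_expand wpe hvu (kappa := fun q => fwt form (- q) l)
  (phi := fun b c => (act M'' a m'' \ox act M b m) \ox act M' c m')
  _ _ (box_uniq _ _) (@box_Qplus _ _) _ hx).
- split=> [b k c c'|c k b b'] /=; rewrite (act_linl _) pureDr pureZr //.
  by rewrite pureDl pureZl.
- move=> b c g; rewrite actM (act_word_omega r0 s0 hform _ hm) (linZ (act_linr _)).
  by rewrite pureZr pureZl.
- by move=> b c hz; apply: box_split; rewrite ?hz //; exact: wordwt_Qplus.
Qed.

Lemma Deltaid_expand B z x a l (m : M) (m' : M') (m'' : M'') :
  wtspace l m'' -> z \in box n B -> Uminus z x ->
  tlift (fun b c => act M' c m' \ox (act M'' b m'' \ox act M a m))
    (tflip (Delta x)) =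
  \sum_(p <- box n B) \sum_(q <- box n B) \sum_i \sum_j
    (fwt form l q * form x (@u p i * @u q j)) *:
      (act M' (@v q j) m' \ox (act M'' (@v p i) m'' \ox act M a m)).
Proof.
move=> hm zB hx.
apply: (Delta_dual_expand wpf dual_bases_sym (kappa := fun q => fwt form l q)
  (phi := fun b c => act M' c m' \ox (act M'' b m'' \ox act M a m))
  _ _ (box_uniq _ _) (@box_Qplus _ _) _ hx).
- split=> [b k c c'|c k b b'] /=; rewrite (act_linl _) pureDl pureZl //.
  by rewrite pureDr pureZr.
- move=> b c g; rewrite actM (act_word_omega' r0 s0 hform _ hm) (linZ (act_linr _)).
  by rewrite pureZl pureZr.
- by move=> b c hz; apply: box_split; rewrite ?hz //; exact: wordwt_Qplus.
Qed.

(** Boxes add: if p + q leaves the sum of the boxes, then p or q leaves its own. *)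
Lemma killed_off_split B B' p q i j (m : M) (m' : M') : killed_off B m ->
  killed_off B' m' -> Qplus p -> Qplus q -> p + q \notin box n (B + B') ->
  act M (@u p i) m = 0 \/ act M' (@u q j) m' = 0.
Proof.
move=> hm hm' pQ qQ; have [pB|/negP pB _] := boolP (p \in box n B); last first.
  by left; apply: (hm p) => //; [exact/negP|exact: dual_Uplus].
have [qB|/negP qB _] := boolP (q \in box n B'); first by rewrite box_add.
by right; apply: (hm' q) => //; [exact/negP|exact: dual_Uplus].
Qed.

Lemma idDelta_vanishes_off B B' l (m : M) (m' : M') (m'' : M'') :
  wtspace l m -> killed_off B m -> killed_off B' m' ->
  vanishes_off (X := tmod (tmod M'' M) M') (idDelta_Theta_ v u) (B + B')
    ((m'' \ox m) \ox m').
Proof.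
move=> hm hB hB' z zQ zB; rewrite act_idDelta big1 // => k _.
(* The expansion is made in an auxiliary box around [z], since [z] is outside the box of the
   statement. *)
have [C zC] := Qplus_box zQ.
rewrite (idDelta_expand _ _ _ hm zC (dual_Uplus _ zQ)).
rewrite big1_seq // => p /andP[_ /box_Qplus pQ].
rewrite big1_seq // => q /andP[_ /box_Qplus qQ].
rewrite big1 // => i _; rewrite big1 // => j _.
have [pqz|pqz] := eqVneq (p + q) z; last first.
  rewrite (pairing_orth wpe (z := p + q) (z' := z)) ?mulr0 ?scale0r //.
    by apply: word_span_mul; exact: dual_Uminus.
  exact: dual_Uplus.
have [|->|->] := killed_off_split i j hB hB' pQ qQ; first by rewrite pqz.
  by rewrite pure0r pure0l scaler0.
by rewrite pure0r scaler0.
Qed.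

(** Here Delta falls on the v_z, while u_z acts on [m] undivided, so no expansion and no weight
    assumption is needed. *)
Lemma Deltaid_vanishes_off B (m : M) (m' : M') (m'' : M'') : killed_off B m ->
  vanishes_off (X := tmod M' (tmod M'' M)) (Deltaid_Theta_ v u) B
    (m' \ox (m'' \ox m)).
Proof.
move=> hB z zQ zB; rewrite act_Deltaid big1 // => k _.
rewrite /tlift big1 // => p _; rewrite (hB z) ?pure0r //; exact: dual_Uplus.
Qed.

Hypotheses (hM : catO M) (hM' : catO M') (hM'' : catO M'').

Lemma idDelta_vanishes x : exists B,
  vanishes_off (X := tmod (tmod M'' M) M') (idDelta_Theta_ v u) B x.
Proof.
have z0 : exists B,
    vanishes_off (X := tmod (tmod M'' M) M') (idDelta_Theta_ v u) B 0.
  by exists 0%N => z _ _; exact: lin0 (act_linr _).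
elim/tens_ind_pure: x => [y m'|x y hx hy|//]; last first.
  exact: (vanishes_off_sum (X := tmod (tmod M'' M) M')).
elim/tens_ind_pure: y => [m'' m|x y hx hy|]; last by rewrite pure0l.
  have [B' hB'] := exists_killed_off r0 s0 hM' m'.
  have [t [ht ->]] := wtseq_exists hM m.
  elim: t ht => [|p t IH] ht; first by rewrite big_nil pure0r pure0l.
  rewrite big_cons pureDr pureDl.
  apply: (vanishes_off_sum (X := tmod (tmod M'' M) M')); last first.
    by apply: IH => q qt; apply: ht; rewrite inE qt orbT.
  have hp := ht p (mem_head _ _); have [B hB] := exists_killed_off r0 s0 hM p.2.
  by exists (B + B')%N; exact: idDelta_vanishes_off hp hB hB'.
by rewrite pureDl; exact: (vanishes_off_sum (X := tmod (tmod M'' M) M')).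
Qed.

Lemma Deltaid_vanishes x : exists B,
  vanishes_off (X := tmod M' (tmod M'' M)) (Deltaid_Theta_ v u) B x.
Proof.
have z0 : exists B,
    vanishes_off (X := tmod M' (tmod M'' M)) (Deltaid_Theta_ v u) B 0.
  by exists 0%N => z _ _; exact: lin0 (act_linr _).
elim/tens_ind_pure: x => [m' y|x y hx hy|//]; last first.
  exact: (vanishes_off_sum (X := tmod M' (tmod M'' M))).
elim/tens_ind_pure: y => [m'' m|x y hx hy|]; last by rewrite pure0r.
  have [B hB] := exists_killed_off r0 s0 hM m.
  by exists B; exact: Deltaid_vanishes_off.
by rewrite pureDr; exact: (vanishes_off_sum (X := tmod M' (tmod M'' M))).
Qed.

Lemma hexagon_idDelta_wt lam mu nu (m : M) (m' : M') (m'' : M'') :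
  wtspace lam m -> wtspace mu m' -> wtspace nu m'' ->
  tmap (Rmx form v u M M'') id
    (tassoc (tmap id (Rmx form v u M' M'') (m \ox (m' \ox m'')))) =
  sum_act (X := tmod (tmod M'' M) M') (idDelta_Theta_ v u)
    (fwt form nu (lam + mu) *: ((m'' \ox m) \ox m')).
Proof.
move=> hm hm' hm''.
have [B1 h1] := exists_killed_off r0 s0 hM m.
have [B2 h2] := exists_killed_off r0 s0 hM' m'.
pose S := box n (B1 + B2).
have SQ z : z \in S -> Qplus z by exact: box_Qplus.
have lR := Rmx_linear hM'' hM.
have lR' := Rmx_linear hM'' hM'.
pose T p q (i : 'I_(d p)) (j : 'I_(d q)) :=
  (act M'' (@v p i * @v q j) m'' \ox act M (@u p i) m) \ox act M' (@u q j) m'.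
(* The inner R gives f(nu, mu) and lowers m'' by q, so the outer R sees the weight nu - q. On the
   other side f(nu, lam + mu) meets the scalar f(- q, lam) of omega_q on m; bimultiplicativity
   identifies the two. *)
transitivity (\sum_(p <- S) \sum_(q <- S) \sum_i \sum_j
    (fwt form nu mu * fwt form (nu - q) lam) *: T p q i j).
  pose g y := tmap (Rmx form v u M M'') id (tassoc (m \ox (y : tens M'' M'))).
  have lg : linear g.
    move=> k x y; rewrite /g ((pure_bilin _ _).1 _ _ _ _) (tassoc_linear _ _ _).
    by rewrite (tmap_linear lR (@id_linear _ _)).
  rewrite (tmap_pure _ _ (@id_linear _ _) lR') -[LHS]/(g _).
  rewrite (Rmx_pure hM'' hM' hm' hm'' (killed_off_mono (leq_addl B1 B2) h2)).
  rewrite (linZ lg) (lin_sum lg) [RHS]exchange_big scaler_sumr -/S.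
  rewrite big_seq [RHS]big_seq; apply: eq_bigr => q /SQ qQ /=.
  rewrite (lin_sum lg) [in RHS](eq_bigr _ (fun p _ => exchange_big _ _ _ _ _ _)) /=.
  rewrite [RHS]exchange_big scaler_sumr; apply: eq_bigr => j _ /=.
  rewrite /g tassoc_pure (tmap_pure _ _ lR (@id_linear _ _)).
  have hv := act_Uminus_wt r0 s0 (dual_Uminus j qQ) hm''.
  rewrite (Rmx_pure hM'' hM hm hv (killed_off_mono (leq_addr B2 B1) h1)) pureZl scalerA.
  rewrite (lin_sum ((pure_bilin _ _).2 _)) scaler_sumr; apply: eq_bigr => p _ /=.
  rewrite (lin_sum ((pure_bilin _ _).2 _)) scaler_sumr; apply: eq_bigr => i _ /=.
  by rewrite /T actM.
rewrite (linZ (sum_act_linear (X := tmod (tmod M'' M) M') idDelta_vanishes)).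
rewrite (sum_act_box (X := tmod (tmod M'' M) M')
  (idDelta_vanishes_off _ hm h1 h2)) -/S.
transitivity (fwt form nu (lam + mu) *: \sum_(z <- S) \sum_k
    \sum_(p <- S) \sum_(q <- S) \sum_i \sum_j
    (fwt form (- q) lam * form (@v p i * @v q j) (@u z k)) *:
      ((act M'' (@v z k) m'' \ox act M (@u p i) m) \ox act M' (@u q j) m')).
  rewrite exchange_big_dsum scaler_sumr big_seq [RHS]big_seq; apply: eq_bigr => p pS.
  rewrite exchange_big_dsum scaler_sumr big_seq [RHS]big_seq; apply: eq_bigr => q qS.
  rewrite exchange_big_dsum scaler_sumr; apply: eq_bigr => i _.
  rewrite exchange_big_dsum scaler_sumr; apply: eq_bigr => j _.
  pose g x := (act M'' x m'' \ox act M (@u p i) m) \ox act M' (@u q j) m'.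
  have lg : linear g by move=> k x y; rewrite /g (act_linl _) !(pureDl, pureZl).
  have pqf : Uminus (p + q) (@v p i * @v q j).
    by apply: word_span_mul; apply: dual_Uminus; exact: SQ.
  (* Duality recombines the v_z into v_p v_q. If p + q is outside [S], then u_p or u_q already kills
     its vector and both sides vanish. *)
  have <- : \sum_(z <- S) \sum_k form (@v p i * @v q j) (@u z k) *: g (@v z k) =
      T p q i j.
    have [pqS|pqS] := boolP (p + q \in S).
      exact: (dual_collapse_f wpe hvu lg (box_uniq _ _) SQ pqS pqf).
    have g0 x : g x = 0.
      rewrite /g; have [->|->] := killed_off_split i j h1 h2 (SQ _ pS) (SQ _ qS) pqS.
        by rewrite pure0r pure0l.
      by rewrite pure0r.
    rewrite -[RHS]/(g _) g0 big1 // => z _; rewrite big1 // => k _.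
    by rewrite g0 scaler0.
  rewrite !scaler_sumr; apply: eq_bigr => z _; rewrite !scaler_sumr.
  apply: eq_bigr => k _; rewrite !scalerA !mulrA; congr (_ * _ *: _).
  by rewrite fwtDl // fwtDr // mulrA [X in X * _ = _]mulrC.
congr (_ *: _); rewrite big_seq [RHS]big_seq; apply: eq_bigr => z zS.
rewrite act_idDelta; apply: eq_bigr => k _.
by rewrite (idDelta_expand _ _ _ hm zS (dual_Uplus _ (SQ _ zS))).
Qed.

(** Raising by q cannot enlarge the box: if p is outside it, so is p + q. *)
Lemma killed_off_act B q j (m : M) : Qplus q -> killed_off B m ->
  killed_off B (act M (@u q j) m).
Proof.
move=> qQ hB p x pQ pB hx; rewrite -actM; apply: (hB (p + q)).
- exact: QplusD.
- by apply: contra pB => /(box_split pQ qQ)[].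
- exact: word_span_mul hx (dual_Uplus _ qQ).
Qed.

Lemma hexagon_Deltaid_wt lam mu nu (m : M) (m' : M') (m'' : M'') :
  wtspace lam m -> wtspace mu m' -> wtspace nu m'' ->
  tmap id (Rmx form v u M M'')
    (tassocV (tmap (Rmx form v u M M') id ((m \ox m') \ox m''))) =
  sum_act (X := tmod M' (tmod M'' M)) (Deltaid_Theta_ v u)
    (fwt form (mu + nu) lam *: (m' \ox (m'' \ox m))).
Proof.
move=> hm hm' hm''.
have [B hB] := exists_killed_off r0 s0 hM m.
pose S := box n B.
have SQ z : z \in S -> Qplus z by exact: box_Qplus.
have lR := Rmx_linear hM'' hM.
have lR' := Rmx_linear hM' hM.
pose T p q (i : 'I_(d p)) (j : 'I_(d q)) :=
  act M' (@v q j) m' \ox (act M'' (@v p i) m'' \ox act M (@u p i * @u q j) m).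
(* Now u_q raises [m] to the weight lam + q before the second R acts, whence f(nu, lam + q). Its
   factor f(nu, q) is the scalar of omega'_q on m''. Both raising operators act on [m], so a single
   box suffices. *)
transitivity (\sum_(p <- S) \sum_(q <- S) \sum_i \sum_j
    (fwt form mu lam * fwt form nu (lam + q)) *: T p q i j).
  pose g y := tmap id (Rmx form v u M M'') (tassocV ((y : tens M' M) \ox m'')).
  have lg : linear g.
    move=> k x y; rewrite /g ((pure_bilin _ _).2 _ _ _ _) (tassocV_linear _ _ _).
    by rewrite (tmap_linear (@id_linear _ _) lR).
  rewrite (tmap_pure _ _ lR' (@id_linear _ _)) -[LHS]/(g _).
  rewrite (Rmx_pure hM' hM hm hm' hB).
  rewrite (linZ lg) (lin_sum lg) [RHS]exchange_big scaler_sumr -/S.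
  rewrite big_seq [RHS]big_seq; apply: eq_bigr => q /SQ qQ /=.
  rewrite (lin_sum lg) [in RHS](eq_bigr _ (fun p _ => exchange_big _ _ _ _ _ _)) /=.
  rewrite [RHS]exchange_big scaler_sumr; apply: eq_bigr => j _ /=.
  rewrite /g tassocV_pure (tmap_pure _ _ (@id_linear _ _) lR).
  have hu := act_Uplus_wt r0 s0 (dual_Uplus j qQ) hm.
  rewrite (Rmx_pure hM'' hM hu hm'' (killed_off_act j qQ hB)) pureZr scalerA.
  rewrite (lin_sum ((pure_bilin _ _).1 _)) scaler_sumr; apply: eq_bigr => p _ /=.
  rewrite (lin_sum ((pure_bilin _ _).1 _)) scaler_sumr; apply: eq_bigr => i _ /=.
  by rewrite /T actM.
rewrite (linZ (sum_act_linear (X := tmod M' (tmod M'' M)) Deltaid_vanishes)).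
rewrite (sum_act_box (X := tmod M' (tmod M'' M))
  (Deltaid_vanishes_off m' m'' hB)) -/S.
transitivity (fwt form (mu + nu) lam *: \sum_(z <- S) \sum_k
    \sum_(p <- S) \sum_(q <- S) \sum_i \sum_j
    (fwt form nu q * form (@v z k) (@u p i * @u q j)) *:
      (act M' (@v q j) m' \ox (act M'' (@v p i) m'' \ox act M (@u z k) m))).
  rewrite exchange_big_dsum scaler_sumr big_seq [RHS]big_seq; apply: eq_bigr => p pS.
  rewrite exchange_big_dsum scaler_sumr big_seq [RHS]big_seq; apply: eq_bigr => q qS.
  rewrite exchange_big_dsum scaler_sumr; apply: eq_bigr => i _.
  rewrite exchange_big_dsum scaler_sumr; apply: eq_bigr => j _.
  pose g x := act M' (@v q j) m' \ox (act M'' (@v p i) m'' \ox act M x m).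
  have lg : linear g by move=> k x y; rewrite /g (act_linl _) !(pureDr, pureZr).
  have pqf : Uplus (p + q) (@u p i * @u q j).
    by apply: word_span_mul; apply: dual_Uplus; exact: SQ.
  have <- : \sum_(z <- S) \sum_k form (@v z k) (@u p i * @u q j) *: g (@u z k) =
      T p q i j.
    have [pqS|pqS] := boolP (p + q \in S).
      exact: (dual_collapse_f wpf dual_bases_sym lg (box_uniq _ _) SQ pqS pqf).
    (* Outside the box u_p u_q kills [m], while each pairing in the sum vanishes by orthogonality,
       since no z in [S] equals p + q. *)
    have -> : T p q i j = 0.
      by rewrite /T (hB (p + q)) ?pure0r //; apply: QplusD; exact: SQ.
    rewrite big1_seq // => z /andP[_ zS]; rewrite big1 // => k _.
    rewrite (pairing_orth wpf (z := p + q) (z' := z)) ?scale0r //.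
      exact: dual_Uminus (SQ _ zS).
    by apply: contraNneq pqS => ->.
  rewrite !scaler_sumr; apply: eq_bigr => z _; rewrite !scaler_sumr.
  apply: eq_bigr => k _; rewrite !scalerA !mulrA; congr (_ * _ *: _).
  by rewrite fwtDl // fwtDr // mulrA.
congr (_ *: _); rewrite big_seq [RHS]big_seq; apply: eq_bigr => z zS.
rewrite act_Deltaid; apply: eq_bigr => k _.
by rewrite (Deltaid_expand _ _ _ hm'' zS (dual_Uminus _ (SQ _ zS))).
Qed.

End Hexagon.

(** * Reduction of the hexagon identities to weight vectors *)

Theorem theorem5p7 (K : closedFieldType) (n : nat) (r s : K)
  (hn : (2 <= n)%N) (hr : r != 0) (hs : s != 0) (hrs : r != s)
  (form : U r s n -> U r s n -> K) (hform : hopf_pairing form)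
  (d : 'rV[int]_n -> nat) (v u : forall z : 'rV[int]_n, 'I_(d z) -> U r s n)
  (hvu : dual_bases form v u)
  (M M' M'' : amod (U r s n)) (hM : catO M) (hM' : catO M') (hM'' : catO M'')
  (ft' : {linear tens (tens M'' M) M' -> tens (tens M'' M) M'})
  (hft' : forall lam mu nu (m : M) (m' : M') (m'' : M''),
     wtspace lam m -> wtspace mu m' -> wtspace nu m'' ->
     ft' ((m'' \ox m) \ox m')
       = fwt form nu (lam + mu) *: ((m'' \ox m) \ox m'))
  (ft'' : {linear tens M' (tens M'' M) -> tens M' (tens M'' M)})
  (hft'' : forall lam mu nu (m : M) (m' : M') (m'' : M''),
     wtspace lam m -> wtspace mu m' -> wtspace nu m'' ->
     ft'' (m' \ox (m'' \ox m))
       = fwt form (mu + nu) lam *: (m' \ox (m'' \ox m))) :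
  (forall x : tens M (tens M' M''),
     tmap (Rmx form v u M M'') id
       (tassoc (tmap id (Rmx form v u M' M'') x))
     = sum_act (X := tmod (tmod M'' M) M') (idDelta_Theta_ v u)
         (ft' (tmap tflip id
                 (tassoc (tmap id tflip x)))))
  /\
  (forall x : tens (tens M M') M'',
     tmap id (Rmx form v u M M'')
       (tassocV (tmap (Rmx form v u M M') id x))
     = sum_act (X := tmod M' (tmod M'' M)) (Deltaid_Theta_ v u)
         (ft'' (tmap id tflip
                  (tassocV (tmap tflip id x))))).
Proof.
have lR N N' (hN : catO N) (hN' : catO N') := Rmx_linear hr hs hvu hN' hN.
split=> x.
- pose g x := tmap (Rmx form v u M M'') id (tassoc (tmap id (Rmx form v u M' M'') x)).
  pose h x := sum_act (X := tmod (tmod M'' M) M') (idDelta_Theta_ v u)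
    (ft' (tmap tflip id (tassoc (tmap id tflip x)))).
  have lg : linear g.
    move=> k y z; rewrite /g (tmap_linear (@id_linear _ _) (lR _ _ hM' hM'')).
    by rewrite (tassoc_linear _ _ _) (tmap_linear (lR _ _ hM hM'') (@id_linear _ _)).
  have lh : linear h.
    move=> k y z; rewrite /h (tmap_linear (@id_linear _ _) (@tflip_linear _ _ _)).
    rewrite (tassoc_linear _ _ _) (tmap_linear (@tflip_linear _ _ _) (@id_linear _ _)).
    (* Local finiteness at every vector makes the right-hand side linear, which permits the
       reduction to pure tensors of weight vectors, one tensor factor at a time. *)
    rewrite linearP; apply: (sum_act_linear (X := tmod (tmod M'' M) M')).
    exact: (idDelta_vanishes hr hs hform hvu).
  rewrite -[LHS]/(g x) -[RHS]/(h x); apply: tens_linear_ext x => // m y.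
  have lm (f : tens M (tens M' M'') -> tens (tens M'' M) M') y0 : linear f ->
      linear (fun m => f (m \ox y0)).
    by move=> lf k a b; rewrite pureDl pureZl lf.
  apply: (weight_linear_ext hM (lm _ y lg) (lm _ y lh)) => lam {}m hm.
  have ly (f : tens M (tens M' M'') -> tens (tens M'' M) M') : linear f ->
      linear (fun y => f (m \ox y)).
    by move=> lf k a b; rewrite pureDr pureZr lf.
  apply: (tens_linear_ext (ly _ lg) (ly _ lh)) => m' m''.
  have lm' (f : tens M (tens M' M'') -> tens (tens M'' M) M') m0 : linear f ->
      linear (fun m' => f (m \ox (m' \ox m0))).
    by move=> lf k a b; rewrite pureDl pureZl pureDr pureZr lf.
  apply: (weight_linear_ext hM' (lm' _ m'' lg) (lm' _ m'' lh)) => mu {}m' hm'.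
  have lm'' (f : tens M (tens M' M'') -> tens (tens M'' M) M') : linear f ->
      linear (fun m'' => f (m \ox (m' \ox m''))).
    by move=> lf k a b; rewrite !(pureDr, pureZr) lf.
  apply: (weight_linear_ext hM'' (lm'' _ lg) (lm'' _ lh)) => nu {}m'' hm''.
  rewrite /h (tmap_pure _ _ (@id_linear _ _) (@tflip_linear _ _ _)) tflip_pure.
  rewrite tassoc_pure (tmap_pure _ _ (@tflip_linear _ _ _) (@id_linear _ _)) tflip_pure.
  rewrite (hft' _ _ _ _ _ _ hm hm' hm'').
  exact: hexagon_idDelta_wt.
- pose g x := tmap id (Rmx form v u M M'') (tassocV (tmap (Rmx form v u M M') id x)).
  pose h x := sum_act (X := tmod M' (tmod M'' M)) (Deltaid_Theta_ v u)
    (ft'' (tmap id tflip (tassocV (tmap tflip id x)))).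
  have lg : linear g.
    move=> k y z; rewrite /g (tmap_linear (lR _ _ hM hM') (@id_linear _ _)).
    by rewrite (tassocV_linear _ _ _) (tmap_linear (@id_linear _ _) (lR _ _ hM hM'')).
  have lh : linear h.
    move=> k y z; rewrite /h (tmap_linear (@tflip_linear _ _ _) (@id_linear _ _)).
    rewrite (tassocV_linear _ _ _) (tmap_linear (@id_linear _ _) (@tflip_linear _ _ _)).
    rewrite linearP; apply: (sum_act_linear (X := tmod M' (tmod M'' M))).
    exact: (Deltaid_vanishes hr hs hvu).
  rewrite -[LHS]/(g x) -[RHS]/(h x); apply: tens_linear_ext x => // y m''.
  have ly (f : tens (tens M M') M'' -> tens M' (tens M'' M)) m0 : linear f ->
      linear (fun y => f (y \ox m0)).
    by move=> lf k a b; rewrite pureDl pureZl lf.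
  apply: (tens_linear_ext (ly _ m'' lg) (ly _ m'' lh)) => m m'.
  have lm (f : tens (tens M M') M'' -> tens M' (tens M'' M)) m0 m1 : linear f ->
      linear (fun m => f ((m \ox m0) \ox m1)).
    by move=> lf k a b; rewrite !(pureDl, pureZl) lf.
  apply: (weight_linear_ext hM (lm _ m' m'' lg) (lm _ m' m'' lh)) => lam {}m hm.
  have lm' (f : tens (tens M M') M'' -> tens M' (tens M'' M)) m0 : linear f ->
      linear (fun m' => f ((m \ox m') \ox m0)).
    by move=> lf k a b; rewrite pureDr pureZr pureDl pureZl lf.
  apply: (weight_linear_ext hM' (lm' _ m'' lg) (lm' _ m'' lh)) => mu {}m' hm'.
  have lm'' (f : tens (tens M M') M'' -> tens M' (tens M'' M)) : linear f ->
      linear (fun m'' => f ((m \ox m') \ox m'')).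
    by move=> lf k a b; rewrite pureDr pureZr lf.
  apply: (weight_linear_ext hM'' (lm'' _ lg) (lm'' _ lh)) => nu {}m'' hm''.
  rewrite /h (tmap_pure _ _ (@tflip_linear _ _ _) (@id_linear _ _)) tflip_pure.
  rewrite tassocV_pure (tmap_pure _ _ (@id_linear _ _) (@tflip_linear _ _ _)) tflip_pure.
  rewrite (hft'' _ _ _ _ _ _ hm hm' hm'').
  exact: hexagon_Deltaid_wt.
Qed.
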